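(* Fix $\Phi,\Psi\in H^3_{LIL}$ and $T_0>0$. For each $\epsilon$ let $r,p$ be the solution of $$\dot r=\delta^+p,\qquad \dot p=\frac1m\,\delta^-(kr)$$ with initial data $$r(j,0)=\Phi(\epsilon j)/k(j),\qquad p(j,0)=\Psi(\epsilon j)\qquad(j\in\mathbb{Z}).$$ Put $$Q_\epsilon(X,\tau)=\mathcal{L}[k\,r(\cdot,\tau/\epsilon)](X/\epsilon),\qquad P_\epsilon(X,\tau)=\mathcal{L}[p(\cdot,\tau/\epsilon)](X/\epsilon).$$ Suppose that $Q_0(X,\tau)$ and $P_0(X,\tau)$ solve $$\partial_\tau Q_0=\tilde k\,\partial_XP_0,\qquad \partial_\tau P_0=\frac1{\bar m}\,\partial_XQ_0$$ with initial data $Q_0(X,0)=\Phi(X)$ and $P_0(X,0)=\Psi(X)$. Then, almost surely, $$\lim_{\epsilon\to0^+}\ \sup_{|\tau|\le T_0}\Bigl(\|Q_\epsilon(\cdot,\tau)-Q_0(\cdot,\tau)\|_{L^2(\mathbb{R})}+\|P_\epsilon(\cdot,\tau)-P_0(\cdot,\tau)\|_{L^2(\mathbb{R})}\Bigr)=0.$$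
   Context: Random coefficients: $\{m(j)\}_{j\in\mathbb{Z}}$ are i.i.d. random variables contained almost surely in an interval $[a_m,b_m]\subset(0,\infty)$, with mean $\bar m:=\mathbb{E}[m]$. $\{1/k(j)\}_{j\in\mathbb{Z}}$ are i.i.d. random variables contained almost surely in an interval $[a_k,b_k]\subset(0,\infty)$, and $\tilde k$ is defined by $1/\tilde k:=\mathbb{E}[1/k]$. Difference operators on sequences: $(\delta^+f)(j)=f(j+1)-f(j)$ and $(\delta^-f)(j)=f(j)-f(j-1)$. Products and quotients of sequences are taken componentwise. The dot denotes $d/dt$, and $r=r(j,t)$, $p=p(j,t)$ are real valued, $j\in\mathbb{Z}$, $t\in\mathbb{R}$; the solution of the (linear, bounded) system is the one with $r(\cdot,t),p(\cdot,t)\in\ell^2(\mathbb{Z})$. Interpolation operator: for $f\in\ell^2(\mathbb{Z})$ let $F[f](\kappa):=\frac1{2\pi}\sum_{j\in\mathbb{Z}}e^{-ij\kappa}f(j)$, let $\theta_\pi$ be the indicator function of $(-\pi,\pi)$, and let $\mathcal{F}^{-1}[v](x):=\int_{\mathbb{R}}v(\xi)e^{i\xi x}\,d\xi$. Then $\mathcal{L}[f](x):=\mathcal{F}^{-1}[\theta_\pi(\cdot)F[f](\cdot)](x)$, $x\in\mathbb{R}$. Function space: for integers $s\ge0$, $\|F\|_{H^s_{LIL}}:=\sum_{i=0}^s\bigl\|(1+|\cdot|\log\log(|\cdot|+e))^{1/2}F^{(i)}\bigr\|_{L^2(\mathbb{R})}$, and $H^s_{LIL}$ is the space of functions $F:\mathbb{R}\to\mathbb{R}$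 in $L^2$ with weak derivatives up to order $s$ for which this norm is finite (continuous representatives are used for point evaluation). *)

(* Defs.v *)
From HB Require Import structures.
From mathcomp Require Import all_boot all_order all_algebra.
From mathcomp Require Import all_classical all_reals all_analysis.
From mathcomp Require Import complex.

Set Implicit Arguments.
Unset Strict Implicit.
Unset Printing Implicit Defensive.

Import Order.TTheory GRing.Theory Num.Theory.
Import numFieldNormedType.Exports.

Local Open Scope classical_set_scope.
Local Open Scope ring_scope.
Local Open Scope complex_scope.

Section RandomSequences.
Context {d : measure_display} {T : measurableType d} {R : realType}.
Variable Pr : probability T R.

Definition independent_family (X : int -> T -> R) : Prop :=
  forall (s : seq int) (B : int -> set R),
    uniq s -> (forall j, measurable (B j)) ->
    Pr (\bigcap_(j in [set` s]) (X j @^-1` B j)) =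
    (\prod_(j <- s) Pr (X j @^-1` B j))%E.

Definition identically_distributed (X : int -> T -> R) : Prop :=
  forall (i j : int) (B : set R), measurable B ->
    Pr (X i @^-1` B) = Pr (X j @^-1` B).

Definition iid (X : int -> T -> R) : Prop :=
  [/\ forall j, measurable_fun [set: T] (X j),
      independent_family X & identically_distributed X].

End RandomSequences.

Section Lattice.
Context {R : realType}.
Implicit Types f g m k : int -> R.

Definition deltap f : int -> R := fun j => f (j + 1) - f j.
Definition deltam f : int -> R := fun j => f j - f (j - 1).

Definition ell2 f : Prop :=
  (\esum_(j in [set: int]) ((f j) ^+ 2)%:E < +oo)%E.

Definition lattice_solution m k (r0 p0 : int -> R) (r p : int -> R -> R) :
    Prop :=
  [/\ forall t, ell2 (r ^~ t) /\ ell2 (p ^~ t),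
      forall (j : int) (t : R), is_derive t (1 : R) (r j) (deltap (p ^~ t) j),
      forall (j : int) (t : R), is_derive t (1 : R) (p j)
        ((m j)^-1 * deltam (fun i => k i * r i t) j) &
      forall j, r j 0 = r0 j /\ p j 0 = p0 j].

End Lattice.

Section Interpolation.
Context {R : realType}.
Local Notation mu := (@lebesgue_measure R).

Definition expi (x : R) : R[i] := Complex (cos x) (sin x).

Definition cintegral (f : R -> R[i]) : R[i] :=
  Complex (Rintegral mu [set: R] (fun x => complex.Re (f x)))
          (Rintegral mu [set: R] (fun x => complex.Im (f x))).

Definition cmeasurable (D : set R) (f : R -> R[i]) : Prop :=
  measurable_fun D (fun x => complex.Re (f x)) /\
  measurable_fun D (fun x => complex.Im (f x)).

Definition L2norm (f : R -> R[i]) : \bar R :=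
  'N[mu]_2%:E[(fun x => (ComplexField.Normc.normc (f x))%:E)].

Definition theta_pi (x : R) : R[i] := (\1_(`]- pi, pi[) x)%:C.

Definition fourier_partial_sum (f : int -> R) (N : nat) (x : R) : R[i] :=
  ((2 * pi)^-1)%:C *
  \sum_(i < (N.*2).+1) let j := i%:Z - N%:Z in
     expi (- (j%:~R * x)) * (f j)%:C.

(* For f in l^2 the Fourier series is understood as a limit in L^2(-pi, pi),
   hence determines its sum only almost everywhere on that interval. *)
Definition is_fourier_series (f : int -> R) (G : R -> R[i]) : Prop :=
  cmeasurable `]- pi, pi[ G /\
  (L2norm (fun x => theta_pi x * (G x - fourier_partial_sum f N x))
     @[N --> \oo] --> 0%E).

(* An arbitrary representative; 0 if the series does not converge. *)
Definition fourier_series (f : int -> R) : R -> R[i] :=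
  xget (fun=> 0) [set G | is_fourier_series f G].

Definition inverse_fourier (v : R -> R[i]) (x : R) : R[i] :=
  cintegral (fun xi => v xi * expi (xi * x)).

Definition interpolation (f : int -> R) : R -> R[i] :=
  inverse_fourier (fun xi => theta_pi xi * fourier_series f xi).

End Interpolation.

Section WeightedSobolev.
Context {R : realType}.
Local Notation mu := (@lebesgue_measure R).

Definition test_function (phi : R -> R) : Prop :=
  (forall n x, derivable (derive1n n phi) x 1) /\
  (exists A, forall x, A < `|x| -> phi x = 0).

Definition weak_derivative (n : nat) (F G : R -> R) : Prop :=
  locally_integrable [set: R] G /\
  forall phi, test_function phi ->
    Rintegral mu [set: R] (fun x => F x * derive1n n phi x) =
    (-1) ^+ n * Rintegral mu [set: R] (fun x => G x * phi x).

Definition lil_weight (x : R) : R :=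
  Num.sqrt (1 + `|x| * ln (ln (`|x| + expR 1))).

(* DF i stands for the i-th weak derivative F^(i). *)
Definition HLIL_norm (s : nat) (DF : nat -> R -> R) : \bar R :=
  (\sum_(i < s.+1) 'N[mu]_2%:E[(fun x => (lil_weight x * DF i x)%:E)])%E.

Definition HLIL (s : nat) (F : R -> R) : Prop :=
  F \in Lfun mu 2%:E /\
  exists DF : nat -> R -> R,
    [/\ DF 0%N = F,
        forall i, (i <= s)%N -> weak_derivative i F (DF i) &
        (HLIL_norm s DF < +oo)%E].

End WeightedSobolev.

Section Wave.
Context {R : realType}.

(* Classical solution; arguments of Q and P are (X, tau). *)
Definition wave_solution (kt mb : R) (Phi Psi : R -> R) (Q P : R -> R -> R) :
    Prop :=
  [/\ forall z : R * R, differentiable (fun y : R * R => Q y.1 y.2) z /\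
                        differentiable (fun y : R * R => P y.1 y.2) z,
      forall X tau, derive1 (Q X) tau = kt * derive1 (P ^~ tau) X,
      forall X tau, derive1 (P X) tau = mb^-1 * derive1 (Q ^~ tau) X &
      forall X, Q X 0 = Phi X /\ P X 0 = Psi X].

End Wave.

(* Main.v *)
Require Import Defs.
From HB Require Import structures.
From mathcomp Require Import all_boot all_order all_algebra.
From mathcomp Require Import all_classical all_reals all_analysis.
From mathcomp Require Import measurable_realfun complex.
From mathcomp Require Import zify ring lra.

Set Implicit Arguments.
Unset Strict Implicit.
Unset Printing Implicit Defensive.

Import Order.TTheory GRing.Theory Num.Theory.
Import numFieldNormedType.Exports.

Local Open Scope classical_set_scope.
Local Open Scope ring_scope.
Local Open Scope complex_scope.

(* Put q = k r and kap = 1/k: the lattice reads kap q' = delta^+ p, m p' = delta^- q, and the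
   energy, the sum over j of kap q^2 + m p^2, controls the l^2 norm. By d'Alembert's formula the
   wave (Q0, P0) is the superposition of two profiles travelling at speeds +s and -s, with
   s^2 = ktilde/mbar. The profiles are approximated in L^2 by smooth compactly supported ones, the
   error being propagated by the energy both on the lattice and in the limit. For a smooth
   compactly supported profile f, the field f(e j + s e t) is corrected by e zeta(j) f' and
   e chi(j) f', where delta^+ chi = ktilde/k - 1 and delta^- zeta = m/mbar - 1; the energy of the
   remaining error is small over times of order 1/e as soon as e chi and e zeta are small on the
   sites |j| <= C/e, which is the strong law of large numbers. Finally, band-limited interpolation
   is compared with piecewise constant interpolation by a Bessel inequality applied to each
   translate. *)

(** * Sums over the integers *)

(** The randomness is spent at once: on one almost sure event, fixed before the scale, the
    correctors are sublinear, and from there on every estimate is deterministic. A solution is only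
    assumed to lie in l^2 at each time, with no uniformity in time, so that even the boundedness of
    the total energy on a time interval has to be proved before Gronwall's inequality can be used;
    truncated energies and a Baire argument supply it. Beyond the hypothesis [ell2], lattice sums
    stay finite: l^2 bounds are bounds on the sums over |j| <= N, uniform in N. Approximating the
    data in L^2 does not by itself control their samples at the sites e j; a modulus of continuity
    whose squares are summable over cells is therefore carried along. The order of choices is: the
    smooth profiles from the prescribed accuracy, then the size of the correctors, then e; it is
    consistent because the amplification of the initial error depends on neither the profiles nor e.
    The arbitrary representative of a Fourier series is only used through real scalar products over
    a period. *)

Section IntSums.
Variable V : nmodType.

(** The symmetric range is built outwards from the origin: an induction step adds one opposite pair
    of sites, and any commutative monoid can be the target, the extended reals included. [zsumE]
    gives the usual big sum. *)
Fixpoint zsum (N : nat) (F : int -> V) : V :=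
  if N is N'.+1 then zsum N' F + F N%:Z + F (- N%:Z) else F 0.

Lemma zsumE N F : zsum N F = \sum_(i < N.*2.+1) F (i%:Z - N%:Z).
Proof.
elim: N => [|N IH] /=; first by rewrite big_ord1 subrr.
rewrite IH [in RHS]big_ord_recl [in RHS]big_ord_recr /= addrC; congr (_ + _).
  by rewrite sub0r.
congr (_ + _).
  apply: eq_bigr => i _; congr F.
  by move: (nat_of_ord i) => k; rewrite /bump /= add1n; lia.
by congr F; rewrite -/(double N) /bump /= add1n -addnn; lia.
Qed.

Lemma eq_zsum N F G : (forall j, (`|j| <= N)%N -> F j = G j) -> zsum N F = zsum N G.
Proof.
elim: N => [|N IH] h /=; first exact: h.
rewrite IH => [|j hj]; last by apply: h; apply: leq_trans hj _.
by congr (_ + _ + _); apply: h; rewrite ?abszN.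
Qed.

Lemma zsumD N F G : zsum N (fun j => F j + G j) = zsum N F + zsum N G.
Proof. by elim: N => //= N ->; rewrite [RHS]addrACA (addrACA (zsum N F)). Qed.

Lemma zsum0 N : zsum N (fun=> 0) = 0.
Proof. by elim: N => //= N ->; rewrite !addr0. Qed.

Lemma zsum_widen N M F : (N <= M)%N ->
  (forall j, (N < `|j|)%N -> F j = 0) -> zsum M F = zsum N F.
Proof.
move=> /subnK <- F0; elim: (M - N)%N => //= k IH.
by rewrite IH !F0 ?addr0 ?abszN //= ltnS leq_addl.
Qed.

Lemma zsum_delta N (n : int) (c : V) :
  zsum N (fun j => if j == n then c else 0) = if (`|n| <= N)%N then c else 0.
Proof.
elim: N => [|N IH] /=; first by rewrite leqn0 absz_eq0 eq_sym.
rewrite IH; case: (ltngtP `|n|%N N.+1) => nN.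
- have -> : (N.+1%:Z == n) = false by apply/eqP; lia.
  have -> : (- N.+1%:Z == n) = false by apply/eqP; lia.
  by rewrite !addr0 -ltnS nN.
- have -> : (N.+1%:Z == n) = false by apply/eqP; lia.
  have -> : (- N.+1%:Z == n) = false by apply/eqP; lia.
  by rewrite !addr0 leqNgt (ltn_trans _ nN).
- rewrite nN ltnn add0r; case: (eqVneq N.+1%:Z n) => e1.
    have -> : (- N.+1%:Z == n) = false by apply/eqP; lia.
    by rewrite addr0.
  have -> : (- N.+1%:Z == n) = true by apply/eqP; move/eqP: e1; lia.
  by rewrite add0r.
Qed.

End IntSums.

Section RealIntSums.
Variable R : realType.
Implicit Types F G : int -> R.

Lemma zsumZ N (c : R) F : zsum N (fun j => c * F j) = c * zsum N F.
Proof. by elim: N => //= N ->; rewrite !mulrDr. Qed.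

Lemma zsumN N F : zsum N (fun j => - F j) = - zsum N F.
Proof. by elim: N => //= N ->; rewrite !opprD. Qed.

Lemma zsumB N F G : zsum N (fun j => F j - G j) = zsum N F - zsum N G.
Proof. by rewrite -zsumN -zsumD. Qed.

Lemma ler_zsum N F G : (forall j, (`|j| <= N)%N -> F j <= G j) -> zsum N F <= zsum N G.
Proof.
elim: N => [|N IH] h /=; first exact: h.
apply: lerD; last by apply: h; rewrite abszN.
apply: lerD; last exact: h.
by apply: IH => j hj; apply: h; apply: leq_trans hj _.
Qed.

Lemma zsum_cst N (c : R) : zsum N (fun=> c) = N.*2.+1%:R * c.
Proof.
elim: N => [|N IH] /=; first by rewrite mul1r.
by rewrite IH doubleS -[N.*2.+3%:R]/(1 + (1 + N.*2.+1)%:R) natrD; ring.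
Qed.

Lemma zsum_mono N M F : (forall j, 0 <= F j) -> (N <= M)%N -> zsum N F <= zsum M F.
Proof.
move=> F0 /subnK <-; elim: (M - N)%N => //= k IH.
by rewrite -addrA (le_trans IH) // lerDl addr_ge0.
Qed.

Lemma zsum_telescope N F : zsum N (fun j => F (j + 1) - F j) = F N.+1%:Z - F (- N%:Z).
Proof.
elim: N => [|N IH] /=; first by rewrite add0r oppr0.
rewrite IH.
have -> : N.+1%:Z + 1 = N.+2%:Z by lia.
have -> : - N.+1%:Z + 1 = - N%:Z by lia.
ring.
Qed.

Lemma zsum_shift_le N F : (forall j, 0 <= F j) ->
  zsum N (fun j => F (j + 1)) <= zsum N.+1 F.
Proof.
move=> F0.
have := zsum_telescope N F; rewrite zsumB => /eqP; rewrite subr_eq => /eqP -> /=.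
by have := F0 (- N%:Z); have := F0 (- N.+1%:Z); lra.
Qed.

Lemma zsum_is_derive N (F dF : int -> R -> R) (t : R) :
  (forall j, is_derive t (1 : R) (F j) (dF j t)) ->
  is_derive t (1 : R) (fun s => zsum N (F ^~ s)) (zsum N (dF ^~ t)).
Proof.
move=> h; elim: N => [|N IH] /=; first exact: h.
have h1 := h N.+1%:Z; have h2 := h (- N.+1%:Z).
exact: is_deriveD.
Qed.

Lemma zsum_continuous N (F : int -> R -> R) :
  (forall j, continuous (F j)) -> continuous (fun s => zsum N (F ^~ s)).
Proof.
move=> h; elim: N => [|N IH] /= t; first exact: h.
by apply: cvgD; [apply: cvgD; [exact: IH|exact: h]|exact: h].
Qed.

End RealIntSums.

(** * Energy estimates for the lattice *)

Section RealDerivatives.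
Variable R : realType.
Implicit Types (f g : R -> R) (x a b c : R).

Lemma derD f g x a b : is_derive x (1 : R) f a -> is_derive x (1 : R) g b ->
  is_derive x (1 : R) (fun y => f y + g y) (a + b).
Proof. by move=> ? ?; apply: is_deriveD. Qed.

Lemma derN f x a : is_derive x (1 : R) f a ->
  is_derive x (1 : R) (fun y => - f y) (- a).
Proof. by move=> ?; apply: is_deriveN. Qed.

Lemma derB f g x a b : is_derive x (1 : R) f a -> is_derive x (1 : R) g b ->
  is_derive x (1 : R) (fun y => f y - g y) (a - b).
Proof. by move=> ? ?; apply: is_deriveB. Qed.

Lemma derM f g x a b : is_derive x (1 : R) f a -> is_derive x (1 : R) g b ->
  is_derive x (1 : R) (fun y => f y * g y) (a * g x + f x * b).
Proof.
move=> ? ?; apply: (is_derive_eq (is_deriveM _ _)).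
by rewrite addrC /GRing.scale /= mulrC.
Qed.

Lemma derC c x : is_derive x (1 : R) (fun=> c) 0.
Proof. exact: is_derive_cst. Qed.

Lemma derI x : is_derive x (1 : R) (fun y => y) 1.
Proof. exact: is_derive_id. Qed.

Lemma derZ c f x a : is_derive x (1 : R) f a ->
  is_derive x (1 : R) (fun y => c * f y) (c * a).
Proof. by move=> h; apply: is_derive_eq (derM (derC c x) h) _; rewrite mul0r add0r. Qed.

Lemma der_comp f g x a b : is_derive (g x) (1 : R) f a -> is_derive x (1 : R) g b ->
  is_derive x (1 : R) (fun y => f (g y)) (a * b).
Proof. exact: is_derive1_comp. Qed.

Lemma der_affine f x a b c : is_derive (b * x + c) (1 : R) f a ->
  is_derive x (1 : R) (fun y => f (b * y + c)) (a * b).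
Proof.
move=> h; apply: der_comp => //.
by apply: is_derive_eq (derD (derZ b (derI x)) (derC c x)) _; rewrite mulr1 addr0.
Qed.

Lemma der_continuous f x a : is_derive x (1 : R) f a -> {for x, continuous f}.
Proof. by case=> d _; apply: differentiable_continuous; apply/derivable1_diffP. Qed.

Lemma der_sqr f x a : is_derive x (1 : R) f a ->
  is_derive x (1 : R) (fun y => f y ^+ 2) (2 * (f x * a)).
Proof. by move=> h; apply: is_derive_eq (derM h h) _; ring. Qed.

Lemma derE f x a : is_derive x (1 : R) f a -> derive1 f x = a.
Proof. by move=> h; rewrite derive1E (@derive_val _ _ _ _ _ _ _ h). Qed.

Lemma derMVT f df (a b : R) : a <= b -> (forall x, a <= x <= b -> is_derive x (1 : R) f (df x)) ->
  exists2 c, a <= c <= b & f b - f a = df c * (b - a).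
Proof.
rewrite le_eqVlt => /predU1P[<-|ab] h.
  by exists a; rewrite ?lexx // !subrr mulr0.
have [||c + e] := @MVT R f df a b ab.
- move=> x; rewrite in_itv /= => /andP[x1 x2]; apply: h; lra.
- apply: derivable_within_continuous => x; rewrite in_itv /= => xab.
  by have [] := h x xab.
- by rewrite in_itv /= => /andP[c1 c2]; exists c => //; lra.
Qed.

Lemma gronwall f df (a b lam c : R) : a <= b -> 0 <= lam -> 0 <= c ->
  (forall t, a <= t <= b -> is_derive t (1 : R) f (df t)) ->
  (forall t, a <= t <= b -> df t <= lam * f t + c) ->
  f b <= expR (lam * (b - a)) * (f a + c * (b - a)).
Proof.
move=> ab lam0 c0 hf hdf.
pose g t := expR ((- lam) * t + lam * a) * f t - c * t.
have hg t : a <= t <= b -> is_derive t (1 : R) g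
    (expR ((- lam) * t + lam * a) * (df t - lam * f t) - c).
  move=> tab; have h1 : is_derive t (1 : R) (fun t => expR ((- lam) * t + lam * a))
     (expR ((- lam) * t + lam * a) * (- lam)) by apply: der_affine; apply: is_derive_expR.
  apply: is_derive_eq (derB (derM h1 (hf t tab)) (derZ c (derI t))) _; ring.
have [t tab] := derMVT ab hg.
rewrite /g => /eqP; rewrite subr_eq => /eqP e.
have e1 : expR (- lam * t + lam * a) <= 1.
  by rewrite -expR0 ler_expR; have := mulr_ge0 lam0 (_ : 0 <= t - a); rewrite mulrBr; lra.
have e2 := expR_ge0 (- lam * t + lam * a).
have e3 : expR (- lam * t + lam * a) * (df t - lam * f t) <= c.
  apply: (@le_trans _ _ (expR (- lam * t + lam * a) * c)).
    by rewrite ler_wpM2l // lerBlDl; apply: hdf.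
  by rewrite ler_piMl.
have e4 : expR (- lam * b + lam * a) * f b <= f a + c * (b - a).
  have -> : f a + c * (b - a) = 0 * (b - a) + (expR (- lam * a + lam * a) * f a - c * a) + c * b.
    by rewrite mulNr addNr expR0; ring.
  rewrite -lerBlDr e lerD2r ler_wpM2r; lra.
have -> : f b = expR (lam * (b - a)) * (expR (- lam * b + lam * a) * f b).
  by rewrite mulrA -expRD (_ : _ + _ = 0) ?expR0 ?mul1r //; ring.
by rewrite ler_wpM2l // expR_ge0.
Qed.

End RealDerivatives.

Section Energy.
Variable R : realType.

Definition hat_weight (K : nat) (j : int) : R := Num.max 0 (1 - `|j|%:~R / K%:R).

Lemma hat_weight_ge0 K j : 0 <= hat_weight K j.
Proof. by rewrite /hat_weight le_max lexx. Qed.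

Lemma hat_weight_le1 K j : hat_weight K j <= 1.
Proof.
by rewrite /hat_weight ge_max ler01 /= lerBlDr lerDl divr_ge0 // ler0z.
Qed.

Lemma hat_weight_out K j : (0 < K)%N -> (K <= `|j|)%N -> hat_weight K j = 0.
Proof.
move=> K0 Kj; rewrite /hat_weight max_l // subr_le0 ler_pdivlMr ?ltr0n // mul1r.
by rewrite -[`|j|]abszE -pmulrn ler_nat.
Qed.

Lemma hat_weight_in K j : (0 < K)%N -> (`|j| <= K)%N -> hat_weight K j = 1 - `|j|%:~R / K%:R.
Proof.
move=> K0 Kj; rewrite /hat_weight max_r // subr_ge0 ler_pdivrMr ?ltr0n // mul1r.
by rewrite -[`|j|]abszE -pmulrn ler_nat.
Qed.

Lemma hat_weight_lip K j : (0 < K)%N -> `|hat_weight K (j + 1) - hat_weight K j| <= K%:R^-1.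
Proof.
move=> K0; rewrite /hat_weight.
have h1 : `| `|j + 1|%:~R / K%:R - `|j|%:~R / K%:R : R| <= K%:R^-1.
  rewrite -mulrBl normrM (@ger0_norm _ K%:R^-1) ?invr_ge0 //.
  rewrite ler_piMl ?invr_ge0 // -rmorphB /= -intr_norm (_ : 1 = 1%:~R) // ler_int.
  lia.
move: h1; set a := _ / _; set b := _ / _; rewrite !ler_norml.
by case: (leP 0 (1 - a)); case: (leP 0 (1 - b)); lra.
Qed.

(** Division by K followed by K -> oo, stated without a limit. It removes the boundary and flux
    errors of order 1/K produced by a cut-off of width K. *)
Lemma archimedean_le (A B C : R) (N : nat) :
  (forall K : nat, (N <= K)%N -> A * K%:R <= B * K%:R + C) -> A <= B.
Proof.
move=> h; rewrite leNgt; apply/negP => BA.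
pose K := maxn N (Num.truncn (C / (A - B))).+1.
have := h K (leq_maxl _ _); apply/negP; rewrite -ltNge.
have AB : 0 < A - B by rewrite subr_gt0.
have : C / (A - B) < K%:R.
  apply: lt_le_trans (truncnS_gt _) _; rewrite ler_nat; exact: leq_maxr.
by rewrite ltr_pdivrMr // mulrBr; lra.
Qed.

Variables (kap mu : int -> R) (lo hi : R).
Hypothesis lo_gt0 : 0 < lo.
Hypothesis kap_bnd : forall j, lo <= kap j <= hi.
Hypothesis mu_bnd : forall j, lo <= mu j <= hi.

Definition energy (q p : int -> R -> R) (t : R) (j : int) : R :=
  kap j * q j t ^+ 2 + mu j * p j t ^+ 2.

(** The forcing is added before division by the coefficients, so that any differentiable pair, in
    particular an approximate solution, solves such a system with its own residuals as [a] and
    [b]. *)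
Definition forced_lattice (q p a b : int -> R -> R) : Prop :=
  (forall j t, is_derive t (1 : R) (q j) ((kap j)^-1 * (p (j + 1) t - p j t + a j t))) /\
  (forall j t, is_derive t (1 : R) (p j) ((mu j)^-1 * (q j t - q (j - 1) t + b j t))).

Lemma kap_gt0 j : 0 < kap j. Proof. by have /andP[h _] := kap_bnd j; apply: lt_le_trans h. Qed.
Lemma mu_gt0 j : 0 < mu j. Proof. by have /andP[h _] := mu_bnd j; apply: lt_le_trans h. Qed.

Lemma energy_ge0 q p t j : 0 <= energy q p t j.
Proof. by rewrite addr_ge0 // mulr_ge0 ?sqr_ge0 // ltW // (kap_gt0, mu_gt0). Qed.

Lemma energy_le q p t j : energy q p t j <= hi * (q j t ^+ 2 + p j t ^+ 2).
Proof.
rewrite mulrDr lerD // ler_wpM2r ?sqr_ge0 //.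
  by have /andP[] := kap_bnd j.
by have /andP[] := mu_bnd j.
Qed.

Lemma energy_ge q p t j : lo * (q j t ^+ 2 + p j t ^+ 2) <= energy q p t j.
Proof.
rewrite mulrDr lerD // ler_wpM2r ?sqr_ge0 //.
  by have /andP[] := kap_bnd j.
by have /andP[] := mu_bnd j.
Qed.

Lemma energy_is_derive q p a b (t : R) j : forced_lattice q p a b ->
  is_derive t (1 : R) (fun s => energy q p s j)
   (2 * (q j t * p (j + 1) t - q (j - 1) t * p j t + (q j t * a j t + p j t * b j t))).
Proof.
case=> hq hp.
apply: is_derive_eq (derD (derZ (kap j) (der_sqr (hq j t))) (derZ (mu j) (der_sqr (hp j t)))) _.
by field; rewrite (gt_eqF (kap_gt0 j)) (gt_eqF (mu_gt0 j)).
Qed.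

Lemma young (lam k x y : R) : 0 < lam -> 0 < k ->
  2 * (x * y) <= lam * (k * x ^+ 2) + lam^-1 * (k^-1 * y ^+ 2).
Proof.
move=> l0 k0; rewrite -subr_ge0.
have -> : lam * (k * x ^+ 2) + lam^-1 * (k^-1 * y ^+ 2) - 2 * (x * y) =
  lam * k * (x - y / (lam * k)) ^+ 2 by field; rewrite !gt_eqF.
by rewrite mulr_ge0 ?sqr_ge0 // mulr_ge0 // ltW.
Qed.

(* Nothing is known about the time derivative of the total energy, so it is truncated by a hat
   of width K, at the price of a flux term of order 1/K. *)
Lemma energy_gronwall q p a b (t0 t1 M lam S E0 : R) :
  forced_lattice q p a b -> t0 <= t1 -> 0 < lam -> 0 <= S ->
  (forall N t, t0 <= t <= t1 -> zsum N (fun j => q j t ^+ 2 + p j t ^+ 2) <= M) ->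
  (forall N t, t0 <= t <= t1 ->
     zsum N (fun j => (kap j)^-1 * a j t ^+ 2 + (mu j)^-1 * b j t ^+ 2) <= S) ->
  (forall N, zsum N (energy q p t0) <= E0) ->
  forall N, zsum N (energy q p t1) <= expR (lam * (t1 - t0)) * (E0 + S / lam * (t1 - t0)).
Proof.
move=> hs t01 lam0 S0 hM hS hE0 N.
have M0 : 0 <= M.
  by apply: le_trans (hM 0%N t0 _) => /=; rewrite ?lexx // addr_ge0 ?sqr_ge0.
set ex := expR _.
have ex0 : 0 <= ex by apply: expR_ge0.
(* Multiplied by K, the weight loses at most N times the sum over |j| <= N, and the flux contributes
   at most [M + M] per unit of time; both stay bounded as K grows. *)
apply: (@archimedean_le _ _ (N%:R * zsum N (energy q p t1) + ex * ((M + M) * (t1 - t0))) N.+1) => K NK.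
have K0 : (0 < K)%N by apply: leq_trans NK.
have K0R : (0 : R) < K%:R by rewrite ltr0n.
pose w := hat_weight K.
pose Ew t := zsum K (fun j => w j * energy q p t j).
pose dE t j := 2 * (q j t * p (j + 1) t - q (j - 1) t * p j t + (q j t * a j t + p j t * b j t)).
have hEw t : is_derive t (1 : R) Ew (zsum K (fun j => w j * dE t j)).
  apply: (@zsum_is_derive R K (fun j s => w j * energy q p s j) (fun j s => w j * dE s j)) => j.
  by apply: derZ; apply: energy_is_derive.
have key t : t0 <= t <= t1 -> zsum K (fun j => w j * dE t j) <= lam * Ew t + (S / lam + (M + M) / K%:R).
  move=> tt.
  (* Summation by parts: the weighted flux is a telescoping sum of [g], whose boundary terms vanish
     with the hat, plus the flux against the increments of the hat, which are at most 1/K. *)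
  pose g j := w j * (q (j - 1) t * p j t).
  have -> : zsum K (fun j => w j * dE t j) =
     2 * zsum K (fun j => g (j + 1) - g j)
     + (zsum K (fun j => - (2 * ((w (j + 1) - w j) * (q j t * p (j + 1) t))))
     + zsum K (fun j => w j * (2 * (q j t * a j t + p j t * b j t)))).
    rewrite -zsumZ -zsumD -zsumD; apply: eq_zsum => j _.
    by rewrite /g /dE addrK; ring.
  have w1 : w K.+1%:Z = 0 by apply: hat_weight_out => //; lia.
  have w2 : w (- K%:Z) = 0 by apply: hat_weight_out => //; lia.
  rewrite zsum_telescope /g w1 w2.
  rewrite !mul0r subr0 mulr0 add0r addrC addrA; apply: lerD.
    rewrite -[Ew t]/(zsum K _) -zsumZ.
    apply: (@le_trans _ _ (zsum K (fun j => lam * (w j * energy q p t j)) +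
       lam^-1 * zsum K (fun j => (kap j)^-1 * a j t ^+ 2 + (mu j)^-1 * b j t ^+ 2))); last first.
      by rewrite lerD2l [S / lam]mulrC ler_pM2l ?invr_gt0 //; apply: hS.
    rewrite -zsumZ -zsumD; apply: ler_zsum => j _.
    have wj0 := hat_weight_ge0 K j; have wj1 := hat_weight_le1 K j.
    have k0 := kap_gt0 j; have m0 := mu_gt0 j.
    apply: (@le_trans _ _ (w j * (lam * energy q p t j + lam^-1 * ((kap j)^-1 * a j t ^+ 2 + (mu j)^-1 * b j t ^+ 2)))); last first.
      rewrite mulrDr; apply: lerD; first by rewrite mulrCA.
      apply: ler_piMl => //; apply: mulr_ge0; first by rewrite invr_ge0 ltW.
      by rewrite addr_ge0 // mulr_ge0 ?sqr_ge0 // invr_ge0 ltW.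
    apply: ler_wpM2l => //.
    have y1 := young (q j t) (a j t) lam0 k0.
    have y2 := young (p j t) (b j t) lam0 m0.
    by have := lerD y1 y2; rewrite addrACA -!mulrDr.
  apply: (@le_trans _ _ (zsum K (fun j => K%:R^-1 * q j t ^+ 2) + zsum K (fun j => K%:R^-1 * p (j + 1) t ^+ 2))).
    rewrite -zsumD; apply: ler_zsum => j _.
    have := hat_weight_lip j K0; rewrite -/w ler_norml => /andP[l1 l2].
    rewrite -mulrDr -mulrN.
    set d := w (j + 1) - w j in l1 l2 *.
    set x := q j t; set y := p (j + 1) t.
    have n1 : 0 <= (K%:R^-1 - d) * (x - y) ^+ 2 by rewrite mulr_ge0 ?sqr_ge0 // subr_ge0.
    have n2 : 0 <= (K%:R^-1 + d) * (x + y) ^+ 2 by rewrite mulr_ge0 ?sqr_ge0 // -lerBlDl sub0r.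
    rewrite -subr_ge0.
    have -> : K%:R^-1 * (x ^+ 2 + y ^+ 2) - 2 * - (d * (x * y)) =
      2^-1 * ((K%:R^-1 - d) * (x - y) ^+ 2 + (K%:R^-1 + d) * (x + y) ^+ 2).
      by field; rewrite gt_eqF.
    by rewrite mulr_ge0 ?invr_ge0 // addr_ge0.
  rewrite !zsumZ -mulrDr [_ / K%:R]mulrC ler_pM2l ?invr_gt0 //; apply: lerD.
    apply: le_trans (hM K t tt); apply: ler_zsum => j _.
    by rewrite lerDl sqr_ge0.
  apply: le_trans (hM K.+1 t tt).
  apply: le_trans (zsum_shift_le K (fun j => sqr_ge0 (p j t))) _.
  by apply: ler_zsum => j _; rewrite lerDr sqr_ge0.
have S1 : 0 <= S / lam by rewrite divr_ge0 // ltW.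
have C0 : 0 <= S / lam + (M + M) / K%:R by rewrite addr_ge0 // divr_ge0 // addr_ge0.
have := gronwall t01 (ltW lam0) C0 (fun t _ => hEw t) key.
rewrite -/ex => G.
have E00 : Ew t0 <= E0.
  apply: le_trans (hE0 K); apply: ler_zsum => j _.
  by apply: ler_piMl; [exact: energy_ge0|exact: hat_weight_le1].
have L : (1 - N%:R / K%:R) * zsum N (energy q p t1) <= Ew t1.
  apply: (@le_trans _ _ (zsum N (fun j => w j * energy q p t1 j))); last first.
    by apply: zsum_mono => [j|]; [rewrite mulr_ge0 ?hat_weight_ge0 ?energy_ge0|exact: ltnW].
  rewrite -zsumZ; apply: ler_zsum => j jN; apply: ler_wpM2r; first exact: energy_ge0.
  rewrite /w hat_weight_in //; last exact: leq_trans jN (ltnW NK).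
  by rewrite lerD2l lerN2 ler_pM2r ?invr_gt0 // -[`|j|]abszE -pmulrn ler_nat.
set Z := zsum N _ in L *.
have {}L : (K%:R - N%:R) * Z <= K%:R * (ex * (E0 + (S / lam + (M + M) / K%:R) * (t1 - t0))).
  have -> : K%:R - N%:R = K%:R * (1 - N%:R / K%:R) :> R by field; rewrite gt_eqF.
  rewrite -mulrA ler_pM2l //; apply: le_trans L _; apply: le_trans G _.
  by rewrite ler_wpM2l // lerD2r.
have e : K%:R * (ex * (E0 + (S / lam + (M + M) / K%:R) * (t1 - t0))) =
  ex * (E0 + S / lam * (t1 - t0)) * K%:R + ex * ((M + M) * (t1 - t0)).
  by field; rewrite !gt_eqF.
by move: L; rewrite e; lra.
Qed.

End Energy.

(** * Boundedness of the energy on time intervals *)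

Section LocalBoundedness.
Variable R : realType.

(** Continuous induction: for S the set of x such that one bound serves on [a, x], a local bound
    around sup S shows that sup S cannot lie below b. [Z s M] stands for a bound M at time s. *)
Lemma locally_bounded_segment (Z : R -> R -> Prop) (a b : R) : a <= b ->
  (forall t M M', M <= M' -> Z t M -> Z t M') ->
  (forall t, a <= t <= b -> exists e M : R, 0 < e /\
     forall s, a <= s <= b -> `|s - t| < e -> Z s M) ->
  exists M, forall s, a <= s <= b -> Z s M.
Proof.
move=> ab Zm loc.
pose S := [set x | a <= x <= b /\ exists M, forall s, a <= s <= x -> Z s M].
have Sa : S a.
  split; first by rewrite lexx.
  have [|e [M [e0 h]]] := loc a; first by rewrite lexx.
  exists M => s /andP[s1 s2]; apply: h; first by rewrite s1 (le_trans s2).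
  by rewrite (_ : s - a = 0) ?normr0 //; apply/eqP; rewrite subr_eq0 eq_le s1 s2.
have Sb : ubound S b by move=> x [/andP[]].
have hS : has_sup S by split; [exists a|exists b].
have ca : a <= sup S by apply: ub_le_sup => //; exists b.
have cb : sup S <= b by apply: ge_sup => //; exists a.
have [|e [M [e0 h]]] := loc (sup S); first by rewrite ca cb.
have [x [xab [M' hx]] xc] := sup_adherent e0 hS.
pose y := Num.min b (sup S + e / 2).
have yb : y <= b by rewrite /y ge_min lexx.
have yc : y <= sup S + e / 2 by rewrite /y ge_min lexx orbT.
have ya : a <= y by rewrite /y le_min ab /= (le_trans ca) // lerDl; lra.
have Sy : S y.
  split; first by rewrite ya yb.
  exists (Num.max M M') => s /andP[s1 s2].
  case: (lerP s x) => sx.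
    by apply: (@Zm _ M'); [rewrite le_max lexx orbT|apply: hx; rewrite s1 sx].
  apply: (@Zm _ M); first by rewrite le_max lexx.
  apply: h; first by rewrite s1 (le_trans s2).
  by rewrite ltr_norml; apply/andP; split; lra.
have yS : y <= sup S by apply: ub_le_sup => //; exists b.
have yE : y = b.
  move: yS; rewrite /y.
  case: (leP b (sup S + e / 2)) => [h1 h2|_ h2]; [lra|exfalso; lra].
by case: Sy => _ [M0 h0]; exists M0 => s hs; apply: h0; rewrite yE.
Qed.

Variables (kap mu : int -> R) (lo hi : R).
Hypothesis lo_gt0 : 0 < lo.
Hypothesis kap_bnd : forall j, lo <= kap j <= hi.
Hypothesis mu_bnd : forall j, lo <= mu j <= hi.
Local Notation system := (forced_lattice kap mu).

Definition ell2_le (q p : int -> R -> R) (t M : R) : Prop :=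
  forall N, zsum N (fun j => q j t ^+ 2 + p j t ^+ 2) <= M.

Definition free_lattice q p := system q p (fun _ _ => 0) (fun _ _ => 0).

Definition backward (f : int -> R -> R) : int -> R -> R := fun j t => f j (- t).

(** The energy estimate only runs forwards. Reversing time flips the sign of both time derivatives,
    and the change of sign of [p] restores the form of the system, so backward estimates follow. *)
Lemma forced_lattice_backward q p a b : system q p a b ->
  system (backward q) (fun j t => - p j (- t)) (fun j t => - a j (- t)) (backward b).
Proof.
case=> hq hp; split=> j t.
  have h := hq j (- t).
  have := @der_affine _ (q j) t _ (-1) 0; rewrite /backward mulN1r addr0 => /(_ _ h).
  rewrite (_ : (fun y => q j (-1 * y + 0)) = (fun y => q j (- y))); last first.
    by apply/funext => y; rewrite mulN1r addr0.
  by move=> h'; apply: is_derive_eq h' _; ring.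
have h := hp j (- t).
have := @der_affine _ (p j) t _ (-1) 0; rewrite /backward mulN1r addr0 => /(_ _ h).
rewrite (_ : (fun y => p j (-1 * y + 0)) = (fun y => p j (- y))); last first.
  by apply/funext => y; rewrite mulN1r addr0.
by move=> h'; apply: is_derive_eq (derN h') _; ring.
Qed.

Lemma free_lattice_backward q p : free_lattice q p ->
  free_lattice (backward q) (fun j t => - p j (- t)).
Proof.
move/forced_lattice_backward; rewrite /free_lattice /backward.
by rewrite (_ : (fun _ _ => - 0) = (fun _ _ => 0)) // oppr0.
Qed.

Lemma ell2_le_backward q p t M : ell2_le q p t M ->
  ell2_le (backward q) (fun j t => - p j (- t)) (- t) M.
Proof.
move=> h N; apply: le_trans (h N); apply: ler_zsum => j _.
by rewrite /backward opprK sqrrN.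
Qed.

Lemma energy_ell2 q p t M N : ell2_le q p t M ->
  zsum N (energy kap mu q p t) <= hi * M.
Proof.
move=> h; have hi0 : 0 < hi.
  by have /andP[h1 h2] := kap_bnd 0; apply: lt_le_trans lo_gt0 (le_trans h1 h2).
apply: (@le_trans _ _ (hi * zsum N (fun j => q j t ^+ 2 + p j t ^+ 2))).
  by rewrite -zsumZ; apply: ler_zsum => j _; apply: energy_le.
by rewrite ler_pM2l.
Qed.

Lemma ell2_energy q p t M : (forall N, zsum N (energy kap mu q p t) <= M) ->
  ell2_le q p t (lo^-1 * M).
Proof.
move=> h N; rewrite mulrC ler_pdivlMr // mulrC; apply: le_trans (h N).
by rewrite -zsumZ; apply: ler_zsum => j _; apply: energy_ge.
Qed.

Lemma ell2_le_ge0 q p t M : ell2_le q p t M -> 0 <= M.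
Proof. by move=> /(_ 0%N); apply: le_trans; rewrite addr_ge0 ?sqr_ge0. Qed.

(** A finite bound [M] over the interval is the price for discarding the flux, but its size is
    absent from the conclusion: qualitative boundedness becomes a bound by the initial value
    alone. *)
Lemma ell2_forward q p (t0 t1 M n : R) : free_lattice q p -> t0 <= t1 ->
  (forall t, t0 <= t <= t1 -> ell2_le q p t M) ->
  ell2_le q p t0 n -> ell2_le q p t1 (lo^-1 * (expR (t1 - t0) * (hi * n))).
Proof.
move=> fr t01 hM hn; apply: ell2_energy => N.
have S0 N' t : t0 <= t <= t1 ->
  zsum N' (fun j => (kap j)^-1 * 0 ^+ 2 + (mu j)^-1 * 0 ^+ 2) <= 0 :> R.
  move=> _; rewrite (_ : (fun j => _) = (fun=> 0)) ?zsum0 //.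
  by apply/funext => j; rewrite expr0n /= !mulr0 addr0.
have := energy_gronwall lo_gt0 kap_bnd mu_bnd fr t01 ltr01 (lexx 0)
  (fun N t h => hM t h N) S0 (fun N => energy_ell2 N hn) N.
by rewrite !mul1r mul0r mul0r addr0.
Qed.

(** The times that are not good form a closed set, and they are the only possible obstruction to the
    energy estimate; this set turns out to be empty as soon as the solution is in l^2 at each
    time. *)
Definition good q p (t : R) := exists e M : R, 0 < e /\ forall s, `|s - t| < e -> ell2_le q p s M.

Lemma good_backward q p t : good q p t -> good (backward q) (fun j t => - p j (- t)) (- t).
Proof.
move=> [e [M [e0 h]]]; exists e, M; split => // s hs.
rewrite -[s]opprK; apply: ell2_le_backward; apply: h.
by rewrite -normrN opprD opprK.
Qed.

Lemma ell2_le_mono q p t M M' : M <= M' -> ell2_le q p t M -> ell2_le q p t M'.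
Proof. by move=> MM' h N; apply: le_trans MM'. Qed.

Lemma good_segment q p a b : a <= b -> (forall t, a <= t <= b -> good q p t) ->
  exists M, forall s, a <= s <= b -> ell2_le q p s M.
Proof.
move=> ab h; apply: (locally_bounded_segment ab).
  by move=> t M M'; apply: ell2_le_mono.
move=> t tab; have [e [M [e0 hs]]] := h t tab.
by exists e, M; split => // s _; apply: hs.
Qed.

Lemma growth_ge q p t (n c : R) : 0 <= c -> 0 <= n -> ell2_le q p t n ->
  ell2_le q p t (lo^-1 * (expR c * (hi * n))).
Proof.
move=> c0 n0; apply: ell2_le_mono.
rewrite mulrC ler_pdivlMr // mulrA mulrC ler_wpM2r //.
have /andP[h1 h2] := kap_bnd 0.
apply: le_trans (le_trans h1 h2) _; apply: ler_peMl.
  exact: le_trans (ltW lo_gt0) (le_trans h1 h2).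
by rewrite -expR0 ler_expR.
Qed.

(* Boundedness on every [u, s] with u > c gives, by the backward estimate from s,
   a bound independent of u; the value at c is finite, so the forward estimate starts at c. *)
Lemma good_propagates q p (c s n : R) : free_lattice q p -> c <= s ->
  (forall u, c < u <= s -> good q p u) -> ell2_le q p c n ->
  ell2_le q p s (lo^-1 * (expR (s - c) * (hi * n))).
Proof.
move=> fr; rewrite le_eqVlt => /predU1P[<-|cs] hg hn.
  by apply: growth_ge => //; [rewrite subrr|exact: ell2_le_ge0 hn].
have [e [M [e0 hM]]] : good q p s by apply: hg; rewrite cs lexx.
have hs : ell2_le q p s M by apply: hM; rewrite subrr normr0.
pose B := lo^-1 * (expR (s - c) * (hi * M)).
have M0 := ell2_le_ge0 hs.
have hi0 : 0 < hi.
  by have /andP[h1 h2] := kap_bnd 0; apply: lt_le_trans lo_gt0 (le_trans h1 h2).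
have hu u : c < u <= s -> ell2_le q p u B.
  move=> /andP[cu us].
  have [|M' hM'] := @good_segment q p u s us.
    by move=> t /andP[t1 t2]; apply: hg; rewrite (lt_le_trans cu) //.
  have := @ell2_forward _ _ (- s) (- u) M' M (free_lattice_backward fr) _ _ (ell2_le_backward hs).
  rewrite lerN2 => /(_ us) h.
  have {}h : ell2_le q p u (lo^-1 * (expR (- u - - s) * (hi * M))).
    move=> N; have := h _ N; rewrite /backward opprK => h0.
    apply: le_trans (h0 _); first by apply: ler_zsum => j _; rewrite sqrrN.
    move=> t tt; rewrite -[t]opprK; apply: ell2_le_backward; apply: hM'.
    by move: tt => /andP[t1 t2]; rewrite lerNr t2 lerNl t1.
  apply: ell2_le_mono h; rewrite /B ler_pM2l ?invr_gt0 // ler_wpM2r //.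
    by rewrite mulr_ge0 // ltW.
  by rewrite ler_expR; lra.
apply: (@ell2_forward _ _ c s (Num.max B n) n fr (ltW cs)) => // t /andP[t1 t2].
move: t1; rewrite le_eqVlt => /predU1P[<-|ct].
  by apply: ell2_le_mono hn; rewrite le_max lexx orbT.
by apply: ell2_le_mono (hu t _); rewrite ?ct // le_max lexx.
Qed.

(** Start from the last bad time before [s]. The bad times being closed, it is itself bad, so the
    bound [n] holds there, and only good times lie between it and [s]: [good_propagates] applies. *)
Lemma bad_propagates q p (c s n : R) : free_lattice q p -> c <= s -> 0 <= n -> ~ good q p c ->
  (forall u, c <= u <= s -> ~ good q p u -> ell2_le q p u n) ->
  ell2_le q p s (lo^-1 * (expR (s - c) * (hi * n))).
Proof.
move=> fr cs n0 bc hb.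
case: (pselect (good q p s)) => gs; last first.
  by apply: growth_ge => //; [rewrite subr_ge0|apply: hb => //; rewrite cs lexx].
pose S := [set u | c <= u <= s /\ ~ good q p u].
have Sc : S c by split => //; rewrite lexx.
have Ss : ubound S s by move=> x [/andP[]].
have hS : has_sup S by split; [exists c|exists s].
have c1 : c <= sup S by apply: ub_le_sup; [exists s|].
have c2 : sup S <= s by apply: ge_sup => //; exists c.
have bS : ~ good q p (sup S).
  move=> [e [M [e0 h]]].
  have [u [ucs bu] uS] := sup_adherent e0 hS.
  have uS2 : u <= sup S by apply: ub_le_sup; [exists s|].
  apply: bu.
  exists (u - (sup S - e)), M; split; first lra.
  move=> v; rewrite ltr_norml => /andP[v1 v2]; apply: h.
  by rewrite ltr_norml; apply/andP; split; lra.
have hn : ell2_le q p (sup S) n by apply: hb => //; rewrite c1.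
apply: (@ell2_le_mono q p s (lo^-1 * (expR (s - sup S) * (hi * n)))); last first.
  apply: good_propagates => // u /andP[u1 u2]; apply: contrapT => bu.
  have : u <= sup S.
    by apply: ub_le_sup; [exists s|split => //; rewrite u2 (le_trans c1) // ltW].
  by rewrite leNgt u1.
have /andP[h1 h2] := kap_bnd 0.
have hi0 : 0 <= hi := le_trans (ltW lo_gt0) (le_trans h1 h2).
by rewrite ler_pM2l ?invr_gt0 // ler_wpM2r ?mulr_ge0 // ler_expR lerB.
Qed.

Lemma bad_ball_bound q p (c r n : R) : free_lattice q p -> 0 <= n -> ~ good q p c ->
  (forall u, `|u - c| < r -> ~ good q p u -> ell2_le q p u n) ->
  forall s, `|s - c| < r -> ell2_le q p s (lo^-1 * (expR `|s - c| * (hi * n))).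
Proof.
move=> fr n0 bc hb s; case: (lerP c s) => cs.
  move=> sr.
  apply: bad_propagates => // u /andP[u1 u2]; apply: hb.
  by rewrite ger0_norm ?subr_ge0 //; apply: le_lt_trans sr; rewrite lerB.
move=> sr.
have := @bad_propagates _ _ (- c) (- s) n (free_lattice_backward fr) _ n0.
rewrite lerN2 opprK [- s + c]addrC => /(_ (ltW cs)) h.
have {}h : ell2_le (backward q) (fun j t => - p j (- t)) (- s)
    (lo^-1 * (expR (c - s) * (hi * n))).
  apply: h.
    move=> /good_backward; rewrite /backward !opprK.
    rewrite (_ : (fun j t => q j (- - t)) = q); last first.
      by apply/funext => j; apply/funext => t; rewrite opprK.
    rewrite (_ : (fun j t => - - p j (- - t)) = p) //.
    by apply/funext => j; apply/funext => t; rewrite !opprK.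
  move=> u /andP[u1 u2] bu; rewrite -[u]opprK; apply: ell2_le_backward; apply: hb.
    by rewrite ltr_norml; apply/andP; split; lra.
  by move=> /good_backward; rewrite opprK.
move=> N; apply: le_trans (h N); apply: ler_zsum => j _.
by rewrite /backward opprK sqrrN.
Qed.

(** If the energy were at most n at every bad time within r of [c], [bad_ball_bound] would bound it
    on the whole ball, making [c] good. So some bad time has a finite partial sum above n, and the
    continuity of that finite sum extends this to a small closed interval. *)
Lemma bad_step q p (c r n : R) : free_lattice q p -> 0 < r -> 0 <= n -> ~ good q p c ->
  exists c' r' : R, [/\ 0 < r', `|c' - c| + r' < r, ~ good q p c' &
    forall s, `|s - c'| <= r' -> exists N, n < zsum N (fun j => q j s ^+ 2 + p j s ^+ 2)].
Proof.
move=> fr r0 n0 bc; apply: contrapT => H; apply: (bc).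
exists r, (lo^-1 * (expR r * (hi * n))); split => // s sr.
have /andP[h1 h2] := kap_bnd 0.
have hi0 : 0 <= hi := le_trans (ltW lo_gt0) (le_trans h1 h2).
apply: ell2_le_mono (bad_ball_bound fr n0 bc _ sr).
  by rewrite ler_pM2l ?invr_gt0 // ler_wpM2r ?mulr_ge0 // ler_expR ltW.
move=> u ur bu N; rewrite leNgt; apply/negP => nN; apply: H.
have cont : continuous (fun s => zsum N (fun j => q j s ^+ 2 + p j s ^+ 2)).
  apply: (@zsum_continuous R N (fun j s => q j s ^+ 2 + p j s ^+ 2)) => j t.
  case: fr => hq hp.
  exact: der_continuous (derD (der_sqr (hq j t)) (der_sqr (hp j t))).
have /nbhs_ballP[e /= e0 he] : \forall s \near u, n < zsum N (fun j => q j s ^+ 2 + p j s ^+ 2).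
  exact: (cvgr_gt _ (cont u) _ nN).
exists u, (Num.min (e / 2) ((r - `|u - c|) / 2)); split => //.
- by rewrite lt_min !divr_gt0 // subr_gt0.
- set m := Num.min _ _; have : m <= (r - `|u - c|) / 2 by rewrite ge_min lexx orbT.
  by move: ur; lra.
- move=> t; rewrite le_min => /andP[te _]; exists N; apply: he.
  by rewrite /ball /= distrC; move: te (e0 : 0 < e); lra.
Qed.

(* A Baire-type argument: were the energy unbounded near some time, nested closed intervals
   on which it exceeds 0, 1, 2, ... would meet in a time at which the solution is not in l^2. *)
Lemma free_lattice_good q p : free_lattice q p ->
  (forall t, exists M, ell2_le q p t M) -> forall t, good q p t.
Proof.
move=> fr fin t0; apply: contrapT => b0.
pose X := {x : R * R | 0 < x.2 /\ ~ good q p x.1}.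
have step (n : nat) (x : X) : exists y : X,
    `|(sval y).1 - (sval x).1| + (sval y).2 < (sval x).2 /\
    forall s, `|s - (sval y).1| <= (sval y).2 ->
      exists N, n%:R < zsum N (fun j => q j s ^+ 2 + p j s ^+ 2).
  case: x => -[c r] /= [r0 bc].
  have [c' [r' [r'0 hc bc' hs]]] := bad_step fr r0 (ler0n R n) bc.
  by exists (exist _ (c', r') (conj r'0 bc')).
pose nxt n x := projT1 (cid (step n x)).
have nxtP n x := projT2 (cid (step n x)).
pose x0 : X := exist _ (t0, 1) (conj ltr01 b0).
pose u := fix u n : X := if n is n'.+1 then nxt n' (u n') else x0.
pose l n := (sval (u n)).1 - (sval (u n)).2.
pose h n := (sval (u n)).1 + (sval (u n)).2.
have lS n : l n <= l n.+1.
  have [+ _] := nxtP n (u n); rewrite /l /= -/(nxt n (u n)).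
  by have := ler_norm ((sval (u n)).1 - (sval (nxt n (u n))).1); rewrite distrC; lra.
have hS n : h n.+1 <= h n.
  have [+ _] := nxtP n (u n); rewrite /h /= -/(nxt n (u n)).
  by have := ler_norm ((sval (nxt n (u n))).1 - (sval (u n)).1); lra.
have lm : {homo l : m n / (m <= n)%N >-> m <= n} by exact: homo_leq (@lexx _ _) (@le_trans _ _) lS.
have hm : {homo h : m n / (m <= n)%N >-> n <= m}.
  by apply: homo_leq => [x|y x z h1 h2|n]; [exact: lexx|exact: le_trans h2 h1|exact: hS].
have lh m n : l m <= h n.
  apply: le_trans (lm _ _ (leq_maxl m n)) _; apply: le_trans (hm _ _ (leq_maxr m n)).
  by rewrite /l /h; case: (u _) => -[c r] /= [r0 _]; lra.
pose t := sup (range l).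
have tl n : l n <= t by apply: ub_le_sup; [exists (h 0%N) => _ [m _ <-]|exists n].
have th n : t <= h n by apply: ge_sup; [exists (l 0%N), 0%N|move=> _ [m _ <-]].
have [M hM] := fin t.
have M0 := ell2_le_ge0 hM.
(* The interval selected at stage n carries energy above n, and n = [(Num.truncn M).+1] exceeds the
   bound [M] at the common point [t]. *)
have [_ /(_ t)] := nxtP (Num.truncn M).+1 (u (Num.truncn M).+1).
rewrite -/(nxt _ _) => -[|N].
  have := tl (Num.truncn M).+2; have := th (Num.truncn M).+2.
  by rewrite /l /h /= ler_distl; lra.
by rewrite ltNge (le_trans (hM N)) // ltW // truncnS_gt.
Qed.

Lemma free_lattice_bounded q p (T : R) : free_lattice q p ->
  (forall t, exists M, ell2_le q p t M) ->
  exists M, forall t, `|t| <= T -> ell2_le q p t M.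
Proof.
move=> fr fin; case: (lerP 0 T) => T0; last first.
  by exists 0 => t tT; have := le_lt_trans tT T0; rewrite ltNge normr_ge0.
have [||M hM] := @good_segment q p (- T) T; first lra.
  by move=> t _; apply: free_lattice_good.
by exists M => t tT; apply: hM; rewrite -ler_norml.
Qed.

End LocalBoundedness.

(** * The strong law of large numbers *)

Section RealIntegrable.
Context d (T : measurableType d) (R : realType) (mu : {measure set T -> \bar R}).
Variable D : set T.
Hypothesis mD : measurable D.
Implicit Types f g : T -> R.
Local Notation intg f := (mu.-integrable D (EFin \o f)).

Lemma intgZ (c : R) f : intg f -> intg (fun x => c * f x).
Proof.
move=> i; have := integrableZl mD c i; exact: eq_integrable.
Qed.

Lemma intgD f g : intg f -> intg g -> intg (fun x => f x + g x).
Proof.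
move=> i j; have := integrableD mD i j; exact: eq_integrable.
Qed.

Lemma intgB f g : intg f -> intg g -> intg (fun x => f x - g x).
Proof.
move=> i j; have := integrableB mD i j; exact: eq_integrable.
Qed.

Lemma RintgZ (c : R) f : intg f ->
  \int[mu]_(x in D) (c * f x) = c * \int[mu]_(x in D) f x.
Proof. exact: RintegralZl. Qed.

Lemma RintgD f g : intg f -> intg g ->
  \int[mu]_(x in D) (f x + g x) = \int[mu]_(x in D) f x + \int[mu]_(x in D) g x.
Proof. exact: RintegralD. Qed.

Lemma RintgB f g : intg f -> intg g ->
  \int[mu]_(x in D) (f x - g x) = \int[mu]_(x in D) f x - \int[mu]_(x in D) g x.
Proof. exact: RintegralB. Qed.

Lemma RintgE f : intg f -> (\int[mu]_(x in D) (f x)%:E = (\int[mu]_(x in D) f x)%:E)%E.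
Proof. by move=> i; rewrite /Rintegral fineK //; exact: integrable_fin_num. Qed.

End RealIntegrable.

(** * Independence and products of expectations *)

Section Independence.
Context d (T : measurableType d) (R : realType) (Pr : probability T R).
Implicit Types X Y f : T -> R.

Lemma bounded_integrable f (B : R) : measurable_fun [set: T] f ->
  (forall w, `|f w| <= B) -> Pr.-integrable [set: T] (EFin \o f).
Proof.
move=> mf fB; apply: measurable_bounded_integrable => //.
- exact: le_lt_trans (probability_le1 Pr measurableT) (ltry 1).
- by exists B; split; [exact: num_real|move=> x Bx w _; apply: le_trans (fB w) (ltW Bx)].
Qed.

Definition independent_pair d1 d2 (T1 : measurableType d1) (T2 : measurableType d2)
    (X : T -> T1) (Y : T -> T2) :=
  forall (A : set T1) (C : set T2), measurable A -> measurable C ->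
  Pr (X @^-1` A `&` Y @^-1` C) = (Pr (X @^-1` A) * Pr (Y @^-1` C))%E.

Section Pair.
Context d1 d2 (T1 : measurableType d1) (T2 : measurableType d2).

(** Independence says that the law of the pair agrees with the product of the laws on rectangles,
    hence everywhere; Tonelli's theorem then factors the integral. *)
Lemma ge0_integral_independent (X : T -> T1) (Y : T -> T2) (g : T1 -> R) (h : T2 -> R) :
  measurable_fun [set: T] X -> measurable_fun [set: T] Y -> independent_pair X Y ->
  measurable_fun [set: T1] g -> measurable_fun [set: T2] h ->
  (forall x, 0 <= g x) -> (forall x, 0 <= h x) ->
  (\int[Pr]_w (g (X w) * h (Y w))%:E =
   \int[Pr]_w (g (X w))%:E * \int[Pr]_w (h (Y w))%:E)%E.
Proof.
move=> mX mY ind mg mh g0 h0.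
pose X' : {mfun T >-> T1} := mfun_Sub (mem_set mX).
pose Y' : {mfun T >-> T2} := mfun_Sub (mem_set mY).
have mXY : measurable_fun [set: T] (fun w => (X w, Y w)) by exact: measurable_fun_pair.
pose XY : {mfun T >-> (T1 * T2)%type} := mfun_Sub (mem_set mXY).
pose m1 := distribution Pr X'; pose m2 := distribution Pr Y'.
pose F : T1 * T2 -> \bar R := fun z => (g z.1 * h z.2)%:E.
have mF : measurable_fun [set: T1 * T2] F.
  apply/measurable_EFinP; apply: measurable_funM.
    by apply: measurableT_comp => //; exact: measurable_fst.
  by apply: measurableT_comp => //; exact: measurable_snd.
have F0 z : (0 <= F z)%E by rewrite lee_fin mulr_ge0.
rewrite (_ : (\int[Pr]_w _)%E = \int[Pr]_w (F \o XY) w)%E //.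
rewrite -ge0_integral_distribution //.
rewrite -(@eq_measure_integral _ _ _ setT _ (m1 \x m2)%E F); last first.
  move=> A mA _; apply: product_measure_unique => // B C mB mC.
rewrite fubini_tonelli1 // /fubini_F /F /=.
have -> : (\int[Pr]_w (g (X w))%:E)%E = (\int[m1]_x (g x)%:E)%E.
  by rewrite ge0_integral_distribution //; exact/measurable_EFinP.
have -> : (\int[Pr]_w (h (Y w))%:E)%E = (\int[m2]_x (h x)%:E)%E.
  by rewrite ge0_integral_distribution //; exact/measurable_EFinP.
have mh' : measurable_fun [set: T2] (fun y => (h y)%:E) by exact/measurable_EFinP.
have mg' : measurable_fun [set: T1] (fun y => (g y)%:E) by exact/measurable_EFinP.
rewrite (eq_integral (fun x => (g x)%:E * \int[m2]_y (h y)%:E)%E); last first.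
  move=> x _; under eq_integral do rewrite EFinM.
  by rewrite ge0_integralZl //; do ?[by rewrite lee_fin | by move=> y _; rewrite lee_fin].
by rewrite ge0_integralZr //; do ?[by move=> y _; rewrite lee_fin |
  by apply: integral_ge0 => x _; rewrite lee_fin].
Qed.

Local Notation E f := (Rintegral Pr setT f).

(** Adding B makes both factors nonnegative; the product formula for the shifted factors expands
    into the wanted one plus terms that cancel. *)
Lemma Rintegral_independent (X : T -> T1) (Y : T -> T2) (g : T1 -> R) (h : T2 -> R) (B : R) :
  measurable_fun [set: T] X -> measurable_fun [set: T] Y -> independent_pair X Y ->
  measurable_fun [set: T1] g -> measurable_fun [set: T2] h ->
  (forall x, `|g x| <= B) -> (forall x, `|h x| <= B) ->
  E (fun w => g (X w) * h (Y w)) = E (fun w => g (X w)) * E (fun w => h (Y w)).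
Proof.
move=> mX mY ind mg mh gB hB.
have B0 : 0 <= B by apply: le_trans (gB point).
have mgX : measurable_fun setT (fun w => g (X w)) by exact: measurableT_comp.
have mhY : measurable_fun setT (fun w => h (Y w)) by exact: measurableT_comp.
have ig : Pr.-integrable setT (EFin \o (fun w => g (X w))).
  by apply: (bounded_integrable mgX) => w.
have ih : Pr.-integrable setT (EFin \o (fun w => h (Y w))).
  by apply: (bounded_integrable mhY) => w.
have iB c : Pr.-integrable setT (EFin \o (fun=> c) : T -> \bar R).
  by apply: (@bounded_integrable (fun=> c) `|c|) => //; exact: measurable_cst.
have EB c : E (fun=> c) = c.
  by rewrite Rintegral_cst // (_ : fine _ = 1) ?mulr1 // -[RHS]/(fine 1%:E); congr fine; exact: probability_setT.
have igh : Pr.-integrable setT (EFin \o (fun w => g (X w) * h (Y w))).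
  apply: (@bounded_integrable _ (B * B)); first exact: measurable_funM.
  by move=> w; rewrite normrM ler_pM.
have iZ c f : Pr.-integrable setT (EFin \o f) -> Pr.-integrable setT (EFin \o (fun w => c * f w)).
  exact: intgZ.
have iD f1 f2 : Pr.-integrable setT (EFin \o f1) -> Pr.-integrable setT (EFin \o f2) ->
    Pr.-integrable setT (EFin \o (fun w => f1 w + f2 w)) by exact: intgD.
have ge0 S (f : S -> R) x : (forall x, `|f x| <= B) -> 0 <= f x + B.
  by move=> /(_ x); rewrite ler_norml => /andP[]; lra.
have := ge0_integral_independent mX mY ind (measurable_funD mg (measurable_cst B))
  (measurable_funD mh (measurable_cst B)) (fun x => ge0 _ g x gB) (fun x => ge0 _ h x hB).
move=> /(congr1 fine); rewrite fineM; last 2 first.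
- by apply: integrable_fin_num => //; exact: iD ig (iB B).
- by apply: integrable_fin_num => //; exact: iD ih (iB B).
move=> e; have {e} : E (fun w => (g (X w) + B) * (h (Y w) + B)) =
  E (fun w => g (X w) + B) * E (fun w => h (Y w) + B) by exact: e.
rewrite (RintgD measurableT ig (iB B)) (RintgD measurableT ih (iB B)) EB.
have -> : (fun w => (g (X w) + B) * (h (Y w) + B)) =
   (fun w => g (X w) * h (Y w) + (B * g (X w) + (B * h (Y w) + B * B))).
  by apply/funext => w; ring.
have i1 := iD _ _ (iZ B _ ih) (iB (B * B)); have i2 := iD _ _ (iZ B _ ig) i1.
rewrite (RintgD measurableT igh i2) (RintgD measurableT (iZ B _ ig) i1).
rewrite (RintgD measurableT (iZ B _ ih) (iB (B * B))) EB !RintgZ //.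
by move=> e; apply: (@addIr _ (B * E (fun w => g (X w)) + (B * E (fun w => h (Y w)) + B * B))); rewrite e; ring.
Qed.

End Pair.
End Independence.

(** * Averages of bounded, pairwise orthogonal variables *)

Section SLLN.
Context d (T : measurableType d) (R : realType) (Pr : probability T R).
Local Notation E f := (Rintegral Pr setT f).
Variables (Y : nat -> T -> R) (B : R).
Hypothesis mY : forall n, measurable_fun [set: T] (Y n).
Hypothesis YB : forall n w, `|Y n w| <= B.
Hypothesis YY : forall m n, (m < n)%N -> E (fun w => Y m w * Y n w) = 0.

Let S n w := \sum_(i < n) Y i w.

Let mS n : measurable_fun [set: T] (S n).
Proof. by apply: measurable_sum. Qed.

Let B0 : 0 <= B.
Proof. exact: le_trans (YB 0 point). Qed.

Let SB n w : `|S n w| <= n%:R * B.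
Proof.
apply: le_trans (ler_norm_sum _ _ _) _.
apply: (@le_trans _ _ (\sum_(i < n) B)); first by apply: ler_sum => i _.
by rewrite sumr_const card_ord mulr_natl.
Qed.

Let bint (f : T -> R) C : measurable_fun [set: T] f -> (forall w, `|f w| <= C) ->
  Pr.-integrable [set: T] (EFin \o f) := @bounded_integrable _ _ _ _ f C.

Let ESY n k : (n <= k)%N -> E (fun w => S n w * Y k w) = 0.
Proof.
elim: n => [|n IH] nk.
  rewrite (_ : (fun w => _) = (fun=> 0 * 0)).
    by rewrite RintegralZl // ?mul0r //; apply: (@bint _ 0) => // w; rewrite normr0.
  by apply/funext => w; rewrite /S big_ord0 !mul0r.
rewrite (_ : (fun w => _) = (fun w => S n w * Y k w + Y n w * Y k w)); last first.
  by apply/funext => w; rewrite /S big_ord_recr /= mulrDl.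
rewrite RintgD //.
- by rewrite IH ?YY ?addr0 // ltnW.
- apply: (@bint _ (n%:R * B * B)); first exact: measurable_funM.
  by move=> w; rewrite normrM ler_pM.
- apply: (@bint _ (B * B)); first exact: measurable_funM.
  by move=> w; rewrite normrM ler_pM.
Qed.

Let Ecst c : E (fun=> c) = c.
Proof.
rewrite Rintegral_cst // (_ : fine _ = 1) ?mulr1 // -[RHS]/(fine 1%:E).
by congr fine; exact: probability_setT.
Qed.

(** Orthogonality removes the cross terms, so the second moment of the sum grows linearly and not
    quadratically. *)
Let ES2 n : E (fun w => S n w ^+ 2) <= n%:R * B ^+ 2.
Proof.
elim: n => [|n IH].
  rewrite (_ : (fun w => _) = (fun=> 0)) ?Ecst ?mul0r //.
  by apply/funext => w; rewrite /S big_ord0 expr0n.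
rewrite (_ : (fun w => _) = (fun w => S n w ^+ 2 + (2 * (S n w * Y n w) + Y n w ^+ 2))); last first.
  by apply/funext => w; rewrite /S big_ord_recr /=; ring.
have i1 : Pr.-integrable [set: T] (EFin \o (fun w => S n w ^+ 2)).
  apply: (@bint _ ((n%:R * B) ^+ 2)); first exact: measurable_funX.
  by move=> w; rewrite normrX ler_pXn2r ?nnegrE ?mulr_ge0.
have i2 : Pr.-integrable [set: T] (EFin \o (fun w => S n w * Y n w)).
  apply: (@bint _ (n%:R * B * B)); first exact: measurable_funM.
  by move=> w; rewrite normrM ler_pM.
have YB2 w : `|Y n w ^+ 2| <= B ^+ 2 by rewrite normrX ler_pXn2r ?nnegrE.
have i3 : Pr.-integrable [set: T] (EFin \o (fun w => Y n w ^+ 2)).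
  by apply: (@bint _ (B ^+ 2)) => //; exact: measurable_funX.
have i4 : Pr.-integrable [set: T] (EFin \o (fun w => 2 * (S n w * Y n w))) by exact: intgZ.
rewrite (RintgD measurableT i1 (intgD measurableT i4 i3)) (RintgD measurableT i4 i3).
rewrite RintgZ // ESY // mulr0 add0r -[n.+1]addn1 natrD mulrDl mul1r lerD //.
rewrite -[leRHS]Ecst; apply: le_Rintegral => //.
  by apply: (@bint _ (B ^+ 2)) => // w; rewrite ger0_norm ?sqr_ge0.
by move=> w _; apply: le_trans (YB2 w); exact: ler_norm.
Qed.

Let f k w := (S (k.+1 ^ 2) w / (k.+1 ^ 2)%:R) ^+ 2.

(** Comparison with a telescoping sum: 1/(n+1)^2 <= 2 (1/(n+1) - 1/(n+2)). *)
Let inv_sq_sum n : \sum_(k < n) B ^+ 2 / (k.+1 ^ 2)%:R <= 2 * B ^+ 2.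
Proof.
have h : \sum_(k < n) ((k.+1 ^ 2)%:R)^-1 <= 2 * (1 - n.+1%:R^-1) :> R.
  elim: n => [|n IH]; first by rewrite big_ord0 invr1 subrr mulr0.
  rewrite big_ord_recr /=; apply: le_trans (lerD IH (lexx _)) _.
  rewrite natrX -subr_ge0.
  have -> : 2 * (1 - n.+2%:R^-1) - (2 * (1 - n.+1%:R^-1) + (n.+1%:R ^+ 2)^-1) =
     n%:R / (n.+1%:R ^+ 2 * n.+2%:R) :> R.
    have -> : n.+2%:R = n%:R + 2 :> R by rewrite -[n.+2]addn2 natrD.
    have -> : n.+1%:R = n%:R + 1 :> R by rewrite -[n.+1]addn1 natrD.
    have := ler0n R n; set x : R := n%:R => x0.
    by field; rewrite !gt_eqF //; lra.
  by rewrite divr_ge0 // mulr_ge0 ?exprn_ge0.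
rewrite -mulr_sumr mulrC ler_wpM2r ?sqr_ge0 //; apply: le_trans h _.
by rewrite ler_piMr // gerBl invr_ge0.
Qed.

(** Along the squares, the expectation of the squared average is at most B^2 / (k+1)^2, so the
    series of these variables has finite expectation. It converges almost surely, and its terms tend
    to 0. *)
Let f_cvg0 : {ae Pr, forall w, f ^~ w @ \oo --> 0}.
Proof.
have mf k : measurable_fun [set: T] (fun w => (f k w)%:E).
  apply/measurable_EFinP; apply: measurable_funX; apply: measurable_funM => //.
have f0 k w : (0 <= (f k w)%:E)%E by rewrite lee_fin sqr_ge0.
pose F w := (\sum_(0 <= k <oo) (f k w)%:E)%E.
have iF : (\int[Pr]_w F w <= (2 * B ^+ 2)%:E)%E.
  rewrite integral_nneseries //.
  apply: lime_le; first by apply: is_cvg_nneseries => k _ _; apply: integral_ge0.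
  apply: nearW => n; rewrite big_mkord.
  apply: (@le_trans _ _ (\sum_(k < n) B ^+ 2 / (k.+1 ^ 2)%:R)%:E); last first.
    by rewrite lee_fin; exact: inv_sq_sum.
  rewrite -sumEFin; apply: lee_sum => k _.
  have ff : (fun w => f k w) = (fun w => ((k.+1 ^ 2)%:R ^- 2) * S (k.+1 ^ 2) w ^+ 2).
    by apply/funext => w; rewrite /f exprMn mulrC exprVn.
  have i1 : Pr.-integrable [set: T] (EFin \o (fun w => S (k.+1 ^ 2) w ^+ 2)).
    apply: (@bint _ (((k.+1 ^ 2)%:R * B) ^+ 2)); first exact: measurable_funX.
    by move=> w; rewrite normrX ler_pXn2r ?nnegrE ?mulr_ge0.
  have i2 : Pr.-integrable [set: T] (EFin \o (fun w => f k w)) by rewrite ff; exact: intgZ.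
  rewrite (RintgE measurableT i2) lee_fin ff RintgZ //.
  apply: le_trans (ler_wpM2l _ (ES2 _)) _; first by rewrite invr_ge0 exprn_ge0.
  have : (k.+1 ^ 2)%:R != 0 :> R by rewrite pnatr_eq0 expn_eq0.
  set x : R := _%:R => x0; rewrite le_eqVlt; apply/orP; left; apply/eqP.
  by field.
have F0 w : (0 <= F w)%E by apply: nneseries_ge0.
have mF : measurable_fun [set: T] F.
  by apply: ge0_emeasurable_sum => // k w _ _; exact: f0.
have intF : Pr.-integrable [set: T] F.
  apply/integrableP; split => //; under eq_integral do rewrite gee0_abs //.
  exact: le_lt_trans iF (ltry _).
apply: filterS (integrable_ae measurableT intF) => w /(_ I) fin.
apply: cvg_series_cvg_0; apply: nondecreasing_is_cvgn.
  by apply: nondecreasing_series => k _ _; exact: sqr_ge0.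
exists (fine (F w)) => _ [n _ <-].
rewrite -lee_fin fineK // /series /= -sumEFin.
by apply: nneseries_lim_ge => k _ _.
Qed.

(* Between consecutive squares the partial sums move by at most 2kB, which is
   negligible with respect to k^2. *)
Lemma slln_bounded : {ae Pr, forall w, forall delta : R, 0 < delta ->
  exists C, forall n, `|\sum_(i < n) Y i w| <= delta * n%:R + C}.
Proof.
apply: filterS f_cvg0 => w fw delta d0.
have d2 : 0 < (delta / 2) ^+ 2 by rewrite exprn_gt0 // divr_gt0.
have [K _ hK] := cvgr_lt _ fw _ d2.
(* The first term covers n below (K+1)^2. Above it, the increment since the last square is at most
   (2 (k+1) + 1) B; Young's inequality moves part of it to delta/2 times (k+1)^2, and the last two
   terms absorb the rest. *)
pose C := K.+1%:R ^+ 2 * B + 4 * B ^+ 2 / delta + 2 * B.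
have C0 : 0 <= 4 * B ^+ 2 / delta by rewrite divr_ge0 ?mulr_ge0 ?sqr_ge0 // ltW.
exists C => n; rewrite -/(S n w).
case: (ltnP n (K.+1 ^ 2)) => nK.
  apply: le_trans (SB n w) _.
  have h1 : n%:R * B <= K.+1%:R ^+ 2 * B by rewrite ler_wpM2r // -natrX ler_nat ltnW.
  have h2 : 0 <= delta * n%:R by rewrite mulr_ge0 // ltW.
  by have b0 := B0; rewrite /C; lra.
pose P k := (k.+1 ^ 2 <= n)%N.
have exP : exists k, P k by exists K.
have ubP k : P k -> (k <= n)%N.
  by rewrite /P => h; apply: leq_trans h; rewrite -mulnn; nia.
pose k := ex_maxn exP ubP.
have [kn kmax] : P k /\ forall j, P j -> (j <= k)%N by rewrite /k; case: ex_maxnP.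
have nk : (n < k.+2 ^ 2)%N.
  by rewrite ltnNge; apply/negP => /kmax; rewrite ltnn.
have Kk : (K <= k)%N by exact: kmax.
have Sk : `|S (k.+1 ^ 2) w| <= delta / 2 * k.+1%:R ^+ 2.
  have p0 : (0 : R) < k.+1%:R ^+ 2 by rewrite exprn_gt0.
  have := hK k Kk; rewrite /f => /ltW.
  rewrite -(real_normK (num_real (S _ w / _))) ler_pXn2r ?nnegrE //; last by rewrite divr_ge0 // ltW.
  by rewrite natrX normf_div (ger0_norm (ltW p0)) ler_pdivrMr.
have Sn : `|S n w - S (k.+1 ^ 2) w| <= (2 * k.+1%:R + 1) * B.
  have -> : S n w - S (k.+1 ^ 2) w = \sum_(k.+1 ^ 2 <= i < n) Y i w.
    by rewrite /S -!(big_mkord xpredT (Y ^~ w)) (big_cat_nat (leq0n _) kn) /= addrAC subrr add0r.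
  apply: le_trans (ler_norm_sum _ _ _) _.
  apply: (@le_trans _ _ (\sum_(k.+1 ^ 2 <= i < n) B)); first by apply: ler_sum => i _.
  rewrite sumr_const_nat -[leLHS]mulr_natl ler_wpM2r // -natrM natr1 ler_nat.
  by move: nk kn; rewrite /P -!mulnn; nia.
have h1 : `|S n w| <= delta / 2 * k.+1%:R ^+ 2 + (2 * k.+1%:R + 1) * B.
  by have := ler_normD (S n w - S (k.+1 ^ 2) w) (S (k.+1 ^ 2) w); rewrite subrK; lra.
have h2 : delta * k.+1%:R ^+ 2 <= delta * n%:R by rewrite ler_pM2l // -natrX ler_nat.
set x : R := k.+1%:R in h1 h2 *.
have h3 : 2 * x * B <= delta / 2 * x ^+ 2 + 2 * B ^+ 2 / delta.
  rewrite -subr_ge0 (_ : _ - _ = (delta * x - 2 * B) ^+ 2 / (2 * delta)); last by field; rewrite gt_eqF.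
  by rewrite divr_ge0 ?sqr_ge0 // mulr_ge0 // ltW.
have h4 : 0 <= K.+1%:R ^+ 2 * B by rewrite mulr_ge0 ?sqr_ge0.
have h5 : 2 * B ^+ 2 / delta * 2 = 4 * B ^+ 2 / delta by field; rewrite gt_eqF.
by rewrite /C; move: h1 h2 h3 h4 h5 C0 B0; rewrite mulrDl mul1r; lra.
Qed.

End SLLN.

(** * From independent identically distributed variables to orthogonal ones *)

Section IIDLaw.
Context d (T : measurableType d) (R : realType) (Pr : probability T R).
Variables (X : int -> T -> R) (a b mu : R).
Hypothesis X_iid : iid Pr X.
Hypothesis X_bnd : forall j, {ae Pr, forall w, a <= X j w <= b}.
Hypothesis muE : (mu%:E = 'E_Pr[X 0%R])%E.
Local Notation E f := (Rintegral Pr setT f).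

(** Clamping alters each variable only on a null set, but turns almost sure bounds into bounds at
    every point, the form in which [slln_bounded] takes them. *)
Let clamp (x : R) : R := Num.max a (Num.min x b).
Let g x := clamp x - mu.
Let B : R := `|a| + `|b| + `|mu|.

Let mX j : measurable_fun [set: T] (X j). Proof. by case: X_iid. Qed.

Let mclamp : measurable_fun [set: R] clamp.
Proof.
by apply: measurable_maxr => //; apply: measurable_minr.
Qed.

Let mg : measurable_fun [set: R] g.
Proof. exact: (measurable_funB mclamp). Qed.

Let clamp_bnd x : `|clamp x| <= `|a| + `|b|.
Proof.
have a0 := normr_ge0 a; have b0 := normr_ge0 b.
have := ler_norm a; have := ler_norm b; have := lerNnormlW (lexx `|a|).
rewrite ler_norml /clamp; case: (leP x b) => xb; [case: (leP a x) => ?|case: (leP a b) => ?]; lra.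
Qed.

Let gB x : `|g x| <= B.
Proof. by apply: le_trans (ler_normB _ _) _; rewrite lerD2r. Qed.

Let clampE x : a <= x <= b -> clamp x = x.
Proof. by move=> /andP[ax xb]; rewrite /clamp min_l // max_r. Qed.

Let mgX j : measurable_fun [set: T] (fun w => g (X j w)).
Proof. exact: measurableT_comp. Qed.

Let Eg j : E (fun w => g (X j w)) = 0.
Proof.
have -> : E (fun w => g (X j w)) = E (fun w => g (X 0 w)).
  pose Xm k : {mfun T >-> R} := mfun_Sub (mem_set (mX k)).
  have mgE : measurable_fun [set: R] (EFin \o g) by exact/measurable_EFinP.
  have ig k : Pr.-integrable setT ((EFin \o g) \o Xm k).
    exact: (bounded_integrable Pr (mgX k) (fun w => gB (X k w))).
  rewrite /Rintegral; congr fine.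
  rewrite -[LHS](integral_distribution mgE (ig j)) -[RHS](integral_distribution mgE (ig 0)).
  apply: eq_measure_integral => A mA _; case: X_iid => _ _ h; exact: h.
have mcX : measurable_fun [set: T] (fun w => clamp (X 0 w)) by exact: measurableT_comp.
have icX : Pr.-integrable setT (EFin \o (fun w => clamp (X 0 w))).
  exact: (bounded_integrable Pr mcX (fun w => clamp_bnd (X 0 w))).
have imu : Pr.-integrable setT (EFin \o (fun=> mu) : T -> \bar R).
  by apply: (@bounded_integrable _ _ _ _ _ `|mu|).
rewrite (RintgB measurableT icX imu) Rintegral_cst // (_ : fine _ = 1); last first.
  by rewrite -[RHS]/(fine 1%:E); congr fine; exact: probability_setT.
rewrite mulr1; apply/eqP; rewrite subr_eq0; apply/eqP.
apply: EFin_inj; rewrite muE -(RintgE measurableT icX) unlock.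
apply: ae_eq_integral => //; [exact/measurable_EFinP|exact/measurable_EFinP|].
by apply: filterS (X_bnd 0) => w h _; rewrite clampE.
Qed.

Let indep i j : i != j -> independent_pair Pr (X i) (X j).
Proof.
move=> ij A C mA mC; case: X_iid => _ ind _.
have := ind [:: i; j] (fun k => if k == i then A else C).
rewrite /= !inE ij => /(_ isT) h.
have {}h := h (fun k => ltac:(by case: ifP)).
move: h; rewrite !big_cons big_nil eqxx eq_sym (negbTE ij) mule1 => <-.
congr (Pr _); apply/seteqP; split => w /=.
  move=> [Aw Cw] k /=; rewrite !inE => /orP[/eqP->|/eqP->]; first by rewrite eqxx.
  by rewrite eq_sym (negbTE ij).
move=> h; split; first by have := h i; rewrite /= !inE eqxx => /(_ isT).
by have := h j; rewrite /= !inE eqxx orbT eq_sym (negbTE ij) => /(_ isT).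
Qed.

(** The injection selects a half-line: it is used with [Posz] and with [Negz], the correctors being
    sums in both directions. The o(n) is written as [delta * n%:R + C], a form that scales directly
    to sites of order 1/e. *)
Lemma slln_iid (idx : nat -> int) : injective idx ->
  {ae Pr, forall w, forall delta : R, 0 < delta ->
    exists C, forall n, `|\sum_(i < n) (X (idx i) w - mu)| <= delta * n%:R + C}.
Proof.
move=> inj.
have := @slln_bounded _ _ _ Pr (fun n w => g (X (idx n) w)) B (fun n => mgX (idx n))
  (fun n w => gB _).
move=> /(_ _)/wrap[].
  move=> m n mn; rewrite (@Rintegral_independent _ _ _ _ _ _ _ _ (X (idx m)) (X (idx n)) g g B) //.
    by rewrite !Eg mulr0.
  by apply: indep; rewrite (inj_eq inj) neq_ltn mn.
have /ae_foralln := fun n => X_bnd (idx n).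
apply: filterS2 => w hb h delta d0.
have [C hC] := h _ d0; exists C => n.
by under eq_bigr => i _ do rewrite -(clampE (hb i)).
Qed.

End IIDLaw.

(** * Band-limited interpolation *)

Section AffineChange.
Variable R : realType.
Local Notation mu := (@lebesgue_measure R).

Let aff (e c : R) : measurableTypeR R -> measurableTypeR R := fun x => e * x + c.

Let maff e c : measurable_fun [set: R] (aff e c).
Proof.
apply: (@measurable_funD _ _ _ _ (fun x : R => e * x) (fun=> c)) => //.
exact: (@measurable_funM _ _ _ _ (fun=> e) (fun x : R => x)).
Qed.

Let affine_pushforward (e c : R) : {measure set (measurableTypeR R) -> \bar R} :=
  measure_function_pushforward__canonical__measure_function_Measure mu (maff e c).

Lemma lebesgue_measure_affine (e c : R) (e0 : 0 < e) (A : set R) : measurable A ->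
  mu A = (e%:E * mu ((fun x => e * x + c)%R @^-1` A))%E.
Proof.
move=> mA.
pose pf := affine_pushforward e c.
pose m : {measure set (measurableTypeR R) -> \bar R} := mscale (NngNum (ltW e0)) pf.
rewrite (@lebesgue_measure_unique R m _ A mA) //.
move=> _ [[a b]] _ <-; rewrite -[RHS]/(e%:E * mu (aff e c @^-1` [set` `]a, b]]))%E /=.
have -> : aff e c @^-1` [set` `]a, b]] = [set` `]((a - c) / e), ((b - c) / e)]].
  apply/seteqP; split => x /=; rewrite /aff !in_itv /= ltr_pdivrMr // ler_pdivlMr // mulrC.
    by move=> /andP[h1 h2]; apply/andP; split; lra.
  by move=> /andP[h1 h2]; apply/andP; split; lra.
rewrite !lebesgue_measure_itv /= !lte_fin ltr_pM2r ?invr_gt0 // ltrD2r.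
case: ifP => _; last by rewrite mule0.
by rewrite -!EFinD -EFinM; congr EFin; field; rewrite gt_eqF.
Qed.

Lemma ge0_integral_affine (e c : R) (f : R -> \bar R) : 0 < e ->
  measurable_fun [set: R] f -> (forall x, 0 <= f x)%E ->
  (\int[mu]_x f x = e%:E * \int[mu]_x f (e * x + c)%R)%E.
Proof.
move=> e0 mf f0.
pose pf := affine_pushforward e c.
pose m : {measure set (measurableTypeR R) -> \bar R} := mscale (NngNum (ltW e0)) pf.
rewrite (@eq_measure_integral _ _ _ setT m mu); last first.
  by move=> A mA _; exact: lebesgue_measure_affine.
rewrite ge0_integral_mscale //; congr (_ * _)%E.
exact: (@ge0_integral_pushforward _ _ (measurableTypeR R) (measurableTypeR R) R (aff e c)
  (maff e c) mu setT f measurableT mf (fun x _ => f0 x)).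
Qed.

Lemma ge0_integral_shift (c : R) (f : R -> \bar R) :
  measurable_fun [set: R] f -> (forall x, 0 <= f x)%E ->
  (\int[mu]_x f x = \int[mu]_x f (x + c)%R)%E.
Proof.
move=> mf f0; rewrite (@ge0_integral_affine 1 c) // mul1e.
by apply: eq_integral => x _; rewrite mul1r.
Qed.

Lemma ge0_integral_scale (e : R) (f : R -> \bar R) : 0 < e ->
  measurable_fun [set: R] f -> (forall x, 0 <= f x)%E ->
  (\int[mu]_x f (x / e)%R = e%:E * \int[mu]_x f x)%E.
Proof.
move=> e0 mf f0; rewrite (@ge0_integral_affine e 0) //.
- by congr (_ * _)%E; apply: eq_integral => x _; rewrite addr0 mulrC mulKf // gt_eqF.
- apply: measurableT_comp => //.
  exact: (@measurable_funM _ _ _ _ (fun x : R => x) (fun=> e^-1)).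
Qed.

Lemma ge0_integral_itv_shift (n : int) (g : R -> \bar R) :
  measurable_fun [set: R] g -> (forall x, 0 <= g x)%E ->
  (\int[mu]_(x in `[n%:~R : R, (n%:~R + 1)%R[) g x = \int[mu]_(s in `[0%R, 1%R[) g (s + n%:~R)%R)%E.
Proof.
move=> mg g0; rewrite integral_mkcond [RHS]integral_mkcond.
rewrite (@ge0_integral_shift n%:~R) //.
- apply: eq_integral => x _; rewrite !patchE.
  by congr (if _ then _ else _); apply/idP/idP; rewrite !inE /= !in_itv /=; lra.
- by apply/(measurable_restrictT _ _).1 => //; exact: measurable_funTS.
- by move=> x; rewrite patchE; case: ifP.
Qed.

Lemma integral_unit_cells (N : nat) (g : R -> \bar R) :
  measurable_fun [set: R] g -> (forall x, 0 <= g x)%E ->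
  (\int[mu]_(x in `[(- N%:R)%R, (N.+1%:R)%R[) g x =
   \int[mu]_(s in `[0%R, 1%R[) zsum N (fun n : int => g (s + n%:~R)%R))%E.
Proof.
move=> mg g0.
have mgn (n : int) : measurable_fun [set: R] (fun s => g (s + n%:~R)).
  by apply: measurableT_comp => //; exact: measurable_funD.
have mz M : measurable_fun [set: R] (fun s => zsum M (fun n : int => g (s + n%:~R)%R)).
  by elim: M => [|M IH] /=; [exact: mgn|do 2 (apply: emeasurable_funD => //)].
have z0 M s : (0 <= zsum M (fun n : int => g (s + n%:~R)%R))%E.
  by elim: M => [|M IH] //=; do 2 (apply: adde_ge0 => //).
elim: N => [|N IH] /=.
  by have := ge0_integral_itv_shift 0 mg g0; rewrite mulr0z add0r oppr0 => ->.
have m1 (n : int) : measurable_fun (`[0%R, 1%R[%classic : set R) (fun s : R => g (s + n%:~R)) by exact: measurable_funTS.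
have m2 : measurable_fun (`[0%R, 1%R[%classic : set R) (fun s : R => zsum N (fun n : int => g (s + n%:~R)%R)) by exact: measurable_funTS.
rewrite ge0_integralD //; last 2 first.
- exact: (emeasurable_funD m2 (m1 N.+1%:Z)).
- exact: (m1 (- N.+1%:Z)).
rewrite ge0_integralD //; last exact: (m1 N.+1%:Z).
rewrite -IH -(ge0_integral_itv_shift N.+1%:Z) // -(ge0_integral_itv_shift (- N.+1%:Z)) //.
have -> : `[- N.+1%:R, N.+2%:R[%classic =
   `[- N%:R, N.+1%:R[%classic `|` `[(N.+1%:Z)%:~R, (N.+1%:Z)%:~R + 1[%classic
    `|` `[(- N.+1%:Z)%:~R, (- N.+1%:Z)%:~R + 1[%classic :> set R.
  have e1 : N.+2%:R = N.+1%:R + 1 :> R by rewrite -[N.+2]addn1 natrD.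
  have e2 : N.+1%:R = N%:R + 1 :> R by rewrite -[N.+1]addn1 natrD.
  have p := ler0n R N.
  apply/seteqP; split => x /=; rewrite !in_itv /= !mulrNz -!pmulrn e1 e2.
    case: (ltP x (- N%:R)) => h1; first by move=> /andP[h2 _]; right; apply/andP; split; lra.
    case: (ltP x (N%:R + 1)) => h2; first by left; left.
    by move=> /andP[_ h3]; left; right.
  by move=> [[]|] /andP[h1 h2]; apply/andP; split; lra.
have e2 : N.+1%:R = N%:R + 1 :> R by rewrite -[N.+1]addn1 natrD.
have p := ler0n R N.
have D1 (x : R) : (`[- N%:R, N.+1%:R[%classic `|`
    `[(N.+1%:Z)%:~R, (N.+1%:Z)%:~R + 1[%classic) x ->
    x \in `[(- N.+1%:Z)%:~R, (- N.+1%:Z)%:~R + 1[ -> False.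
  by clear IH; move=> [] /=; rewrite !in_itv /= !mulrNz -!pmulrn e2 => /andP[h1 h2] /andP[h3 h4]; lra.
have D2 (x : R) : x \in `[- N%:R, N.+1%:R[ ->
    x \in `[(N.+1%:Z)%:~R, (N.+1%:Z)%:~R + 1[ -> False.
  by clear IH; rewrite !in_itv /= -!pmulrn e2 => /andP[h1 h2] /andP[h3 h4]; lra.
rewrite ge0_integral_setU //; last 3 first.
- by apply: measurableU; exact: measurable_itv.
- exact: measurable_funTS.
- by apply/disj_setPS => x [h1 h2]; exact: (D1 x h1 h2).
rewrite ge0_integral_setU //; last 2 first.
- exact: measurable_funTS.
- by apply/disj_setPS => x [h1 h2]; exact: (D2 x h1 h2).
by move=> x _; apply: adde_ge0.
Qed.

(** The line is the union of the integer translates of [0, 1), so the integral of g is the integral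
    over s in [0, 1) of its sums over s + Z. A bound on these sums, uniform in s, thus reduces an
    integral over the line to lattice sums. *)
Lemma folding_bound (g : R -> \bar R) (C : \bar R) :
  measurable_fun [set: R] g -> (forall x, 0 <= g x)%E ->
  (forall N (s : R), 0 <= s < 1 -> (zsum N (fun n : int => g (s + n%:~R)%R) <= C)%E) ->
  (\int[mu]_x g x <= C)%E.
Proof.
move=> mg g0 hC.
pose I (N : nat) : set R := `[- N%:R, N.+1%:R[%classic.
have UI : \bigcup_N I N = setT.
  apply/seteqP; split => // x _.
  exists (Num.truncn `|x|).+1 => //=; rewrite /I /= in_itv /=.
  have h := truncnS_gt `|x|; have := ler_norm x; have := lerNnormlW (lexx `|x|).
  have : (Num.truncn `|x|).+1%:R < (Num.truncn `|x|).+2%:R :> R by rewrite ltr_nat.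
  by move: h => /=; lra.
have ndI : nondecreasing_seq I.
  move=> m n mn; apply/subsetPset => x; rewrite /I /= !in_itv /= => /andP[h1 h2].
  have e1 : (m%:R : R) <= n%:R by rewrite ler_nat.
  have e2 : (m.+1%:R : R) <= n.+1%:R by rewrite ler_nat.
  by apply/andP; split; lra.
have cv : (\int[mu]_(x in I i) g x)%E @[i --> \oo] --> (\int[mu]_x g x)%E.
  rewrite -UI; apply: ge0_nondecreasing_set_cvg_integral => //.
  - by move=> i; exact: measurable_itv.
  - by move=> i; exact: measurable_funTS.
rewrite -(cvg_lim _ cv) //.
apply: lime_le; first by apply/cvg_ex; eexists; exact: cv.
apply: nearW => N; rewrite /I integral_unit_cells //.
have C0 : (0 <= C)%E.
  apply: le_trans (hC 0%N 0 _); first exact: g0.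
  by rewrite lexx ltr01.
apply: (@le_trans _ _ (\int[mu]_(s in `[0%R, 1%R[) C)%E).
  apply: ge0_le_integral => //.
  - move=> s _; elim: N => //= N IH; do 2 (apply: adde_ge0 => //).
  - apply: measurable_funTS.
    have mgn (n : int) : measurable_fun [set: R] (fun s => g (s + n%:~R)).
      by apply: measurableT_comp => //; exact: measurable_funD.
    have mz : measurable_fun [set: R] (fun s => zsum N (fun n : int => g (s + n%:~R)%R)).
      by elim: N => [|M IH] /=; [exact: mgn|do 2 (apply: emeasurable_funD => //)].
    exact: mz.
  - by move=> s /=; rewrite in_itv /=; exact: hC.
rewrite integral_cst // (_ : _ `[0%R, 1%R[%classic = 1%E) ?mule1 //.
by apply: etrans (lebesgue_measure_itv _) _; rewrite /= lte_fin ltr01 oppr0 adde0.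
Qed.

End AffineChange.

(** * Bessel's inequality *)

Section AbstractBessel.
Variables (R : realType) (V : Type) (S : V -> Prop) (ip : V -> V -> R).
Variable axpy : V -> R -> V -> V.
Hypothesis axpyS : forall h c e, S h -> S e -> S (axpy h c e).
Hypothesis ipC : forall h k, ip h k = ip k h.
Hypothesis ip_axpy : forall h c e k, S h -> S e -> S k ->
  ip (axpy h c e) k = ip h k - c * ip e k.
Hypothesis ip_ge0 : forall h, 0 <= ip h h.

(** Induction on the family: removing from h its component along the first vector leaves the other
    coefficients unchanged and lowers [c * ip h h] by the square of the first one. The setting is a
    bare type with a form that is bilinear on [S], because functions are not identified almost
    everywhere. *)
Lemma bessel_inequality (I : eqType) (e : I -> V) (c : R) (s : seq I) :
  0 < c -> uniq s -> (forall i, S (e i)) ->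
  (forall i j, ip (e i) (e j) = if i == j then c else 0) ->
  forall h, S h -> \sum_(i <- s) ip h (e i) ^+ 2 <= c * ip h h.
Proof.
move=> c0 us eS orth; elim: s us => [|i s IH] /= us h hS.
  by rewrite big_nil mulr_ge0 // ltW.
have /andP[is' us'] := us.
rewrite big_cons.
pose h' := axpy h (ip h (e i) / c) (e i).
have h'S : S h' by exact: axpyS.
have h'j j : j \in s -> ip h' (e j) = ip h (e j).
  move=> js; rewrite ip_axpy // orth; case: eqP => [ij|_]; last by rewrite mulr0 subr0.
  by rewrite ij js in is'.
have h'h' : c * ip h' h' = c * ip h h - ip h (e i) ^+ 2.
  rewrite {1}/h' ip_axpy // (ipC h h') (ipC (e i) h') {1 2}/h' !ip_axpy // (ipC (e i) h) orth eqxx.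
  by field; rewrite gt_eqF.
have := IH us' h' h'S; rewrite h'h' (eq_big_seq (fun j => ip h (e j) ^+ 2)).
  by rewrite -lerBrDl.
by move=> j js; rewrite h'j.
Qed.

End AbstractBessel.

(** * Square integrable functions on one period *)

Section SquareIntegrable.
Variable R : realType.
Local Notation mu := (@lebesgue_measure R).
Local Notation D := (`]- pi, pi[%classic : set R).
Local Notation intg f := (mu.-integrable D (EFin \o f)).
Implicit Types f g : R -> R.

Let mD : measurable D. Proof. exact: measurable_itv. Qed.

Lemma lebesgue_measure_period : mu D = (2 * pi)%:E.
Proof.
apply: etrans (lebesgue_measure_itv _) _; rewrite /= lte_fin.
have p := pi_gt0 R; rewrite gtrN // -EFinD; congr EFin; ring.
Qed.

Definition sqi f := measurable_fun D f /\ intg (fun x => f x ^+ 2).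

Lemma bounded_intg f B : measurable_fun D f -> (forall x, `|f x| <= B) -> intg f.
Proof.
move=> mf fB; apply: measurable_bounded_integrable => //.
- by rewrite /= lebesgue_measure_period ltry.
- by exists B; split; [exact: num_real|move=> x Bx w _; apply: le_trans (fB w) (ltW Bx)].
Qed.

Lemma sqi_bounded f B : measurable_fun D f -> (forall x, `|f x| <= B) -> sqi f.
Proof.
move=> mf fB; split => //; apply: (@bounded_intg _ (B ^+ 2)); first exact: measurable_funX.
have B0 : 0 <= B by apply: le_trans (fB 0).
by move=> x; rewrite normrX ler_pXn2r ?nnegrE.
Qed.

Lemma le_intg f g : measurable_fun D f -> intg g -> (forall x, `|f x| <= g x) -> intg f.
Proof.
move=> mf ig fg; apply: le_integrable ig => //; first exact/measurable_EFinP.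
move=> x _; rewrite /= lee_fin; apply: le_trans (fg x) _; exact: ler_norm.
Qed.

Lemma sqiM f g : sqi f -> sqi g -> intg (fun x => f x * g x).
Proof.
move=> [mf sf] [mg sg]; apply: (@le_intg _ (fun x => f x ^+ 2 + g x ^+ 2)).
- exact: measurable_funM.
- exact: intgD.
move=> x; rewrite normrM.
have -> : f x ^+ 2 + g x ^+ 2 = `|f x| ^+ 2 + `|g x| ^+ 2 by rewrite !real_normK ?num_real.
have := sqr_ge0 (`|f x| - `|g x|); have := mulr_ge0 (normr_ge0 (f x)) (normr_ge0 (g x)).
rewrite sqrrB mulr2n; lra.
Qed.

Lemma sqi_lin f g c : sqi f -> sqi g -> sqi (fun x => f x + c * g x).
Proof.
move=> sf sg; have [mf sf2] := sf; have [mg sg2] := sg; split.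
  by apply: measurable_funD => //; exact: measurable_funM.
have -> : (fun x => (f x + c * g x) ^+ 2) =
  (fun x => f x ^+ 2 + (2 * c * (f x * g x) + c ^+ 2 * g x ^+ 2)).
  by apply/funext => x; ring.
by do 2 (apply: intgD => //); apply: intgZ => //; exact: sqiM.
Qed.

Lemma sqi_linB f g c : sqi f -> sqi g -> sqi (fun x => f x - c * g x).
Proof.
move=> sf sg; have := sqi_lin (- c) sf sg.
by congr sqi; apply/funext => x; rewrite mulNr.
Qed.

Lemma sqi_mul f g : sqi f -> measurable_fun D g -> (forall x, `|g x| <= 1) ->
  sqi (fun x => f x * g x).
Proof.
move=> [mf sf] mg g1; split; first exact: measurable_funM.
apply: (@le_intg _ (fun x => f x ^+ 2)) => //.
  by apply: measurable_funX; exact: measurable_funM.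
move=> x; rewrite ger0_norm ?sqr_ge0 // exprMn.
apply: ler_piMr; first exact: sqr_ge0.
by rewrite -(real_normK (num_real (g x))) expr_le1.
Qed.

Lemma sqi_intg f : sqi f -> intg f.
Proof.
move=> sf; have s1 : sqi (fun=> 1) by apply: (@sqi_bounded _ 1) => // x; rewrite normr1.
by have := sqiM sf s1; congr integrable; apply/funext => x; rewrite /= mulr1.
Qed.

Definition cfun : Type := ((R -> R) * (R -> R))%type.
Implicit Types H K : cfun.

Definition inL2 H := sqi H.1 /\ sqi H.2.

(** Complex functions are pairs of real ones, and this is the real part of their Hermitian product
    over a period. *)
Definition ip H K : R := \int[mu]_(x in D) (H.1 x * K.1 x + H.2 x * K.2 x).

Definition axpy H (c : R) K : cfun := (fun x => H.1 x - c * K.1 x, fun x => H.2 x - c * K.2 x).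

Lemma inL2_axpy H c K : inL2 H -> inL2 K -> inL2 (axpy H c K).
Proof. by move=> [a b] [a' b']; split; exact: sqi_linB. Qed.

Lemma ip_intg H K : inL2 H -> inL2 K -> intg (fun x => H.1 x * K.1 x + H.2 x * K.2 x).
Proof. by move=> [a b] [a' b']; apply: intgD => //; exact: sqiM. Qed.

Lemma ipC H K : ip H K = ip K H.
Proof. by apply: eq_Rintegral => x _; rewrite mulrC [X in _ + X]mulrC. Qed.

Lemma ip_axpy H c K L : inL2 H -> inL2 K -> inL2 L ->
  ip (axpy H c K) L = ip H L - c * ip K L.
Proof.
move=> h k l; rewrite /ip -RintgZ //; last exact: ip_intg.
rewrite -RintgB //; [|exact: ip_intg|by apply: intgZ => //; exact: ip_intg].
by apply: eq_Rintegral => x _ /=; ring.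
Qed.

Lemma ip_ge0 H : 0 <= ip H H.
Proof. by apply: Rintegral_ge0 => x _; rewrite -!expr2 addr_ge0 ?sqr_ge0. Qed.

Lemma ip_le H K : inL2 H -> inL2 K ->
  (forall x, D x -> H.1 x ^+ 2 + H.2 x ^+ 2 <= K.1 x ^+ 2 + K.2 x ^+ 2) -> ip H H <= ip K K.
Proof.
by move=> h k hk; apply: le_Rintegral => //; do ?exact: ip_intg.
Qed.

Lemma ip_par H K L : inL2 H -> inL2 K -> inL2 L ->
  (forall x, D x -> L.1 x = H.1 x + K.1 x /\ L.2 x = H.2 x + K.2 x) ->
  ip L L <= 2 * (ip H H + ip K K).
Proof.
move=> h k l hkl.
rewrite /ip -RintgD //; [|exact: ip_intg|exact: ip_intg].
rewrite -RintgZ //; last by apply: intgD => //; exact: ip_intg.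
apply: le_Rintegral => //; do ?exact: ip_intg.
  by apply: intgZ => //; apply: intgD => //; exact: ip_intg.
move=> x /hkl[-> ->]; rewrite -subr_ge0 (_ : _ - _ = (H.1 x - K.1 x) ^+ 2 + (H.2 x - K.2 x) ^+ 2).
  by rewrite addr_ge0 ?sqr_ge0.
by ring.
Qed.

(** [wave_e y] is exp(-i y x) and [wave_v y] is i times it. The products of H with them are the real
    and imaginary parts of the integral of H(x) exp(i y x), that is, of the inverse Fourier
    transform at y. *)
Definition wave_e (y : R) : cfun := (fun x => cos (y * x), fun x => - sin (y * x)).
Definition wave_v (y : R) : cfun := (fun x => sin (y * x), fun x => cos (y * x)).

Lemma measurable_cosM y : measurable_fun D (fun x : R => cos (y * x)).
Proof.
apply: measurable_funTS; apply: continuous_measurable_fun => x.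
apply: continuous_comp; last exact: continuous_cos.
by apply: cvgM; [exact: cvg_cst|exact: cvg_id].
Qed.

Lemma measurable_sinM y : measurable_fun D (fun x : R => sin (y * x)).
Proof.
apply: measurable_funTS; apply: continuous_measurable_fun => x.
apply: continuous_comp; last exact: continuous_sin.
by apply: cvgM; [exact: cvg_cst|exact: cvg_id].
Qed.

Lemma cos_norm_le1 (x : R) : `|cos x| <= 1.
Proof. by rewrite ler_norml cos_geN1 cos_le1. Qed.

Lemma sin_norm_le1 (x : R) : `|sin x| <= 1.
Proof. by rewrite ler_norml sin_geN1 sin_le1. Qed.

Lemma sqi_cos y : sqi (fun x => cos (y * x)).
Proof. by apply: (@sqi_bounded _ 1) => [|x]; [exact: measurable_cosM|exact: cos_norm_le1]. Qed.

Lemma sqi_sin y : sqi (fun x => sin (y * x)).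
Proof. by apply: (@sqi_bounded _ 1) => [|x]; [exact: measurable_sinM|exact: sin_norm_le1]. Qed.

Lemma inL2_e y : inL2 (wave_e y).
Proof.
split; first exact: sqi_cos.
have [m i] := sqi_sin y; split; first exact: measurable_funN.
by move: i; congr integrable; apply/funext => x /=; rewrite sqrrN.
Qed.

Lemma inL2_v y : inL2 (wave_v y).
Proof. by split; [exact: sqi_sin|exact: sqi_cos]. Qed.

(* The real and imaginary parts of a trigonometric polynomial with real coefficients. *)
Definition trig_sum (g : int -> R) (N : nat) : cfun :=
  (fun x => (2 * pi)^-1 * zsum N (fun j => g j * cos (j%:~R * x)),
   fun x => (2 * pi)^-1 * zsum N (fun j => g j * - sin (j%:~R * x))).

Lemma int_deriv_period (F f : R -> R) : (forall x : R, is_derive x (1 : R) F (f x)) ->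
  (forall x : R, {for x, continuous f}) -> \int[mu]_(x in D) f x = F pi - F (- pi).
Proof.
move=> dF cf.
have pp : - pi < pi :> R by have := pi_gt0 R; lra.
have cF x : {for x, continuous F} by exact: der_continuous (dF x).
have mf : measurable_fun D f.
  by apply: measurable_funTS; apply: continuous_measurable_fun => x; exact: cf.
rewrite /Rintegral -(@integral_itv_bndoo _ _ _ _ true false); last exact/measurable_EFinP.
rewrite (@continuous_FTC2 _ f F) //.
- by apply: continuous_subspaceT => x; exact: cf.
- split.
  + by move=> x _; case: (dF x).
  + by apply: cvg_at_right_filter; exact: cF.
  + by apply: cvg_at_left_filter; exact: cF.
- by move=> x _; rewrite (derE (dF x)).
Qed.

Lemma sin_int_pi (n : int) : sin (n%:~R * pi) = 0 :> R.
Proof.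
have h (k : nat) : sin (k%:R * pi) = 0 :> R.
  elim: k => [|k IH]; first by rewrite mul0r sin0.
  by rewrite -addn1 natrD mulrDl mul1r sinD IH sinpi mul0r mulr0 addr0.
case: n => k; first by rewrite -pmulrn.
by rewrite NegzE mulrNz mulNr sinN -pmulrn h oppr0.
Qed.

Let cont_cos (c : R) x : {for x, continuous (fun x : R => cos (c * x))}.
Proof.
apply: (@der_continuous _ _ _ (- sin (c * x + 0) * c)).
have := der_affine (is_derive_cos (c * x + 0)).
by congr is_derive; apply/funext => y; rewrite addr0.
Qed.

Let cont_sin (c : R) x : {for x, continuous (fun x : R => sin (c * x))}.
Proof.
apply: (@der_continuous _ _ _ (cos (c * x + 0) * c)).
have := der_affine (is_derive_sin (c * x + 0)).
by congr is_derive; apply/funext => y; rewrite addr0.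
Qed.

Lemma integral_cos_int (n : int) :
  \int[mu]_(x in D) cos (n%:~R * x) = if n == 0 then 2 * pi else 0.
Proof.
case: eqP => [->|/eqP n0].
  rewrite (_ : (fun x => _) = (fun=> 1)); last by apply/funext => x; rewrite mulr0z mul0r cos0.
  by rewrite Rintegral_cst // [X in fine X]lebesgue_measure_period mul1r.
have nR0 : n%:~R != 0 :> R by rewrite intr_eq0.
have h (x : R) : is_derive x (1 : R) (fun x => n%:~R^-1 * sin (n%:~R * x)) (cos (n%:~R * x)).
  have := derZ n%:~R^-1 (der_affine (is_derive_sin (n%:~R * x + 0))).
  rewrite (_ : (fun y => _) = (fun y => n%:~R^-1 * sin (n%:~R * y))); last first.
    by apply/funext => y; rewrite addr0.
  by move=> h; apply: is_derive_eq h _; rewrite addr0; field.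
rewrite (int_deriv_period h (@cont_cos _)).
by rewrite mulrN sinN sin_int_pi oppr0 mulr0 subr0.
Qed.

Lemma integral_sin_int (n : int) : \int[mu]_(x in D) sin (n%:~R * x) = 0 :> R.
Proof.
case: (eqVneq n 0) => [->|n0].
  rewrite (_ : (fun x => _) = (fun=> 0)); last by apply/funext => x; rewrite mulr0z mul0r sin0.
  by rewrite Rintegral_cst // mul0r.
have nR0 : n%:~R != 0 :> R by rewrite intr_eq0.
have h (x : R) : is_derive x (1 : R) (fun x => - n%:~R^-1 * cos (n%:~R * x)) (sin (n%:~R * x)).
  have := derZ (- n%:~R^-1) (der_affine (is_derive_cos (n%:~R * x + 0))).
  rewrite (_ : (fun y => _) = (fun y => - n%:~R^-1 * cos (n%:~R * y))); last first.
    by apply/funext => y; rewrite addr0.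
  by move=> h; apply: is_derive_eq h _; rewrite addr0; field.
rewrite (int_deriv_period h (@cont_sin _)).
by rewrite mulrN cosN subrr.
Qed.

Definition basis (p : int * bool) : cfun :=
  if p.2 then wave_e p.1%:~R else wave_v p.1%:~R.

Lemma inL2_basis p : inL2 (basis p).
Proof. by rewrite /basis; case: ifP => _; [exact: inL2_e|exact: inL2_v]. Qed.

Lemma basis_orth p q : ip (basis p) (basis q) = if p == q then 2 * pi else 0.
Proof.
move: p q => [n a] [m b]; rewrite xpair_eqE /ip /basis.
case: a b => -[] /=; rewrite ?andbT ?andbF.
- rewrite -subr_eq0 -integral_cos_int; apply: eq_Rintegral => x _.
  by rewrite mulrNN rmorphB /= mulrBl cosB.
- rewrite -[RHS](integral_sin_int (m - n)); apply: eq_Rintegral => x _.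
  by rewrite rmorphB /= mulrBl sinB; ring.
- rewrite -[RHS](integral_sin_int (n - m)); apply: eq_Rintegral => x _.
  by rewrite rmorphB /= mulrBl sinB; ring.
- rewrite -subr_eq0 -integral_cos_int; apply: eq_Rintegral => x _.
  by rewrite rmorphB /= mulrBl cosB; ring.
Qed.

Lemma bessel_zsum N H : inL2 H ->
  zsum N (fun n => ip H (wave_e n%:~R) ^+ 2 + ip H (wave_v n%:~R) ^+ 2) <= 2 * pi * ip H H.
Proof.
move=> h.
pose s := [seq (i%:Z - N%:Z, b) | i <- index_iota 0 N.*2.+1, b <- [:: true; false]].
have us : uniq s.
  by apply: allpairs_uniq => //; [exact: iota_uniq|move=> [i b] [j c] _ _ /= []; lia + (move=> e ->; congr pair; lia)].
have := bessel_inequality inL2_axpy ipC ip_axpy ip_ge0 _ us inL2_basis basis_orth h.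
rewrite mulr_gt0 ?pi_gt0 // => /(_ isT); apply: le_trans.
rewrite zsumE /s big_allpairs_dep big_mkord le_eqVlt; apply/orP; left; apply/eqP.
by apply: eq_bigr => i _; rewrite !big_cons big_nil /= addr0.
Qed.

Lemma inL2_trig_sum (g : int -> R) N : inL2 (trig_sum g N).
Proof.
have s0 : sqi (fun=> 0) by apply: (@sqi_bounded _ 0) => // x; rewrite normr0.
have sN f : sqi f -> sqi (fun x => - f x).
  by move=> sf; have := sqi_lin (-1) s0 sf; congr sqi; apply/funext => x; rewrite mulN1r add0r.
have sz (F : int -> R -> R) : (forall j, sqi (F j)) -> sqi (fun x => zsum N (fun j => g j * F j x)).
  move=> sF; elim: N => [|M IH] /=.
    by have := sqi_lin (g 0) s0 (sF 0); congr sqi; apply/funext => x; rewrite add0r.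
  exact: (sqi_lin _ (sqi_lin _ IH (sF _)) (sF _)).
have sZ c f : sqi f -> sqi (fun x => c * f x).
  by move=> sf; have := sqi_lin c s0 sf; congr sqi; apply/funext => x; rewrite add0r.
split; apply: sZ; first by apply: (sz (fun j x => cos (j%:~R * x))) => j; exact: sqi_cos.
by apply: (sz (fun j x => - sin (j%:~R * x))) => j; apply: sN; exact: sqi_sin.
Qed.

Lemma ip_trig_sum (g : int -> R) N H : inL2 H ->
  ip (trig_sum g N) H = (2 * pi)^-1 * zsum N (fun j => g j * ip (wave_e j%:~R) H).
Proof.
move=> h.
pose T M : cfun := (fun x => zsum M (fun j => g j * cos (j%:~R * x)),
   fun x => zsum M (fun j => g j * - sin (j%:~R * x))).
have p0 : 2 * pi != 0 :> R by rewrite mulf_neq0 // gt_eqF // pi_gt0.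
have pi0 : pi != 0 :> R by rewrite gt_eqF // pi_gt0.
have iT M : inL2 (T M).
  have := inL2_axpy (1 - 2 * pi) (inL2_trig_sum g M) (inL2_trig_sum g M).
  rewrite (_ : axpy _ _ _ = T M) // /axpy /T /trig_sum /=.
  by congr (_, _); apply/funext => x;
    rewrite mulrBl mul1r mulrA mulfV // mul1r opprB addrCA subrr addr0.
(* Linearity is available through [axpy] only, so a multiple c T is written T - (1 - c) T. *)
have -> : ip (trig_sum g N) H = (2 * pi)^-1 * ip (T N) H.
  have e1 : trig_sum g N = axpy (T N) (1 - (2 * pi)^-1) (T N).
    by rewrite /axpy /trig_sum /T /=; congr (_, _); apply/funext => x; ring.
  by rewrite e1 ip_axpy //; ring.
congr (_ * _); elim: N => [|M IH] /=.
  have -> : T 0%N = axpy (wave_e 0%:~R) (1 - g 0) (wave_e 0%:~R).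
    by rewrite /axpy /T /wave_e /=; congr (_, _); apply/funext => x; ring.
  by rewrite ip_axpy ?inL2_e //; [ring|exact: inL2_e|exact: inL2_e].
have -> : T M.+1 = axpy (axpy (T M) (- g M.+1%:Z) (wave_e M.+1%:~R))
     (- g (- M.+1%:Z)) (wave_e (- M.+1%:Z)%:~R).
  by rewrite /axpy /T /wave_e /=; congr (_, _); apply/funext => x; ring.
rewrite !ip_axpy //; do ?[exact: inL2_e | exact: inL2_axpy (iT M) (inL2_e _)].
by rewrite IH; ring.
Qed.

(** The factor 1/(2 pi) cancels the squared norm 2 pi of the basis vectors, so the coefficients come
    back; those along [wave_v] vanish because [g] is real. *)
Lemma ip_trig_sum_basis (g : int -> R) N p :
  ip (trig_sum g N) (basis p) = if p.2 && (`|p.1| <= N)%N then g p.1 else 0.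
Proof.
rewrite ip_trig_sum; last exact: inL2_basis.
have p0 : 2 * pi != 0 :> R by rewrite mulf_neq0 // gt_eqF // pi_gt0.
have -> : (fun j => g j * ip (wave_e j%:~R) (basis p)) =
    (fun j => if (j, true) == p then 2 * pi * g p.1 else 0).
  apply/funext => j; rewrite (basis_orth (j, true)); case: eqP => [<-|_] /=; first by rewrite mulrC.
  by rewrite mulr0.
case: p => n [] /=; last first.
  rewrite (_ : (fun j => _) = (fun=> 0)) ?zsum0 ?mulr0 //.
  by apply/funext => j; rewrite xpair_eqE andbF.
rewrite (_ : (fun j => _) = (fun j => if j == n then 2 * pi * g n else 0)).
  by rewrite zsum_delta; case: ifP => _; [rewrite mulKf|rewrite mulr0].
by apply/funext => j; rewrite xpair_eqE andbT.
Qed.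

Lemma ip_trig_sum_self (g : int -> R) N :
  ip (trig_sum g N) (trig_sum g N) = (2 * pi)^-1 * zsum N (fun j => g j ^+ 2).
Proof.
rewrite ip_trig_sum; last exact: inL2_trig_sum.
congr (_ * _); apply: eq_zsum => j jN.
by rewrite ipC (ip_trig_sum_basis g N (j, true)) /= jN expr2.
Qed.

End SquareIntegrable.

Lemma cvge0_le {R : realType} {U : Type} {F : set_system U} {FF : Filter F} (u : U -> \bar R) :
  (forall x, 0 <= u x)%E -> (forall e : R, 0 < e -> \forall x \near F, (u x <= e%:E)%E) ->
  u @ F --> 0%E.
Proof.
move=> u0 hu; apply/fine_cvgP; split.
  apply: filterS (hu 1 ltr01) => x hx.
  by rewrite ge0_fin_numE //; exact: le_lt_trans hx (ltry _).
apply/cvgrPdist_le => e e0; apply: filterS (hu e e0) => x hx.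
rewrite sub0r normrN ger0_norm ?fine_ge0 //= -lee_fin fineK //.
by rewrite ge0_fin_numE //; exact: le_lt_trans hx (ltry _).
Qed.

Lemma cvge0_near_le {R : realType} {U : Type} {F : set_system U} {FF : Filter F}
  (u : U -> \bar R) (e : R) : u @ F --> 0%E -> 0 < e -> \forall x \near F, (u x <= e%:E)%E.
Proof.
move=> /fine_cvgP[h1 /cvgrPdist_le h2] e0.
apply: filterS2 h1 (h2 _ e0) => x fx; rewrite sub0r normrN => hx.
by rewrite -(fineK fx) lee_fin (le_trans _ hx) // ler_norm.
Qed.

(** * Fourier series of square summable sequences *)

Section Interpolation.
Variable R : realType.
Local Notation mu := (@lebesgue_measure R).
Local Notation D := (`]- pi, pi[%classic : set R).
Implicit Types (F G : R -> R[i]) (H K : cfun R) (f h : int -> R).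

Let mD : measurable D. Proof. exact: measurable_itv. Qed.

Definition sqmod (z : R[i]) : R := complex.Re z ^+ 2 + complex.Im z ^+ 2.

Lemma sqmod_ge0 z : 0 <= sqmod z.
Proof. by rewrite addr_ge0 ?sqr_ge0. Qed.

Lemma L2norm_le F (c : R) : 0 <= c ->
  (L2norm F <= c%:E)%E = (\int[mu]_x (sqmod (F x))%:E <= (c ^+ 2)%:E)%E.
Proof.
move=> c0; rewrite /L2norm unlock.
have -> : (\int[mu]_x (`|(ComplexField.Normc.normc (F x))%:E| `^ 2))%E =
    (\int[mu]_x (sqmod (F x))%:E)%E.
  apply: eq_integral => x _.
  have n0 : 0 <= ComplexField.Normc.normc (F x) by case: (F x) => a b; exact: sqrtr_ge0.
  rewrite gee0_abs ?lee_fin // poweR_EFin powR_mulrn //; congr EFin.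
  by case: (F x) => a b; rewrite /= sqr_sqrtr // addr_ge0 ?sqr_ge0.
have : (0 <= \int[mu]_x (sqmod (F x))%:E)%E.
  by apply: integral_ge0 => x _; rewrite lee_fin sqmod_ge0.
case: (\int[mu]_x _)%E => [r||] // r0'.
  have r0 : 0 <= r by rewrite -lee_fin.
  rewrite poweR_EFin !lee_fin powR12_sqrt // -[in RHS](sqr_sqrtr r0).
  by rewrite ler_pXn2r ?nnegrE ?sqrtr_ge0.
by rewrite poweRyr ?invr_eq0 // !leye_eq.
Qed.

Definition parts G : cfun R := (fun x => complex.Re (G x), fun x => complex.Im (G x)).

Lemma Re_zsum N (E : int -> R[i]) : complex.Re (zsum N E) = zsum N (fun j => complex.Re (E j)).
Proof.
elim: N => //= N <-.
by case: (zsum N E) => a b; case: (E N.+1%:Z) => c d; case: (E (- N.+1%:Z)).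
Qed.

Lemma Im_zsum N (E : int -> R[i]) : complex.Im (zsum N E) = zsum N (fun j => complex.Im (E j)).
Proof.
elim: N => //= N <-.
by case: (zsum N E) => a b; case: (E N.+1%:Z) => c d; case: (E (- N.+1%:Z)).
Qed.

Lemma parts_fourier_partial_sum f N : parts (fourier_partial_sum f N) = trig_sum f N.
Proof.
have e x : fourier_partial_sum f N x =
   ((2 * pi)^-1)%:C * zsum N (fun j => expi (- (j%:~R * x)) * (f j)%:C).
  by rewrite zsumE.
rewrite /parts /trig_sum; congr (_, _); apply/funext => x; rewrite e.
  have -> : forall (a : R) (z : R[i]), complex.Re (a%:C * z) = a * complex.Re z.
    by move=> a [u v] /=; rewrite mul0r subr0.
  rewrite Re_zsum; congr (_ * _); apply: eq_zsum => j _ /=.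
  by rewrite mulr0 subr0 cosN mulrC.
have -> : forall (a : R) (z : R[i]), complex.Im (a%:C * z) = a * complex.Im z.
  by move=> a [u v] /=; rewrite mul0r addr0.
rewrite Im_zsum; congr (_ * _); apply: eq_zsum => j _ /=.
by rewrite mulr0 add0r sinN mulrC.
Qed.

Lemma integral_theta (g : R -> R) (F : R -> R) :
  (forall x, F x = \1_D x * g x) ->
  (\int[mu]_x (F x)%:E = \int[mu]_(x in D) (g x)%:E)%E.
Proof.
move=> h; rewrite [RHS]integral_mkcond; apply: eq_integral => x _.
rewrite h patchE indicE; case: ifP => _ /=; by rewrite ?mul1r ?mul0r.
Qed.

Lemma sqmod_theta G f N x :
  sqmod (theta_pi x * (G x - fourier_partial_sum f N x)) = \1_D x *
  (((parts G).1 x - (trig_sum f N).1 x) ^+ 2 + ((parts G).2 x - (trig_sum f N).2 x) ^+ 2).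
Proof.
rewrite -parts_fourier_partial_sum [(parts G).1 x]/(complex.Re (G x))
  [(parts G).2 x]/(complex.Im (G x)) [(parts _).1 x]/(complex.Re _) [(parts _).2 x]/(complex.Im _).
rewrite /sqmod /theta_pi.
case: (G x) => a b; case: (fourier_partial_sum f N x) => c d /=.
rewrite indicE; case: (x \in _) => /=; rewrite ?(mul0r, mul1r, subr0, addr0) //.
by rewrite expr0n /= addr0.
Qed.

Lemma axpy1 H K : axpy H 1 K = (fun x => H.1 x - K.1 x, fun x => H.2 x - K.2 x).
Proof. by congr (_, _); apply/funext => x; rewrite mul1r. Qed.

Lemma ip_selfE H : inL2 H ->
  (\int[mu]_(x in D) (H.1 x ^+ 2 + H.2 x ^+ 2)%:E = (ip H H)%:E)%E.
Proof.
move=> hH; by rewrite /ip -RintgE //; exact: ip_intg.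
Qed.

Lemma inL2_of_le H (c : R) : measurable_fun D H.1 -> measurable_fun D H.2 ->
  (\int[mu]_(x in D) (H.1 x ^+ 2 + H.2 x ^+ 2)%:E <= c%:E)%E -> inL2 H.
Proof.
move=> m1 m2 hc.
have i : mu.-integrable D (EFin \o (fun x => H.1 x ^+ 2 + H.2 x ^+ 2)).
  apply/integrableP; split.
    by apply/measurable_EFinP; apply: measurable_funD; exact: measurable_funX.
  apply: le_lt_trans (ltry c); apply: le_trans hc.
  by under eq_integral do rewrite /= ger0_norm ?addr_ge0 ?sqr_ge0 //.
split; split => //; apply: (@le_intg _ _ (fun x => H.1 x ^+ 2 + H.2 x ^+ 2)) => //;
  do ?[exact: measurable_funX]; move=> x; rewrite ger0_norm ?sqr_ge0 //.
  by rewrite lerDl sqr_ge0.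
by rewrite lerDr sqr_ge0.
Qed.

Definition ell2_bnd f (M : R) := forall N, zsum N (fun j => f j ^+ 2) <= M.

Lemma trig_sum_diff f N M : (N <= M)%N ->
  ip (axpy (trig_sum f M) 1 (trig_sum f N)) (axpy (trig_sum f M) 1 (trig_sum f N)) =
  (2 * pi)^-1 * (zsum M (fun j => f j ^+ 2) - zsum N (fun j => f j ^+ 2)).
Proof.
move=> NM.
have iN := inL2_trig_sum f N; have iM := inL2_trig_sum f M.
have iA := inL2_axpy 1 iM iN.
rewrite ip_axpy // ![ip _ (axpy _ _ _)]ipC !ip_axpy // !ip_trig_sum_self [ip (trig_sum f M) (trig_sum f N)]ipC.
have -> : ip (trig_sum f N) (trig_sum f M) = (2 * pi)^-1 * zsum N (fun j => f j ^+ 2).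
  rewrite ip_trig_sum //; congr (_ * _); apply: eq_zsum => j jN.
  by rewrite ipC (ip_trig_sum_basis f M (j, true)) /= (leq_trans jN NM) expr2.
ring.
Qed.

Lemma cvgn_geometric_steps (u : nat -> R) (C : R) :
  (forall k, `|u k.+1 - u k| <= C * 2^-1 ^+ k) -> cvgn u.
Proof.
move=> hu.
have cv : cvgn (series (fun k => u k.+1 - u k)).
  apply: normed_cvg; apply: (@series_le_cvg _ _ (geometric C 2^-1)) => //.
  - by move=> n; exact: normr_ge0.
  - by move=> n; apply: le_trans (normr_ge0 _) (hu n).
  - by apply: is_cvg_geometric_series; rewrite ger0_norm ?invr_ge0 // invf_lt1 // ltr1n.
have e : u = (fun n => series (fun k => u k.+1 - u k) n + u 0%N).
  apply/funext => n; rewrite /series /= telescope_sumr // addrNK //.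
by rewrite e; apply: is_cvgD => //; exact: is_cvg_cst.
Qed.

(* Riesz-Fischer: a rapidly convergent subsequence of the partial sums converges almost
   everywhere, and Fatou's lemma bounds the distance to its limit. *)
Lemma fourier_series_exists f M : ell2_bnd f M -> exists G, is_fourier_series f G.
Proof.
move=> hM.
pose z N := zsum N (fun j => f j ^+ 2).
have znd : nondecreasing_seq z.
  by apply/nondecreasing_seqP => n; apply: zsum_mono => // j; exact: sqr_ge0.
have cz : cvgn z by apply: nondecreasing_is_cvgn => //; exists M => _ [n _ <-]; exact: hM.
pose L := limn z.
have zL n : z n <= L by exact: nondecreasing_cvgn_le.
have zcv : z @ \oo --> L by exact: cz.
(* The rate 8^-k leaves room for the weight 4^k in [w]: the integrals of [w k] are still summable,
   while a bound on [w k x] forces steps of order 2^-k at x. *)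
have ex k : exists n, L - z n <= 8^-1 ^+ k.
  have p : 0 < 8^-1 ^+ k :> R by rewrite exprn_gt0 // invr_gt0.
  have /cvgrPdist_le/(_ _ p)[n _ hn] := zcv; exists n.
  by apply: le_trans (ler_norm _) _; apply: (hn n) => /=.
have [n hn] := choice ex.
(* Adding k and all the earlier choices makes the index increasing and at least both k and [n k]. *)
pose N k := (k + \sum_(i < k.+1) n i)%N.
have Nk k : (k <= N k)%N by exact: leq_addr.
have nN k : (n k <= N k)%N by rewrite /N big_ord_recr /= addnA leq_addl.
have NN k : (N k <= N k.+1)%N.
  by rewrite /N [X in (_ <= _ + X)%N]big_ord_recr /=; apply: leq_add => //; exact: leq_addr.
pose S k := trig_sum f (N k).
pose dl k := axpy (S k.+1) 1 (S k).
have iS k : inL2 (S k) by exact: inL2_trig_sum.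
have idl k : inL2 (dl k) by exact: inL2_axpy.
pose w k x := 4 ^+ k * ((dl k).1 x ^+ 2 + (dl k).2 x ^+ 2).
have pi1 : (2 * pi)^-1 <= 1 :> R.
  by rewrite invf_le1 ?mulr_gt0 ?pi_gt0 //; have := @pi_ge2 R; lra.
have w0 k x : 0 <= w k x by rewrite mulr_ge0 ?exprn_ge0 // addr_ge0 ?sqr_ge0.
have mS k : measurable_fun D (S k).1 /\ measurable_fun D (S k).2.
  by have [[? _] [? _]] := iS k.
have iwk k : mu.-integrable D (EFin \o w k).
  apply: intgZ => //; have := ip_intg (idl k) (idl k).
  by congr integrable; apply/funext => x /=; rewrite !expr2.
have Iw k : (\int[mu]_(x in D) (w k x)%:E <= (2^-1 ^+ k)%:E)%E.
  rewrite RintgE // lee_fin RintgZ //; last first.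
    have := ip_intg (idl k) (idl k).
    by congr integrable; apply/funext => x /=; rewrite !expr2.
  have -> : \int[mu]_(x in D) ((dl k).1 x ^+ 2 + (dl k).2 x ^+ 2) = ip (dl k) (dl k).
    by apply: eq_Rintegral => x _; rewrite !expr2.
  have e2 : 2^-1 ^+ k = 4 ^+ k * 8^-1 ^+ k :> R by rewrite -exprMn; congr (_ ^+ _); field.
  rewrite e2 ler_pM2l ?exprn_gt0 // trig_sum_diff //.
  have h1 : z (N k.+1) - z (N k) <= 8^-1 ^+ k.
    apply: le_trans (hn k); apply: lerB; [exact: zL|exact: znd].
  have h2 : 0 <= z (N k.+1) - z (N k) by rewrite subr_ge0 znd.
  by apply: le_trans h1; rewrite ler_piMl.
pose Phi x := (\sum_(0 <= k <oo) (w k x)%:E)%E.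
have mw k : measurable_fun D (fun x => (w k x)%:E) by have /measurable_int := iwk k.
have Phi0 x : (0 <= Phi x)%E by apply: nneseries_ge0 => k _ _; rewrite lee_fin.
have mPhi : measurable_fun D Phi.
  by apply: ge0_emeasurable_sum => // k x _ _; rewrite lee_fin.
have IPhi : (\int[mu]_(x in D) Phi x <= 2%:E)%E.
  rewrite integral_nneseries //; last by move=> k x _; rewrite lee_fin.
  apply: lime_le.
    by apply: is_cvg_nneseries => k _ _; apply: integral_ge0 => x _; rewrite lee_fin.
  apply: nearW => m; rewrite big_mkord.
  apply: (@le_trans _ _ (\sum_(k < m) 2^-1 ^+ k)%:E).
    by rewrite -sumEFin; apply: lee_sum => k _.
  have -> : \sum_(k < m) 2^-1 ^+ k = 2 - 2 * 2^-1 ^+ m :> R.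
    elim: m => [|m IH]; first by rewrite big_ord0 expr0; ring.
    by rewrite big_ord_recr /= IH exprS; field.
  by rewrite lee_fin gerBl mulr_ge0 // exprn_ge0 // invr_ge0.
have iPhi : mu.-integrable D Phi.
  apply/integrableP; split => //; under eq_integral do rewrite gee0_abs //.
  exact: le_lt_trans IPhi (ltry _).
pose E : set R := D `&` Phi @^-1` [set` `]-oo%E, +oo%E[].
have mE : measurable E by apply: mPhi => //; exact: emeasurable_itv.
have Ew x : E x -> exists C, forall k, w k x <= C.
  move=> [_ /=]; rewrite in_itv /= => /andP[p1 p2].
  have fin : Phi x \is a fin_num by rewrite fin_numE -ltNye p1 /= -ltey p2.
  exists (fine (Phi x)) => k; rewrite -lee_fin fineK //.
  apply: le_trans (nneseries_lim_ge k.+1 _); last by move=> ? _ _; rewrite lee_fin.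
  rewrite big_nat_recr //= leeDr // sume_ge0 // => i _; rewrite lee_fin //.
have stepb (a C : R) k : 4 ^+ k * a ^+ 2 <= C -> `|a| <= (1 + C) / 2 * 2^-1 ^+ k.
  move=> h; set t : R := 2 ^+ k; have t0 : 0 < t by rewrite exprn_gt0.
  have e4 : 4 ^+ k = t ^+ 2 :> R by rewrite /t -exprM mulnC exprM; congr (_ ^+ _); ring.
  have h2 : 2 * (t * `|a|) <= 1 + (t * `|a|) ^+ 2.
    by have := sqr_ge0 (t * `|a| - 1); rewrite sqrrB mulr1 expr1n mulr2n; lra.
  rewrite exprVn -/t ler_pdivlMr // mulrC.
  by move: h h2; rewrite e4 exprMn real_normK ?num_real //; lra.
have cv1 x : E x -> cvgn (fun k => (S k).1 x).
  move=> /Ew[C hC]; apply: (@cvgn_geometric_steps _ ((1 + C) / 2)) => k.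
  have -> : (S k.+1).1 x - (S k).1 x = (dl k).1 x by rewrite /dl axpy1.
  apply: stepb; apply: le_trans (hC k); rewrite /w ler_pM2l ?exprn_gt0 //.
  by rewrite lerDl sqr_ge0.
have cv2 x : E x -> cvgn (fun k => (S k).2 x).
  move=> /Ew[C hC]; apply: (@cvgn_geometric_steps _ ((1 + C) / 2)) => k.
  have -> : (S k.+1).2 x - (S k).2 x = (dl k).2 x by rewrite /dl axpy1.
  apply: stepb; apply: le_trans (hC k); rewrite /w ler_pM2l ?exprn_gt0 //.
  by rewrite lerDr sqr_ge0.
(* Cut off outside [E], the partial sums converge at every point, which makes the limit measurable;
   the complement of [E] in the period is null. *)
pose h1 k x := \1_E x * (S k).1 x; pose h2 k x := \1_E x * (S k).2 x.
pose G1 x := \1_E x * limn (fun k => (S k).1 x).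
pose G2 x := \1_E x * limn (fun k => (S k).2 x).
have hc1 x : h1 ^~ x @ \oo --> G1 x.
  rewrite /h1 /G1 indicE; case: (pselect (E x)) => Ex.
    by rewrite mem_set //; apply: cvgM; [exact: cvg_cst|exact: cv1].
  by rewrite memNset // !mul0r; under eq_fun do rewrite mul0r; exact: cvg_cst.
have hc2 x : h2 ^~ x @ \oo --> G2 x.
  rewrite /h2 /G2 indicE; case: (pselect (E x)) => Ex.
    by rewrite mem_set //; apply: cvgM; [exact: cvg_cst|exact: cv2].
  by rewrite memNset // !mul0r; under eq_fun do rewrite mul0r; exact: cvg_cst.
have mI : measurable_fun D (\1_E : R -> R) by exact: measurable_funTS.
have mh1 k : measurable_fun D (h1 k) by apply: measurable_funM => //; exact: (mS k).1.
have mh2 k : measurable_fun D (h2 k) by apply: measurable_funM => //; exact: (mS k).2.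
have mG1 : measurable_fun D G1 by apply: (measurable_fun_cvg mh1) => x _.
have mG2 : measurable_fun D G2 by apply: (measurable_fun_cvg mh2) => x _.
exists (fun x => Complex (G1 x) (G2 x)); split; first by split.
have bound N0 : (\int[mu]_(x in D) ((G1 x - (trig_sum f N0).1 x) ^+ 2 +
    (G2 x - (trig_sum f N0).2 x) ^+ 2)%:E <= (L - z N0)%:E)%E.
  have iT := inL2_trig_sum f N0; have [[mT1 _] [mT2 _]] := iT.
  (* The shift by [N0] keeps the index of the subsequence at least [N0], so that [trig_sum_diff]
     applies. *)
  pose F k x := ((h1 (k + N0)%N x - (trig_sum f N0).1 x) ^+ 2 +
    (h2 (k + N0)%N x - (trig_sum f N0).2 x) ^+ 2)%:E.
  have mF k : measurable_fun D (F k).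
    apply/measurable_EFinP; apply: measurable_funD; apply: measurable_funX; exact: measurable_funB.
  have F0 k x : (0 <= F k x)%E by rewrite lee_fin addr_ge0 ?sqr_ge0.
  have := fatou mu mD mF (fun k x _ => F0 k x).
  have -> : (\int[mu]_(x in D) limn_einf (F ^~ x) = \int[mu]_(x in D)
      ((G1 x - (trig_sum f N0).1 x) ^+ 2 + (G2 x - (trig_sum f N0).2 x) ^+ 2)%:E)%E.
    apply: eq_integral => x _; apply: (cvg_limn_einf_sup _).1.
    apply: cvg_EFin; first by apply: nearW.
    apply: cvgD; rewrite ?expr2.
      under eq_fun do rewrite expr2.
      by apply: cvgM; apply: cvgB; do ?exact: cvg_cst; rewrite (cvg_shiftn N0 (h1 ^~ x)); exact: hc1.
    under eq_fun do rewrite expr2.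
    by apply: cvgM; apply: cvgB; do ?exact: cvg_cst; rewrite (cvg_shiftn N0 (h2 ^~ x)); exact: hc2.
  move=> hf; apply: le_trans hf _.
  have IF k : (\int[mu]_(x in D) F k x <= (L - z N0)%:E)%E.
    have iA := inL2_axpy 1 (iS (k + N0)%N) iT.
    have -> : (\int[mu]_(x in D) F k x = \int[mu]_(x in D)
        ((axpy (S (k + N0)%N) 1 (trig_sum f N0)).1 x ^+ 2 +
         (axpy (S (k + N0)%N) 1 (trig_sum f N0)).2 x ^+ 2)%:E)%E.
      have [[ma1 _] [ma2 _]] := iA.
      apply: ge0_ae_eq_integral => //.
      - exact: mF.
      - by apply/measurable_EFinP; apply: measurable_funD; exact: measurable_funX.
      - by move=> x _; rewrite lee_fin addr_ge0 ?sqr_ge0.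
      have [A [mA A0 hA]] : {ae mu, forall x, D x -> Phi x \is a fin_num}.
        by apply: integrable_ae iPhi; exact: measurable_itv.
      exists A; split => // x nx; apply: hA => hx; apply: nx => Dx.
      have Ex : E x.
        split => //=; move: (hx Dx); rewrite fin_numE in_itv /= => /andP[q1 q2].
        by rewrite ltNye q1 ltey q2.
      by rewrite /F /h1 /h2 axpy1 indicE mem_set //= !mul1r.
    rewrite ip_selfE // lee_fin trig_sum_diff; last exact: leq_trans (leq_addl k N0) (Nk _).
    have le1 : 0 <= z (N (k + N0)%N) - z N0.
      by rewrite subr_ge0; apply: znd; exact: leq_trans (leq_addl k N0) (Nk _).
    apply: (@le_trans _ _ (z (N (k + N0)%N) - z N0)); first by rewrite ler_piMl.
    by rewrite lerB.
  rewrite limn_einf_lim; apply: lime_le; first exact: is_cvg_einfs.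
  apply: nearW => k; apply: le_trans (IF k).
  by apply: ereal_inf_lbound; exists k => /=.
apply: cvge0_le => [N0|e e0]; first exact: Lnorm_ge0.
have e2 : 0 < e ^+ 2 by rewrite exprn_gt0.
have /cvgrPdist_le/(_ _ e2)[m _ hm] := zcv.
exists m => // N0 mN0; rewrite /= L2norm_le; last exact: ltW.
rewrite (integral_theta (fun x => sqmod_theta (fun x => Complex (G1 x) (G2 x)) f N0 x)).
apply: le_trans (bound N0) _; rewrite lee_fin.
by apply: le_trans (ler_norm _) _; exact: hm.
Qed.

End Interpolation.

(** * Distance from the interpolation to a step function *)

Section InterpolationEstimate.
Variable R : realType.
Local Notation mu := (@lebesgue_measure R).
Local Notation D := (`]- pi, pi[%classic : set R).
Implicit Types (F G : R -> R[i]) (H K : cfun R) (f h : int -> R).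

Let mD : measurable D. Proof. exact: measurable_itv. Qed.

Lemma fourier_seriesP f M : ell2_bnd f M ->
  inL2 (parts (fourier_series f)) /\
  forall e : R, 0 < e -> exists N0, forall N, (N0 <= N)%N ->
    ip (axpy (parts (fourier_series f)) 1 (trig_sum f N))
       (axpy (parts (fourier_series f)) 1 (trig_sum f N)) <= e.
Proof.
move=> hM; set G := fourier_series f.
have [[mG1 mG2] cv] : is_fourier_series f G by exact: (xgetPex _ (fourier_series_exists hM)).
have key (e : R) : 0 < e -> exists N0, forall N, (N0 <= N)%N ->
   (\int[mu]_(x in D) ((axpy (parts G) 1 (trig_sum f N)).1 x ^+ 2 +
    (axpy (parts G) 1 (trig_sum f N)).2 x ^+ 2)%:E <= e%:E)%E.
  move=> e0; have s0 : 0 < Num.sqrt e by rewrite sqrtr_gt0.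
  have [N0 _ hN] := cvge0_near_le cv s0.
  exists N0 => N NN; rewrite axpy1.
  have : (L2norm (fun x => theta_pi x * (G x - fourier_partial_sum f N x))%R <= (Num.sqrt e)%:E)%E.
    exact: hN.
  rewrite L2norm_le; last exact: ltW.
  by rewrite (integral_theta (fun x => sqmod_theta G f N x)) sqr_sqrtr ?(ltW e0).
have iA N : inL2 (axpy (parts G) 1 (trig_sum f N)) -> inL2 (parts G).
  move=> h; have := inL2_axpy (-1) h (inL2_trig_sum f N); congr inL2.
  rewrite axpy1 /axpy /parts /=; congr (_, _); apply/funext => x; ring.
have iG : inL2 (parts G).
  have [N0 hN] := key 1 ltr01; have := hN N0 (leqnn _) => h.
  have [[mT1 _] [mT2 _]] := inL2_trig_sum f N0.
  apply: (iA N0); apply: inL2_of_le h; rewrite axpy1 /=; exact: measurable_funB.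
split => // e e0; have [N0 hN] := key e e0; exists N0 => N NN.
have := hN N NN; rewrite ip_selfE ?lee_fin //.
by apply: inL2_axpy => //; exact: inL2_trig_sum.
Qed.

Lemma interpolationE f x :
  interpolation f x = Complex (ip (parts (fourier_series f)) (wave_e x))
                              (ip (parts (fourier_series f)) (wave_v x)).
Proof.
rewrite /interpolation /inverse_fourier /cintegral; congr Complex.
  rewrite /ip [RHS]Rintegral_mkcond; apply: eq_Rintegral => y _.
  rewrite patchE /theta_pi indicE /parts /wave_e /expi /=.
  case: (fourier_series f y) => a b; case: ifP => _ /=; first by rewrite [x * y]mulrC; ring.
  by rewrite [RHS](_ : _ = 0) //; ring.
rewrite /ip [RHS]Rintegral_mkcond; apply: eq_Rintegral => y _.
rewrite patchE /theta_pi indicE /parts /wave_e /expi /=.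
case: (fourier_series f y) => a b; case: ifP => _ /=; first by rewrite [x * y]mulrC; ring.
by rewrite [RHS](_ : _ = 0) //; ring.
Qed.

(* Multiplication by exp(i s x), that is, translation of the interpolation by s. *)
Definition rotate (s : R) H : cfun R :=
  (fun x => H.1 x * cos (s * x) - H.2 x * sin (s * x),
   fun x => H.1 x * sin (s * x) + H.2 x * cos (s * x)).

Lemma inL2_rotate s H : inL2 H -> inL2 (rotate s H).
Proof.
move=> [s1 s2].
have mc := measurable_cosM s; have ms := measurable_sinM s.
have c1 (x : R) : `|cos (s * x)| <= 1 by exact: cos_norm_le1.
have n1 (x : R) : `|sin (s * x)| <= 1 by exact: sin_norm_le1.
have h1 := sqi_mul s1 mc c1; have h2 := sqi_mul s2 ms n1.
have h3 := sqi_mul s1 ms n1; have h4 := sqi_mul s2 mc c1.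
split.
  by have := sqi_linB 1 h1 h2; congr sqi; apply/funext => x; rewrite mul1r.
by have := sqi_lin 1 h3 h4; congr sqi; apply/funext => x; rewrite mul1r.
Qed.

Lemma rotate_sqmod s H x :
  (rotate s H).1 x ^+ 2 + (rotate s H).2 x ^+ 2 = H.1 x ^+ 2 + H.2 x ^+ 2.
Proof.
rewrite /rotate /=; have := cos2Dsin2 (s * x); move: (cos _) (sin _) => c t e.
by rewrite -[RHS]mul1r -e; ring.
Qed.

Lemma ip_rotate_e s y H : ip (rotate s H) (wave_e y) = ip H (wave_e (y + s)).
Proof. by apply: eq_Rintegral => x _ /=; rewrite (mulrDl y s x) cosD sinD; ring. Qed.

Lemma ip_rotate_v s y H : ip (rotate s H) (wave_v y) = ip H (wave_v (y + s)).
Proof. by apply: eq_Rintegral => x _ /=; rewrite (mulrDl y s x) cosD sinD; ring. Qed.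

Lemma cos_le_scale (s x : R) : 0 <= s <= 1 -> D x -> cos x <= cos (s * x).
Proof.
move=> /andP[s0 s1]; rewrite /= in_itv /= => /andP[x1 x2].
have pos y : 0 <= y <= pi -> cos y <= cos (s * y).
  move=> /andP[y0 y1].
  have sy : s * y <= y by rewrite ler_piMl.
  have sy0 : 0 <= s * y by rewrite mulr_ge0.
  rewrite leNgt ltr_cos ?in_itv /= ?y0 ?y1 ?sy0 ?(le_trans sy y1) //.
  by rewrite -leNgt.
case: (lerP 0 x) => x0; first by apply: pos; rewrite x0 ltW.
rewrite -cosN -[leRHS]cosN -mulrN; apply: pos; apply/andP; split; lra.
Qed.

(** Pointwise, |exp(i s x) - 1|^2 = 2 - 2 cos(s x), which for |x| < pi is at most its value at s =
    1. A translation by a fraction of a site costs no more than one by a full site, and the latter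
    is a difference operator. *)
Lemma rotate_diff_le s H : 0 <= s <= 1 -> inL2 H ->
  ip (axpy (rotate s H) 1 H) (axpy (rotate s H) 1 H) <=
  ip (axpy (rotate 1 H) 1 H) (axpy (rotate 1 H) 1 H).
Proof.
move=> s01 hH; apply: ip_le; do ?[by apply: inL2_axpy => //; exact: inL2_rotate].
move=> x Dx; rewrite /axpy /rotate /= !mul1r.
have e (y : R) : (H.1 x * cos y - H.2 x * sin y - H.1 x) ^+ 2 +
   (H.1 x * sin y + H.2 x * cos y - H.2 x) ^+ 2 = (2 - 2 * cos y) * (H.1 x ^+ 2 + H.2 x ^+ 2).
  have := cos2Dsin2 y; move: (cos y) (sin y) => c t h.
  have -> : (H.1 x * c - H.2 x * t - H.1 x) ^+ 2 + (H.1 x * t + H.2 x * c - H.2 x) ^+ 2 =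
    (c ^+ 2 + t ^+ 2) * (H.1 x ^+ 2 + H.2 x ^+ 2) + (1 - 2 * c) * (H.1 x ^+ 2 + H.2 x ^+ 2) by ring.
  by rewrite h; ring.
rewrite !e; apply: ler_wpM2r; first by rewrite addr_ge0 ?sqr_ge0.
by have := cos_le_scale s01 Dx; lra.
Qed.

(** Multiplying by exp(i x) shifts the coefficients by one site, so the difference has coefficients
    [deltap h]; their support reaches one site further to the left, hence [N.+1]. *)
Lemma rotate_trig_sum h (N : nat) : (forall j, (N < `|j|)%N -> h j = 0) ->
  axpy (rotate 1 (trig_sum h N)) 1 (trig_sum h N) = trig_sum (deltap h) N.+1.
Proof.
move=> h0.
have sh (g : int -> R -> R) x : zsum N.+1 (fun j => h (j + 1) * g j x) =
    zsum N (fun j => h j * g (j - 1) x).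
  rewrite -(@zsum_widen _ N N.+1 (fun j => h j * g (j - 1) x)) //; last first.
    by move=> j jN; rewrite h0 // mul0r.
  have := zsum_telescope N.+1 (fun j => h j * g (j - 1) x).
  rewrite (h0 N.+2%:Z) ?(h0 (- N.+1%:Z)) ?mul0r ?subr0; [|lia|lia].
  rewrite zsumB => /eqP; rewrite subr_eq0 => /eqP <-.
  by apply: eq_zsum => j _; rewrite addrK.
have wd (g : int -> R -> R) x : zsum N.+1 (fun j => h j * g j x) = zsum N (fun j => h j * g j x).
  by apply: zsum_widen => // j jN; rewrite h0 // mul0r.
have dl (g : int -> R -> R) x : zsum N.+1 (fun j => deltap h j * g j x) =
    zsum N (fun j => h j * g (j - 1) x) - zsum N (fun j => h j * g j x).
  by rewrite -sh -wd -zsumB; apply: eq_zsum => j _; rewrite /deltap mulrBl.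
clear sh wd h0; move: (N.+1) dl => M dl.
rewrite axpy1 /rotate /trig_sum /=; congr (_, _); apply/funext => x.
  rewrite (dl (fun j x => cos (j%:~R * x))) mulrBr; congr (_ - _).
  rewrite -!mulrA -mulrBr; congr (_ * _).
  rewrite ![zsum N _ * _]mulrC -!zsumZ -zsumB; apply: eq_zsum => j _.
  by rewrite rmorphB /= mulrBl cosB; ring.
rewrite (dl (fun j x => - sin (j%:~R * x))) mulrBr; congr (_ - _).
rewrite -!mulrA -mulrDr; congr (_ * _).
rewrite ![zsum N _ * _]mulrC -!zsumZ -zsumD; apply: eq_zsum => j _.
by rewrite rmorphB /= mulrBl sinB; ring.
Qed.

(** Parseval's identity would give S / (2 pi); a factor 2 is lost in separating the remainder of the
    Fourier series, which is then made arbitrarily small, from the trigonometric sum of f - h. *)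
Lemma ip_fourier_dist f h (Nh : nat) (M S : R) : ell2_bnd f M ->
  (forall j, (Nh < `|j|)%N -> h j = 0) -> ell2_bnd (fun j => f j - h j) S ->
  ip (axpy (parts (fourier_series f)) 1 (trig_sum h Nh))
     (axpy (parts (fourier_series f)) 1 (trig_sum h Nh)) <= pi^-1 * S.
Proof.
move=> hM h0 hS; have [iG hG] := fourier_seriesP hM.
set G := parts _ in iG hG *.
have pi0 : 0 < pi :> R := pi_gt0 R.
suff key (e : R) : 0 < e -> ip (axpy G 1 (trig_sum h Nh)) (axpy G 1 (trig_sum h Nh)) <= pi^-1 * S + e.
  by apply/ler_addgt0Pr => e; exact: key.
move=> e0.
have e2 : 0 < e / 2 by rewrite divr_gt0.
have [N0 hN] := hG _ e2.
pose N := maxn N0 Nh.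
have iT := inL2_trig_sum f N; have iTh := inL2_trig_sum h Nh.
have iD := inL2_trig_sum (fun j => f j - h j) N.
have iA1 := inL2_axpy 1 iG iT.
have := ip_par iA1 iD (inL2_axpy 1 iG iTh) => /(_ _)/wrap[].
  move=> x _; rewrite !axpy1 /=.
  have w (g : int -> R) : zsum Nh (fun j => h j * g j) = zsum N (fun j => h j * g j).
    symmetry; apply: zsum_widen; first exact: leq_maxr.
    by move=> j jN; rewrite h0 // mul0r.
  have d (g : int -> R) : zsum N (fun j => (f j - h j) * g j) =
      zsum N (fun j => f j * g j) - zsum N (fun j => h j * g j).
    by rewrite -zsumB; apply: eq_zsum => j _; rewrite mulrBl.
  by rewrite !w !d; split; ring.
move=> h1; apply: le_trans h1 _.
have hN' := hN N (leq_maxl _ _); rewrite ip_trig_sum_self.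
have hS' : (2 * pi)^-1 * zsum N (fun j => (f j - h j) ^+ 2) <= (2 * pi)^-1 * S.
  by rewrite ler_pM2l ?invr_gt0 ?mulr_gt0.
have e1 : pi^-1 * S = 2 * ((2 * pi)^-1 * S) by rewrite invfM !mulrA mulfV ?mul1r // pnatr_eq0.
by rewrite e1; move: hN' hS'; lra.
Qed.

(** For fixed s, the interpolation at s + n and the value h n are both coefficients along the n-th
    exponential: of the rotated series of f, and of [H]. The difference splits into [K1], the
    rotated series of f - h, and [K2], the effect of the rotation on [H]. Bessel's inequality for
    each gives 2 (2 pi) (S1 / pi) and 2 (2 pi) (S2 / (2 pi)). *)
Lemma interpolation_cell f h (Nh : nat) (M S1 S2 s : R) N : ell2_bnd f M ->
  (forall j, (Nh < `|j|)%N -> h j = 0) -> ell2_bnd (fun j => f j - h j) S1 ->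
  ell2_bnd (deltap h) S2 -> 0 <= s <= 1 ->
  zsum N (fun n => sqmod (interpolation f (s + n%:~R) - (h n)%:C)) <= 4 * S1 + 2 * S2.
Proof.
move=> hM h0 hS1 hS2 s01; have [iG _] := fourier_seriesP hM.
have dist := ip_fourier_dist hM h0 hS1.
set G := parts (fourier_series f) in iG dist *.
pose H := trig_sum h Nh.
have iH : inL2 H := inL2_trig_sum h Nh.
have pi0 : 0 < pi :> R := pi_gt0 R.
pose K1 := rotate s (axpy G 1 H); pose K2 := axpy (rotate s H) 1 H.
have iK1 : inL2 K1 by apply: inL2_rotate; exact: inL2_axpy.
have iK2 : inL2 K2 by apply: inL2_axpy => //; exact: inL2_rotate.
have hHe (n : int) : ip H (wave_e n%:~R) = h n.
  have := ip_trig_sum_basis h Nh (n, true); rewrite /basis /= => ->.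
  by case: leqP => // /h0.
have hHv (n : int) : ip H (wave_v n%:~R) = 0.
  by have := ip_trig_sum_basis h Nh (n, false); rewrite /basis /=.
have L (W : R -> cfun R) (n : int) : (forall y, inL2 (W y)) ->
   (forall K y, ip (rotate s K) (W y) = ip K (W (y + s))) ->
   ip G (W (s + n%:~R)) - ip H (W n%:~R) = ip K1 (W n%:~R) + ip K2 (W n%:~R).
  move=> iW rW; rewrite /K1 /K2 rW !ip_axpy //; do ?exact: inL2_rotate.
  by rewrite rW [n%:~R + s]addrC; ring.
have b1 := bessel_zsum N iK1; have b2 := bessel_zsum N iK2.
apply: (@le_trans _ _ (2 * (2 * pi * ip K1 K1) + 2 * (2 * pi * ip K2 K2))).
  apply: (@le_trans _ _ (2 * zsum N (fun n => ip K1 (wave_e n%:~R) ^+ 2 + ip K1 (wave_v n%:~R) ^+ 2) +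
     2 * zsum N (fun n => ip K2 (wave_e n%:~R) ^+ 2 + ip K2 (wave_v n%:~R) ^+ 2))); last by lra.
  rewrite -!zsumZ -zsumD; apply: ler_zsum => n _.
  rewrite interpolationE -/G /sqmod /= subr0 -(hHe n).
  have -> : ip G (wave_v (s + n%:~R)) = ip K1 (wave_v n%:~R) + ip K2 (wave_v n%:~R).
    by rewrite -L ?hHv ?subr0 //; [exact: inL2_v|move=> *; exact: ip_rotate_v].
  rewrite L; [|exact: inL2_e|move=> *; exact: ip_rotate_e].
  set a := ip K1 _; set b := ip K2 _; set c := ip K1 _; set d := ip K2 _.
  rewrite -subr_ge0 (_ : _ - _ = (a - b) ^+ 2 + (c - d) ^+ 2); last by ring.
  by rewrite addr_ge0 ?sqr_ge0.
have k1 : ip K1 K1 <= pi^-1 * S1.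
  apply: le_trans dist; apply: ip_le => //; first exact: inL2_axpy.
  by move=> x _; rewrite /K1 rotate_sqmod.
have k2 : ip K2 K2 <= (2 * pi)^-1 * S2.
  apply: le_trans (rotate_diff_le s01 iH) _.
  by rewrite rotate_trig_sum // ip_trig_sum_self ler_pM2l ?invr_gt0 ?mulr_gt0.
have e1 : 2 * (2 * pi * (pi^-1 * S1)) = 4 * S1.
  by rewrite -(mulrA 2 pi) mulVKf ?gt_eqF //; ring.
have e2 : 2 * (2 * pi * ((2 * pi)^-1 * S2)) = 2 * S2.
  by rewrite mulVKf // gt_eqF // mulr_gt0.
rewrite -e1 -e2; apply: lerD.
  by rewrite ler_pM2l // ler_pM2l ?mulr_gt0.
by rewrite ler_pM2l // ler_pM2l ?mulr_gt0.
Qed.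

Lemma ip_wave_continuous (W : R -> cfun R) (G : cfun R) : inL2 G ->
  (forall y, inL2 (W y)) -> (forall y x, `|(W y).1 x| <= 1 /\ `|(W y).2 x| <= 1) ->
  (forall x, continuous (fun y => (W y).1 x) /\ continuous (fun y => (W y).2 x)) ->
  continuous (fun y => ip G (W y)).
Proof.
move=> iG iW W1 cW y; have [[m1 _] [m2 _]] := iG.
apply: (@continuity_under_integral _ _ _ mu (fun y x => G.1 x * (W y).1 x + G.2 x * (W y).2 x)
  D mD (y - 1) (y + 1) _ _ (fun x => `|G.1 x| + `|G.2 x|)).
- by move=> z _; exact: ip_intg.
- apply: nearW => x _ z _; have [c1 c2] := cW x.
  by apply: cvgD; apply: cvgM; do ?[exact: cvg_cst|exact: c1|exact: c2].
- by apply: intgD => //; apply: integrable_norm => //; apply: sqi_intg; case: iG.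
- move=> z _; apply: nearW => x _; have [w1 w2] := W1 z x.
  apply: le_trans (ler_normD _ _) _; rewrite !normrM.
  by apply: lerD; apply: ler_piMr.
- by rewrite inE /= in_itv /=; apply/andP; split; lra.
Qed.

Lemma measurable_interpolation f M : ell2_bnd f M ->
  measurable_fun [set: R] (fun x => complex.Re (interpolation f x)) /\
  measurable_fun [set: R] (fun x => complex.Im (interpolation f x)).
Proof.
move=> hM; have [iG _] := fourier_seriesP hM.
have cc x : continuous (fun y : R => cos (y * x)).
  move=> y; apply: continuous_comp; last exact: continuous_cos.
  by apply: cvgM; [exact: cvg_id|exact: cvg_cst].
have cs x : continuous (fun y : R => sin (y * x)).
  move=> y; apply: continuous_comp; last exact: continuous_sin.
  by apply: cvgM; [exact: cvg_id|exact: cvg_cst].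
split.
  rewrite (_ : (fun x => _) = (fun y => ip (parts (fourier_series f)) (wave_e y))); last first.
    by apply/funext => x; rewrite interpolationE.
  apply: continuous_measurable_fun; apply: ip_wave_continuous => //.
  - exact: inL2_e.
  - by move=> y x; split; [exact: cos_norm_le1|rewrite normrN; exact: sin_norm_le1].
  - by move=> x; split; [exact: cc|move=> y; exact: (cvgN (cs x y))].
rewrite (_ : (fun x => _) = (fun y => ip (parts (fourier_series f)) (wave_v y))); last first.
  by apply/funext => x; rewrite interpolationE.
apply: continuous_measurable_fun; apply: ip_wave_continuous => //.
- exact: inL2_v.
- by move=> y x; split; [exact: sin_norm_le1|exact: cos_norm_le1].
- by move=> x; split; [exact: cs|exact: cc].
Qed.

Lemma measurable_step h (Nh : nat) : (forall j, (Nh < `|j|)%N -> h j = 0) ->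
  measurable_fun [set: R] (fun x : R => h (Num.floor x)).
Proof.
move=> h0.
rewrite (_ : (fun x => _) = (fun x => zsum Nh (fun j => h j * \1_(`[j%:~R, (j + 1)%:~R[%classic : set R) x))).
  elim: Nh {h0} => [|N IH] /=; first exact: measurable_funM.
  by do 2 (apply: measurable_funD; last exact: measurable_funM).
apply/funext => x.
transitivity (zsum Nh (fun j => if j == Num.floor x then h (Num.floor x) else 0)).
  by rewrite zsum_delta; case: leqP => // /h0.
apply: eq_zsum => j _; rewrite indicE mem_setE /= in_itv /= eq_sym floor_eq.
case: ifP => [jx|_]; rewrite ?mulr0 ?mulr1 //.
by congr h; apply: floor_def.
Qed.

(** Scaling brings the sites to the integers, where [folding_bound] meets the uniformity in s of
    [interpolation_cell]; for s in [0, 1) the floor of s + n is n. *)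
Lemma interpolation_estimate f h (Nh : nat) (M S1 S2 e : R) : 0 < e -> ell2_bnd f M ->
  (forall j, (Nh < `|j|)%N -> h j = 0) -> ell2_bnd (fun j => f j - h j) S1 ->
  ell2_bnd (deltap h) S2 ->
  (\int[mu]_x (sqmod (interpolation f (x / e) - (h (Num.floor (x / e)))%:C))%:E <=
   (e * (4 * S1 + 2 * S2))%:E)%E.
Proof.
move=> e0 hM h0 hS1 hS2.
pose g (x : R) := (sqmod (interpolation f x - (h (Num.floor x))%:C))%:E.
have g0 x : (0 <= g x)%E by rewrite lee_fin sqmod_ge0.
have [m1 m2] := measurable_interpolation hM.
have mg : measurable_fun [set: R] g.
  apply/measurable_EFinP; apply: measurable_funD; apply: measurable_funX.
    rewrite (_ : (fun x => _) = (fun x => complex.Re (interpolation f x) - h (Num.floor x))).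
      by apply: measurable_funB => //; exact: measurable_step h0.
    by apply/funext => x; case: (interpolation f x).
  rewrite (_ : (fun x => _) = (fun x => complex.Im (interpolation f x))) //.
  by apply/funext => x; case: (interpolation f x) => a b /=; rewrite subr0.
rewrite (ge0_integral_scale e0 mg g0) EFinM lee_pmul2l ?lte_fin //.
apply: folding_bound => // N s /andP[s0 s1].
have -> : zsum N (fun n : int => g (s + n%:~R)) =
   (zsum N (fun n => sqmod (interpolation f (s + n%:~R) - (h n)%:C)))%:E.
  have fl (n : int) : Num.floor (s + n%:~R) = n.
    by apply: floor_def; rewrite intrD /= lerDr s0 [_ + 1]addrC ltrD2r.
  have eg (n : int) : g (s + n%:~R) = (sqmod (interpolation f (s + n%:~R) - (h n)%:C))%:E.
    by rewrite /g fl.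
  by elim: N => [|N IH] /=; [exact: eg|rewrite IH !eg !EFinD].
by rewrite lee_fin; apply: interpolation_cell hM h0 hS1 hS2 _; rewrite s0 ltW.
Qed.

End InterpolationEstimate.

(** * Smooth functions, weak derivatives and sampling *)

Section SmoothStep.
Variable R : realType.
Implicit Types (f g : R -> R) (x : R).

Lemma is_derive_quadratic f (C : R) : f 0 = 0 -> (forall x, `|f x| <= C * x ^+ 2) ->
  is_derive (0 : R) (1 : R) f 0.
Proof.
move=> f0 hf.
have C0 : 0 <= C by have := hf 1; rewrite expr1n mulr1; apply: le_trans.
have cv : h^-1 *: ((f \o shift 0) (h *: (1 : R)) - f 0) @[h --> (0 : R)^'] --> (0 : R).
  apply/cvgrPdist_le => e e0; near=> h.
  have h0 : h != 0 by near: h; exact: nbhs_dnbhs_neq.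
  rewrite sub0r normrN /= f0 subr0 addr0 /GRing.scale /= mulr1 normrM normfV.
  rewrite ler_pdivrMl ?normr_gt0 //; apply: le_trans (hf h) _.
  rewrite -(real_normK (num_real h)) expr2 mulrCA ler_wpM2l //.
  apply: (@le_trans _ _ ((C + 1) * `|h|)); first by rewrite ler_wpM2r //; lra.
  rewrite mulrC -ler_pdivlMr; last by lra.
  near: h; apply: dnbhs0_le; rewrite divr_gt0 //; lra.
by split; [apply/cvg_ex; exists 0|exact: cvg_lim cv].
Unshelve. all: by end_near. Qed.

Lemma der_expr f n x (a : R) : is_derive x (1 : R) f a ->
  is_derive x (1 : R) (fun y => f y ^+ n) (n%:R * f x ^+ n.-1 * a).
Proof.
move=> h; elim: n => [|n IH]; first by rewrite !mul0r; exact: derC.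
rewrite (_ : (fun y => _) = (fun y => f y * f y ^+ n)); last first.
  by apply/funext => y; rewrite exprS.
apply: is_derive_eq (derM h IH) _; case: n {IH} => [|m] /=; first by ring.
by rewrite !exprS -[m.+2]addn1 natrD; ring.
Qed.

Lemma exprn_expRN_le (n : nat) x : 0 <= x -> x ^+ n.+1 * expR (- x) <= n.+1%:R ^+ n.+1.
Proof.
move=> x0; rewrite expRN ler_pdivrMr ?expR_gt0 //.
have n0 : (0 : R) < n.+1%:R by rewrite ltr0n.
have -> : expR x = expR (x / n.+1%:R) ^+ n.+1.
  by rewrite -expRM_natl; congr expR; rewrite mulrC divfK // gt_eqF.
rewrite -exprMn ler_pXn2r ?nnegrE ?mulr_ge0 ?expR_ge0 //.
rewrite -ler_pdivrMl // mulrC.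
by apply: le_trans (expR_ge1Dx _); rewrite lerDr.
Qed.

(** The functions x^-n exp(-1/x), extended by 0: the exponent is kept as a parameter because
    differentiation only raises it, so the family is stable up to linear combinations. *)
Definition flat (n : nat) x : R := if 0 < x then x^-1 ^+ n * expR (- x^-1) else 0.

Lemma flat_ge0 n x : 0 <= flat n x.
Proof.
by rewrite /flat; case: ifP => // x0; rewrite mulr_ge0 ?expR_ge0 // exprn_ge0 // invr_ge0 ltW.
Qed.

Lemma flat_gt0 n x : 0 < x -> 0 < flat n x.
Proof. by move=> x0; rewrite /flat x0 mulr_gt0 ?expR_gt0 // exprn_gt0 // invr_gt0. Qed.

Lemma flat_eq0 n x : x <= 0 -> flat n x = 0.
Proof. by rewrite /flat ltNge => ->. Qed.

Lemma flat_derive n x :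
  is_derive x (1 : R) (flat n) (flat n.+2 x - n%:R * flat n.+1 x).
Proof.
case: (ltrgt0P x) => x0.
- have xn0 : x != 0 by rewrite gt_eqF.
  have dV : is_derive x (1 : R) (fun y => y^-1) (- x ^- 2).
    by apply: is_derive_eq (is_deriveV xn0 (derI x)) _; rewrite /GRing.scale /= mulr1.
  have dX := der_expr n dV.
  have dE : is_derive x (1 : R) (fun y => expR (- y^-1)) (expR (- x^-1) * - (- x ^- 2)).
    exact: (der_comp (is_derive_expR _) (derN dV)).
  have dM := derM dX dE.
  have : is_derive x (1 : R) (flat n) (n%:R * x^-1 ^+ n.-1 * - x ^- 2 * expR (- x^-1) +
      x^-1 ^+ n * (expR (- x^-1) * - (- x ^- 2))).
    apply: near_eq_is_derive dM.
    by near=> y; rewrite /flat ifT //; near: y; exact: lt_nbhsr.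
  move=> h; apply: is_derive_eq h _; rewrite /flat x0 -exprVn.
  case: (n) => [|m]; first by rewrite /= !mul0r add0r expr0; ring.
  by move: (x^-1) (expR _) => y e; rewrite /= !exprS expr0; ring.
- have h : is_derive x (1 : R) (fun=> 0 : R) 0 by exact: derC.
  rewrite !flat_eq0 ?(ltW x0) // mulr0 subr0.
  apply: near_eq_is_derive h.
  by near=> y; rewrite flat_eq0 // ltW //; near: y; exact: lt_nbhsl.
- rewrite x0 !flat_eq0 // mulr0 subr0; apply: (@is_derive_quadratic _ (n.+2%:R ^+ n.+2)).
    by rewrite flat_eq0.
  move=> y; case: (leP y 0) => y0.
    by rewrite flat_eq0 // normr0; apply: mulr_ge0; [exact: exprn_ge0|exact: sqr_ge0].
  rewrite ger0_norm ?flat_ge0 // /flat y0.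
  (* Two more inverse powers are traded for y^2: differentiability at 0 then follows from a
     quadratic bound. *)
  have -> : y^-1 ^+ n = y^-1 ^+ n.+2 * y ^+ 2 by rewrite -addn2 exprD -mulrA -exprMn mulVf ?gt_eqF // expr1n mulr1.
  rewrite -mulrA [y ^+ 2 * _]mulrC mulrA ler_wpM2r ?sqr_ge0 //.
  by apply: exprn_expRN_le; rewrite invr_ge0 ltW.
Unshelve. all: by end_near. Qed.

Definition step_den x := flat 0 x + flat 0 (1 - x).

Lemma step_den_gt0 x : 0 < step_den x.
Proof.
rewrite /step_den; case: (ltP 0 x) => x0.
  by have := flat_gt0 0 x0; have := flat_ge0 0 (1 - x); lra.
by have := @flat_gt0 0 (1 - x) (ltac:(lra)); have := flat_ge0 0 x; lra.
Qed.

(* Closed under differentiation, hence made of functions differentiable to all orders. *)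
Inductive smooth_algebra : (R -> R) -> Prop :=
| smooth_flat n : smooth_algebra (flat n)
| smooth_inv : smooth_algebra (fun x => (step_den x)^-1)
| smooth_add f g : smooth_algebra f -> smooth_algebra g -> smooth_algebra (fun x => f x + g x)
| smooth_mul f g : smooth_algebra f -> smooth_algebra g -> smooth_algebra (fun x => f x * g x)
| smooth_affine f c k b : smooth_algebra f -> smooth_algebra (fun x => c * f (k * x + b)).

Lemma smooth_algebra_derive f : smooth_algebra f ->
  exists2 f', smooth_algebra f' & forall x, is_derive x (1 : R) f (f' x).
Proof.
have dflat n : exists2 f', smooth_algebra f' & forall x, is_derive x (1 : R) (flat n) (f' x).
  exists (fun x => flat n.+2 x + - n%:R * flat n.+1 (1 * x + 0)).
    by apply: smooth_add; [exact: smooth_flat|apply: smooth_affine; exact: smooth_flat].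
  by move=> x; have := flat_derive n x; rewrite mul1r addr0 mulNr.
elim=> {f} [n||f g _ [f' sf' df] _ [g' sg' dg]|f g sf [f' sf' df] sg [g' sg' dg]|f c k b _ [f' sf' df]].
- exact: dflat.
- have [f' sf' df] := dflat 0%N.
  have sd : smooth_algebra (fun x => f' x + -1 * f' (-1 * x + 1)).
    by apply: smooth_add => //; exact: smooth_affine.
  exists (fun x => -1 * ((step_den (1 * x + 0))^-1 * (step_den (1 * x + 0))^-1 *
     (f' (1 * x + 0) + -1 * f' (-1 * (1 * x + 0) + 1)))).
    apply: (@smooth_affine (fun x => (step_den x)^-1 * (step_den x)^-1 * (f' x + -1 * f' (-1 * x + 1)))).
    by apply: smooth_mul => //; apply: smooth_mul; exact: smooth_inv.
  move=> x; have nz : step_den x != 0 by rewrite gt_eqF // step_den_gt0.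
  have dd : is_derive x (1 : R) step_den (f' x + -1 * f' (-1 * x + 1)).
    have h := der_affine (df (-1 * x + 1)).
    rewrite (_ : step_den = (fun y => flat 0 y + flat 0 (-1 * y + 1))); last first.
      by apply/funext => y; rewrite /step_den mulN1r [- y + 1]addrC.
    by apply: is_derive_eq (derD (df x) h) _; rewrite mulrC.
  apply: is_derive_eq (is_deriveV nz dd) _; rewrite /GRing.scale /= !mul1r !addr0.
  by field.
- by exists (fun x => f' x + g' x); [exact: smooth_add|move=> x; exact: derD].
- exists (fun x => f' x * g x + f x * g' x); last by move=> x; exact: derM.
  by apply: smooth_add; exact: smooth_mul.
- exists (fun x => (c * k) * f' (k * x + b)); first exact: smooth_affine.
  move=> x; apply: is_derive_eq (derZ c (der_affine (df (k * x + b)))) _; ring.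
Qed.

Lemma smooth_algebra_derivable n f x : smooth_algebra f -> derivable (derive1n n f) x 1.
Proof.
elim: n f x => [|n IH] f x /smooth_algebra_derive[f' sf' df]; first by case: (df x).
rewrite derive1Sn (_ : derive1 f = f'); first exact: IH.
by apply/funext => y; exact: derE (df y).
Qed.

Definition smooth_step x := flat 0 x * (step_den x)^-1.

Lemma smooth_step_smooth : smooth_algebra smooth_step.
Proof. by apply: smooth_mul; [exact: smooth_flat|exact: smooth_inv]. Qed.

Lemma smooth_step_left x : x <= 0 -> smooth_step x = 0.
Proof. by move=> x0; rewrite /smooth_step flat_eq0 // mul0r. Qed.

Lemma smooth_step_right x : 1 <= x -> smooth_step x = 1.
Proof.
move=> x1; rewrite /smooth_step /step_den [flat 0 (1 - x)]flat_eq0 ?subr_le0 // addr0.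
by rewrite mulfV // gt_eqF // flat_gt0 //; lra.
Qed.

Lemma smooth_step_bnd x : 0 <= smooth_step x <= 1.
Proof.
have d0 := step_den_gt0 x; have f0 := flat_ge0 0 x; have f1 := flat_ge0 0 (1 - x).
rewrite /smooth_step divr_ge0 ?(ltW d0) //= ler_pdivrMr // mul1r /step_den.
by rewrite lerDl.
Qed.

End SmoothStep.

(** * Increments of a function with a weak derivative *)

Section WeakDerivative.
Variable R : realType.
Implicit Types (F G f g : R -> R) (a b c x y : R).
Local Notation mu := (@lebesgue_measure R).
Local Notation intg D f := (mu.-integrable D (EFin \o f)).

Lemma segment_bounded f a b : a <= b -> continuous f ->
  exists2 C : R, 0 <= C & forall x, a <= x <= b -> `|f x| <= C.
Proof.
move=> ab cf.
have cn : {within `[a, b], continuous (fun x => `|f x|)}.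
  by apply: continuous_subspaceT => x; apply: cvg_norm; exact: cf.
by have [c _ hc] := EVT_max ab cn; exists `|f c|.
Qed.

Lemma derive_out0 (f df : R -> R) (A : R) : (forall x, A < `|x| -> f x = 0) ->
  (forall x, is_derive x (1 : R) f (df x)) -> forall x, A < `|x| -> df x = 0.
Proof.
move=> f0 hf x Ax; rewrite -(derE (hf x)); apply: derE.
apply: near_eq_is_derive (derC 0 x).
near=> y; rewrite f0 //; near: y.
have : {for x, continuous (fun y : R => `|y|)} by exact: norm_continuous.
by move/cvgr_gt; apply.
Unshelve. all: by end_near. Qed.

Lemma integral_support (D : set R) (f : R -> \bar R) : (forall x, ~ D x -> f x = 0%E) ->
  (\int[mu]_x f x = \int[mu]_(x in D) f x)%E.
Proof.
move=> f0; rewrite [RHS]integral_mkcond; apply: eq_integral => x _.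
by rewrite patchE; case: ifPn => // /negP xD; apply: f0 => Dx; apply: xD; rewrite inE.
Qed.

Lemma integrable_support (D : set R) f : measurable D -> (forall x, ~ D x -> f x = 0) ->
  intg D f -> intg [set: R] f.
Proof.
move=> mD f0 h; have := (@integrable_mkcond _ _ R mu D (EFin \o f) mD).1 h.
apply: eq_integrable => // x _ /=.
by rewrite patchE; case: ifPn => // /negP xD; rewrite f0 // => Dx; apply: xD; rewrite inE.
Qed.

Lemma segment_measure a b : a < b -> mu `[a, b]%classic = (b - a)%:E.
Proof. by move=> ab; rewrite lebesgue_measure_itv /= lte_fin ab. Qed.

Lemma integral_cst_segment a b (r : R) : a < b ->
  (\int[mu]_(x in `[a, b]) r%:E = (r * (b - a))%:E)%E.
Proof.
move=> ab; apply: etrans (@integral_cst _ _ R mu _ (measurable_itv _) _) _.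
by rewrite EFinM; apply: congr1; exact: segment_measure.
Qed.

Lemma Rintegral_cst_segment a b (r : R) : a < b -> \int[mu]_(x in `[a, b]) r = r * (b - a).
Proof. by move=> ab; rewrite /Rintegral integral_cst_segment. Qed.

Lemma continuous_integrable f a b : continuous f -> intg `[a, b] f.
Proof.
move=> cf; apply: continuous_compact_integrable; first exact: segment_compact.
exact: continuous_subspaceT.
Qed.

Lemma smooth_step_derivative : exists (dstep : R -> R) (C : R),
  [/\ continuous dstep, forall x, is_derive x (1 : R) (@smooth_step R) (dstep x),
      forall x, ~~ (0 <= x <= 1) -> dstep x = 0 & forall x, `|dstep x| <= C].
Proof.
have [ds sds hds] := smooth_algebra_derive (@smooth_step_smooth R).
have cds : continuous ds.
  by have [d2 _ h2] := smooth_algebra_derive sds => x; exact: der_continuous (h2 x).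
have [C C0 hC] := segment_bounded (ler01 : 0 <= 1 :> R) cds.
have out x : ~~ (0 <= x <= 1) -> ds x = 0.
  rewrite negb_and -!ltNge => /orP[x0|x1]; rewrite -(derE (hds x)); apply: derE.
    apply: near_eq_is_derive (derC 0 x).
    by near=> y; rewrite smooth_step_left // ltW //; near: y; exact: lt_nbhsl.
  apply: near_eq_is_derive (derC 1 x).
  by near=> y; rewrite smooth_step_right // ltW //; near: y; exact: lt_nbhsr.
exists ds, C; split=> // x; case: (boolP (0 <= x <= 1)) => [/hC//|/out->].
by rewrite normr0.
Unshelve. all: by end_near. Qed.

(** The rescaled derivative of the smooth step has mass one on [c, c + eta], so [K] integrates to an
    average of F there. Its sign is not known; this is why the bound [C] of the derivative
    multiplies the oscillation [e]. *)
Lemma bump_average F (ds : R -> R) (C c eta e v : R) : 0 < eta -> continuous F ->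
  continuous ds -> (forall x, is_derive x (1 : R) (@smooth_step R) (ds x)) ->
  (forall x, ~~ (0 <= x <= 1) -> ds x = 0) -> (forall x, `|ds x| <= C) ->
  (forall x, c <= x <= c + eta -> `|F x - v| <= e) ->
  let K := fun x => F x * (eta^-1 * ds (eta^-1 * x + - (c / eta))) in
  intg [set: R] K /\ `|\int[mu]_x K x - v| <= C * e.
Proof.
move=> eta0 cF cds hds out hC hF K.
pose D : set R := `[c, c + eta]%classic; pose k x := eta^-1 * ds (eta^-1 * x + - (c / eta)).
have mD : measurable D by exact: measurable_itv.
have ck : continuous k.
  move=> x; apply: cvgM; first exact: cvg_cst.
  apply: (@continuous_comp _ _ _ (fun x => eta^-1 * x + - (c / eta)) ds); last exact: cds.
  apply: cvgD; last exact: cvg_cst.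
  by apply: cvgM; [exact: cvg_cst|exact: cvg_id].
have argE x : eta^-1 * x + - (c / eta) = (x - c) / eta by rewrite mulrC -mulrBl.
have k0 x : ~ D x -> k x = 0.
  move=> nx; rewrite /k out ?mulr0 // argE ler_pdivlMr // mul0r ler_pdivrMr // mul1r.
  by apply/negP => h; apply: nx; rewrite /D /= in_itv /=; lra.
have cK : continuous K by move=> x; apply: cvgM; [exact: cF|exact: ck].
have K0 x : ~ D x -> K x = 0 by move=> nx; rewrite /K -/(k x) k0 // mulr0.
have iK : intg D K by exact: continuous_integrable.
have ik : intg D k by exact: continuous_integrable.
split; first exact: integrable_support iK.
have I1 : \int[mu]_(x in D) k x = 1.
  rewrite /Rintegral (@continuous_FTC2 R k (fun x => smooth_step (eta^-1 * x + - (c / eta)))).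
  - rewrite !argE subrr mul0r [smooth_step 0]smooth_step_left // addrAC subrr add0r.
    by rewrite divff ?gt_eqF // smooth_step_right //= subr0.
  - by lra.
  - exact: continuous_subspaceT.
  - have dA x : is_derive x (1 : R) (fun x => smooth_step (eta^-1 * x + - (c / eta))) (k x).
      by apply: is_derive_eq (der_affine (hds _)) _; rewrite mulrC.
    split => [x _||]; first by case: (dA x).
      by apply: cvg_at_right_filter; exact: der_continuous (dA c).
    by apply: cvg_at_left_filter; exact: der_continuous (dA (c + eta)).
  - move=> x _; apply: derE; apply: is_derive_eq (der_affine (hds _)) _; by rewrite mulrC.
have -> : \int[mu]_x K x = \int[mu]_(x in D) K x.
  by rewrite /Rintegral (@integral_support D) // => x nx; rewrite K0.
have ikv : intg D (fun x => v * k x) by exact: intgZ.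
have -> : \int[mu]_(x in D) K x - v = \int[mu]_(x in D) (K x - v * k x).
  by rewrite RintgB // RintgZ // I1 mulr1.
have id : intg D (fun x => K x - v * k x) by exact: intgB.
apply: (le_trans (@le_normr_Rintegral _ _ R mu D _ mD id)).
have ic : intg D (fun=> (e * (eta^-1 * C))%R) by apply: continuous_integrable => x; exact: cvg_cst.
apply: (@le_trans _ _ (\int[mu]_(x in D) (e * (eta^-1 * C)))).
  apply: (@le_Rintegral _ _ R mu) => //; first exact: integrable_norm.
  move=> x; rewrite /D /= in_itv /= => xD.
  rewrite /K -/(k x) -mulrBl normrM; apply: ler_pM => //; first exact: hF.
  by rewrite /k normrM gtr0_norm ?invr_gt0 // ler_pM2l ?invr_gt0.
rewrite Rintegral_cst_segment; last by lra.
rewrite [c + _]addrC addrK.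
by rewrite le_eqVlt; apply/orP; left; apply/eqP; field; rewrite gt_eqF.
Qed.

(** Optimisation over s recovers the Cauchy-Schwarz inequality from a family of linear ones, with s
    = d / I or, when I = 0, with s = (L + 1) / d, which contradicts d > 0. *)
Lemma young_square (d I L : R) : 0 <= d -> 0 <= I -> 0 <= L ->
  (forall s : R, 0 < s -> 2 * d <= s * I + L / s) -> d ^+ 2 <= L * I.
Proof.
move=> d0 I0 L0 h; case: (ltrgt0P d) d0 => // [dp _|-> _]; last first.
  by rewrite expr0n mulr_ge0.
case: (ltrgt0P I) I0 => // [Ip _|I00 _]; last rewrite I00 in h *.

  have := h (d / I) (divr_gt0 dp Ip); rewrite divfK ?gt_eqF // invf_div.
  move=> h1; have : d * d <= (L * (I / d)) * d by rewrite ler_pM2r //; lra.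
  by rewrite expr2 => /le_trans; apply; rewrite -!mulrA mulVf ?gt_eqF // mulr1.
have Lp : 0 < L + 1 by lra.
have := h ((L + 1) / d) (divr_gt0 Lp dp); rewrite mulr0 add0r => h1.
have : L / ((L + 1) / d) <= d.
  rewrite invf_div mulrA ler_pdivrMr // mulrC ler_pM2l //; lra.
by move=> h2; exfalso; lra.
Qed.

Lemma young_inverse (s g : R) : 0 < s -> 2 * g <= s * g ^+ 2 + s^-1.
Proof.
move=> s0; have : 0 <= s^-1 * (s * g - 1) ^+ 2 by rewrite mulr_ge0 ?sqr_ge0 // invr_ge0 ltW.
rewrite (_ : s^-1 * _ = s * g ^+ 2 + s^-1 - 2 * g); first by lra.
by field; rewrite gt_eqF.
Qed.

Lemma continuous_near F (v e : R) : continuous F -> 0 < e ->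
  exists2 eta : R, 0 < eta & forall x, `|x - v| <= eta -> `|F x - F v| <= e.
Proof.
move=> cF e0; have /cvgrPdist_le/(_ e e0) := cF v.
rewrite nearE => /nbhs_normP[r /= r0 hr]; exists (r / 2); first by lra.
move=> x xv; rewrite distrC; apply: hr => /=; rewrite distrC; lra.
Qed.

(* The weak derivative is tested against smoothed indicators of [a, b]. *)
Lemma weak_derivative_young F G a b (I s : R) : continuous F -> weak_derivative 1 F G ->
  a < b -> (\int[mu]_(x in `[a, b]) (G x ^+ 2)%:E <= I%:E)%E -> 0 < s ->
  2 * `|F b - F a| <= s * I + (b - a) / s.
Proof.
move=> cF [lG wG] ab hI s0.
have [ds [C [cds hds out hC]]] := smooth_step_derivative.
have C0 : 0 <= C by apply: le_trans (hC 0).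
suff key (e : R) : 0 < e -> 2 * `|F b - F a| <= s * I + (b - a) / s + e.
  by apply/ler_addgt0Pr => e /key.
(* Each of the two averages is off by at most C e' <= e / 4, and the increment of F is counted twice
   in the goal. *)
move=> e0; pose e' := e / (4 * (C + 1)).
have e'0 : 0 < e' by rewrite divr_gt0 // mulr_gt0 //; lra.
have [r1 r10 h1] := continuous_near a cF e'0.
have [r2 r20 h2] := continuous_near b cF e'0.
pose eta := Num.min (Num.min r1 r2) ((b - a) / 3).
have eta0 : 0 < eta by rewrite !lt_min r10 r20 /=; lra.
have eta1 : eta <= r1 by rewrite !ge_min lexx.
have eta2 : eta <= r2 by rewrite !ge_min lexx orbT.
have eta3 : eta <= (b - a) / 3 by rewrite ge_min lexx orbT.
have [iA hA] := @bump_average F ds C a eta e' (F a) eta0 cF cds hds out hC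
  (ltac:(move=> x xa; apply: h1; rewrite ler_norml; lra)).
have [iB hB] := @bump_average F ds C (b - eta) eta e' (F b) eta0 cF cds hds out hC
  (ltac:(move=> x xa; apply: h2; rewrite ler_norml; lra)).
pose phi x := 1 * smooth_step (eta^-1 * x + - (a / eta)) +
  -1 * smooth_step (eta^-1 * x + - ((b - eta) / eta)).
have sphi : smooth_algebra phi.
  by apply: smooth_add; apply: (@smooth_affine R); exact: smooth_step_smooth.
have argE c x : eta^-1 * x + - (c / eta) = (x - c) / eta by rewrite mulrC -mulrBl.
have phi0 x : ~ (a <= x <= b) -> phi x = 0.
  move=> /negP; rewrite negb_and -!ltNge /phi !argE => /orP[xa|xb].
    by rewrite !smooth_step_left ?mulr0 ?addr0 // ler_pdivrMr // mul0r; lra.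
  by rewrite !smooth_step_right ?ler_pdivlMr // ?mul1r; lra.
have phi1 x : `|phi x| <= 1.
  rewrite /phi ler_norml.
  have := smooth_step_bnd (eta^-1 * x + - (a / eta)).
  have := smooth_step_bnd (eta^-1 * x + - ((b - eta) / eta)); lra.
have tphi : test_function phi.
  split; first by move=> n x; exact: smooth_algebra_derivable.
  exists (`|a| + `|b|) => x hx; apply: phi0 => xab.
  have : `|x| <= `|a| + `|b|.
    have := ler_norm b; have := lerNnormlW (lexx `|a|).
    by have := normr_ge0 a; have := normr_ge0 b; rewrite ler_norml; lra.
  by lra.
have dphi x : derive1n 1 phi x = eta^-1 * ds (eta^-1 * x + - (a / eta)) -
    eta^-1 * ds (eta^-1 * x + - ((b - eta) / eta)).
  rewrite derive1n1; apply: derE.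
  apply: is_derive_eq (derD (derZ 1 (der_affine (hds _))) (derZ (-1) (der_affine (hds _)))) _.
  by ring.
have := wG _ tphi; under eq_Rintegral do rewrite dphi mulrBr.
rewrite RintgB // expr1 mulN1r => E.
pose D : set R := `[a, b]%classic.
have mD : measurable D by exact: measurable_itv.
have [mG _ fG] := lG.
have mGD : measurable_fun D G by exact: measurable_funTS.
have iG : intg D G.
  apply/integrableP; split; first exact/measurable_EFinP.
  by apply: fG => //; exact: segment_compact.
have cphi : continuous phi.
  by have [d2 _ hd2] := smooth_algebra_derive sphi => x; exact: der_continuous (hd2 x).
have mphi : measurable_fun D phi by apply: measurable_funTS; exact: continuous_measurable_fun.
have iGp : intg D (fun x => G x * phi x).
  apply: (@le_integrable _ _ R mu D mD _ (EFin \o G) _ _ iG); first by apply/measurable_EFinP; exact: measurable_funM.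
  by move=> x _ /=; rewrite lee_fin normrM ler_piMr.
have EGp : \int[mu]_x (G x * phi x) = \int[mu]_(x in D) (G x * phi x).
  by rewrite /Rintegral (@integral_support D) // => x nx; rewrite phi0 ?mulr0.
have hG : 2 * `|\int[mu]_x (G x * phi x)| <= s * I + (b - a) / s.
  rewrite EGp; apply: (@le_trans _ _ (2 * \int[mu]_(x in D) `|G x * phi x|)).
    by rewrite ler_pM2l //; exact: (@le_normr_Rintegral _ _ R mu).
  have iN : intg D (fun x => `|G x * phi x|) by exact: integrable_norm.
  have mG2 : measurable_fun D (fun x => G x ^+ 2) by exact: measurable_funX.
  rewrite -RintgZ // -lee_fin -RintgE //; last exact: intgZ.
  apply: (@le_trans _ _ (\int[mu]_(x in D) (s%:E * (G x ^+ 2)%:E + (s^-1)%:E))%E).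
    apply: ge0_le_integral => //.
    - by apply/measurable_EFinP; apply: measurable_funM => //; apply: measurableT_comp => //;
        exact: measurable_funM.
    - apply: emeasurable_funD => //; apply/measurable_EFinP.
      by apply: measurable_funM.
    - move=> x _; rewrite -EFinM -EFinD lee_fin normrM.
      apply: (@le_trans _ _ (2 * `|G x|)); first by rewrite ler_pM2l // ler_piMr.
      rewrite -(real_normK (num_real (G x))); move: `|G x| => g.
      exact: young_inverse.
  rewrite ge0_integralD //; first last.
  - by move=> x _; rewrite lee_fin invr_ge0 ltW.
  - by apply/measurable_EFinP; exact: measurable_funM.
  - by move=> x _; rewrite -EFinM lee_fin mulr_ge0 ?sqr_ge0 ?(ltW s0).
  rewrite ge0_integralZl //; first last.
  - by rewrite lee_fin ltW.
  - by move=> x _; rewrite lee_fin sqr_ge0.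
  - exact/measurable_EFinP.
  rewrite EFinD EFinM leeD ?lee_wpmul2l ?lee_fin ?(ltW s0) //.
  by rewrite integral_cst_segment // lee_fin mulrC.
clear -C0 e0 e'0 E hA hB hG.
move: E hA hB hG.
move: (\int[mu]_x _) (\int[mu]_x _) (\int[mu]_x _) => u v w E hA hB hG.
have : C * e' <= e / 4.
  rewrite /e' mulrA ler_pdivrMr; last by lra.
  by have := mulr_ge0 C0 (ltW e0); nra.
move: hA hB; rewrite !ler_distl; move: hG; rewrite (_ : w = v - u); last by lra.
move=> hG hA hB hC'.
have : `|F b - F a| <= `|u| + e / 2.
  rewrite ler_norml; have := ler_norm u; have := lerNnormlW (lexx `|u|); lra.
by lra.
Qed.

Lemma weak_derivative_holder F G a b (I : R) : continuous F -> weak_derivative 1 F G ->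
  a < b -> (\int[mu]_(x in `[a, b]) (G x ^+ 2)%:E <= I%:E)%E ->
  (F b - F a) ^+ 2 <= (b - a) * I.
Proof.
move=> cF wG ab hI.
have I0 : 0 <= I.
  by rewrite -lee_fin; apply: le_trans hI; apply: integral_ge0 => x _; rewrite lee_fin sqr_ge0.
rewrite -(real_normK (num_real (F b - F a))); apply: young_square => //; first by lra.
by move=> s s0; exact: weak_derivative_young wG ab hI s0.
Qed.

End WeakDerivative.

(** * Summable moduli of continuity and sampling *)

Section QuadraticModulus.
Variable R : realType.
Implicit Types (F G f g : R -> R) (x y e V : R).
Local Notation mu := (@lebesgue_measure R).

Definition cell e (i : int) : set R := `[e * i%:~R, e * (i%:~R + 1)[%classic.

Lemma cellE e i x : 0 < e -> cell e i x <-> i = Num.floor (x / e).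
Proof.
move=> e0; rewrite /cell /= in_itv /= [e * _]mulrC [e * (_ + 1)]mulrC.
rewrite -ler_pdivlMr // -ltr_pdivrMr //; split.
  by move=> h; apply/eqP; rewrite eq_sym floor_eq; move: h; rewrite intrD.
by move=> ->; have := floor_itv (x / e); rewrite intrD.
Qed.

Lemma zsum_integral_cells e N (g : R -> \bar R) : 0 < e -> measurable_fun [set: R] g ->
  (forall x, 0 <= g x)%E ->
  (zsum N (fun i => \int[mu]_(x in cell e i) g x) <= \int[mu]_x g x)%E.
Proof.
move=> e0 mg g0.
have mp i : measurable_fun [set: R] (g \_ (cell e i)).
  by apply/(measurable_restrictT _ _).1 => //; [exact: measurable_itv|exact: measurable_funTS].
have p0 i x : (0 <= (g \_ (cell e i)) x)%E by rewrite patchE; case: ifP.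
have mz M : measurable_fun [set: R] (fun x => zsum M (fun i => (g \_ (cell e i)) x)).
  by elim: M => [|M IH] //=; do 2 (apply: emeasurable_funD => //).
have z0 M x : (0 <= zsum M (fun i => (g \_ (cell e i)) x))%E.
  by elim: M => [|M IH] //=; do 2 (apply: adde_ge0 => //).
have Ei i : (\int[mu]_(x in cell e i) g x = \int[mu]_x (g \_ (cell e i)) x)%E.
  exact: integral_mkcond.
have -> : zsum N (fun i => \int[mu]_(x in cell e i) g x)%E =
    (\int[mu]_x zsum N (fun i => (g \_ (cell e i)) x))%E.
  elim: N => [|N IH] /=; first exact: Ei.
  rewrite ge0_integralD //; last 3 first.
  - by move=> x _; apply: adde_ge0 => //; exact: z0.
  - exact: (emeasurable_funD (mz N) (mp N.+1%:Z)).
  - exact: mp.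
  rewrite ge0_integralD //; last 2 first.
  - exact: (mz N).
  - exact: mp.
  by rewrite -IH -!Ei.
apply: ge0_le_integral => //; first exact: (mz N).
move=> x _.
rewrite (@eq_zsum _ N _ (fun i => if i == Num.floor (x / e) then g x else 0%E)); last first.
  move=> i _; rewrite patchE; case: eqP => [->|ne]; first by rewrite mem_set //; exact/cellE.
  by rewrite memNset // => /(cellE _ _ e0).
by rewrite zsum_delta; case: ifP.
Qed.

Lemma int_norm_gt (n : nat) (i : int) : (n < `|i|)%N ->
  (n%:R + 1 <= i%:~R :> R) \/ (i%:~R + 1 <= - n%:R :> R).
Proof.
move=> ni; have [h|h] : (n%:Z + 1 <= i) \/ (i + 1 <= - n%:Z) by lia.
  by left; move: h; rewrite -(ler_int R) intrD -pmulrn.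
by right; move: h; rewrite -(ler_int R) intrD mulrNz -pmulrn.
Qed.

Lemma sqr_split_le (u v w : R) : (u - v) ^+ 2 <= w -> u ^+ 2 <= 2 * v ^+ 2 + 2 * w.
Proof. by have := sqr_ge0 (u - 2 * v); nra. Qed.

(* Square integrability of F' in a form that does not mention F': think of c i as the integral
   of F'^2 over the i-th cell of length e. *)
Definition quadratic_modulus F V := forall e, 0 < e <= 1 -> exists c : int -> R,
  [/\ forall i, 0 <= c i, forall N, zsum N c <= V &
   forall i x y, e * i%:~R <= x <= e * (i%:~R + 1) -> e * i%:~R <= y <= e * (i%:~R + 1) ->
     (F x - F y) ^+ 2 <= e * c i].

Lemma quadratic_modulus_ge0 F V : quadratic_modulus F V -> 0 <= V.
Proof.
move=> /(_ 1)[|c [c0 cV _]]; first by rewrite ltr01 lexx.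
exact: le_trans (c0 0) (cV 0%N).
Qed.

Lemma quadratic_modulus_lin F G (a b : R) V W : quadratic_modulus F V -> quadratic_modulus G W ->
  quadratic_modulus (fun x => a * F x + b * G x) (2 * a ^+ 2 * V + 2 * b ^+ 2 * W).
Proof.
move=> hF hG e e01; have [c [c0 cV hc]] := hF e e01; have [d [d0 dW hd]] := hG e e01.
have a2 := sqr_ge0 a; have b2 := sqr_ge0 b.
exists (fun i => 2 * a ^+ 2 * c i + 2 * b ^+ 2 * d i); split.
- by move=> i; have := mulr_ge0 a2 (c0 i); have := mulr_ge0 b2 (d0 i); lra.
- move=> N; rewrite zsumD !zsumZ.
  by have := ler_wpM2l a2 (cV N); have := ler_wpM2l b2 (dW N); lra.
move=> i x y hx hy; have h1 := ler_wpM2l a2 (hc i x y hx hy).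
have h2 := ler_wpM2l b2 (hd i x y hx hy).
have := sqr_ge0 (a * (F x - F y) - b * (G x - G y)); nra.
Qed.

Lemma quadratic_modulus_weak F G V : continuous F -> weak_derivative 1 F G ->
  (\int[mu]_x (G x ^+ 2)%:E <= V%:E)%E -> quadratic_modulus F V.
Proof.
move=> cF wG hV e /andP[e0 _].
have [[mG _ _] _] := wG.
have mG2 : measurable_fun [set: R] (fun x => (G x ^+ 2)%:E).
  by apply/measurable_EFinP; exact: measurable_funX.
have G0 x : (0 <= (G x ^+ 2)%:E)%E by rewrite lee_fin sqr_ge0.
pose I i := (\int[mu]_(x in cell e i) (G x ^+ 2)%:E)%E.
have I0 i : (0 <= I i)%E by exact: integral_ge0.
have zI N : (zsum N I <= V%:E)%E by exact: le_trans (zsum_integral_cells N e0 mG2 G0) hV.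
have IV i : (I i <= V%:E)%E.
  apply: le_trans hV; apply: ge0_subset_integral => //; exact: measurable_itv.
have IE i : I i = (fine (I i))%:E.
  by rewrite fineK // ge0_fin_numE //; apply: le_lt_trans (IV i) (ltry _).
exists (fun i => fine (I i)); split.
- by move=> i; exact: fine_ge0.
- move=> N; rewrite -lee_fin; apply: le_trans (zI N).
  by elim: N => [|N IH] /=; rewrite ?EFinD -!IE // leeD2r // leeD2r.
move=> i x y.
wlog xy : x y / x <= y.
  move=> h hx hy; case: (leP x y) => xy; first exact: h.
  by rewrite -sqrrN opprB; apply: h => //; exact: ltW.
move=> hx hy; move: xy; rewrite le_eqVlt => /predU1P[->|xy].
  by rewrite subrr expr0n /= mulr_ge0 ?fine_ge0 // ltW.
rewrite -sqrrN opprB; apply: (@le_trans _ _ ((y - x) * fine (I i))).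
  apply: (weak_derivative_holder cF wG) => //; rewrite -IE.
  have mc : measurable_fun (cell e i) (fun x => (G x ^+ 2)%:E) by exact: measurable_funTS.
  rewrite /I /cell integral_itv_bndo_bndc //.
  apply: ge0_subset_integral => //.
    exact: measurable_funTS.
  move=> z /=; rewrite !in_itv /=; clear - hx hy; lra.
rewrite ler_wpM2r ?fine_ge0 //; clear -hx hy; lra.
Qed.

(** About 2 A / e cells meet the support, each with constant e L^2, so the total does not depend on
    e; the 5 absorbs the cells at the ends, as e <= 1. *)
Lemma quadratic_modulus_lipschitz f (A L : R) : 0 <= A -> (forall x, A < `|x| -> f x = 0) ->
  (forall x y, `|f x - f y| <= L * `|x - y|) -> quadratic_modulus f (L ^+ 2 * (2 * A + 5)).
Proof.
move=> A0 f0 fL e /andP[e0 e1].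
pose n := (Num.truncn (A / e)).+1.
exists (fun i => if (`|i| <= n)%N then e * L ^+ 2 else 0); split.
- by move=> i; case: ifP => // _; rewrite mulr_ge0 ?sqr_ge0 // ltW.
- move=> N; apply: (@le_trans _ _ (zsum n (fun i => if (`|i| <= n)%N then e * L ^+ 2 else 0))).
    apply: (@le_trans _ _ (zsum (maxn N n) (fun i => if (`|i| <= n)%N then e * L ^+ 2 else 0))).
      apply: zsum_mono (leq_maxl _ _) => i.
      by case: ifP => // _; rewrite mulr_ge0 ?sqr_ge0 // ltW.
    by rewrite (@zsum_widen _ n) ?leq_maxr // => i; rewrite ltnNge => /negbTE->.
  rewrite (@eq_zsum _ n _ (fun=> e * L ^+ 2)) => [|i ->//].
  rewrite zsum_cst mulrA mulrC ler_wpM2l ?sqr_ge0 //.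
  have h : n%:R <= A / e + 1.
    by rewrite /n -addn1 natrD lerD2r; rewrite truncn_le // divr_ge0 // ltW.
  have h2 : n.*2.+1%:R = 2 * n%:R + 1 :> R by rewrite -addn1 natrD -muln2 natrM mulrC.
  have h3 : n%:R * e <= A + e.
    apply: (@le_trans _ _ ((A / e + 1) * e)); first by rewrite ler_pM2r.
    by rewrite mulrDl mul1r divfK ?gt_eqF.
  by rewrite h2 mulrDl mul1r -mulrA; lra.
move=> i x y hx hy; case: ifPn => [_|].
  rewrite -(real_normK (num_real (f x - f y))) mulrA -expr2 -exprMn.
  have L0 : 0 <= L.
    have := fL 1 0; rewrite subr0 normr1 mulr1; exact: le_trans.
  rewrite ler_pXn2r ?nnegrE ?mulr_ge0 ?(ltW e0) //.
  apply: le_trans (fL x y) _; rewrite mulrC ler_wpM2r //.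
  rewrite ler_norml; lra.
rewrite -ltnNge => ni; rewrite mulr0.
suff out z : e * i%:~R <= z <= e * (i%:~R + 1) -> f z = 0 by rewrite !out // subrr expr0n.
move=> hz; case: (leP `|z| A) => [zA|/f0//]; exfalso.
have h1 : (A / e) < n%:R by rewrite /n; apply: truncnS_gt.
have h2 : A < e * n%:R by rewrite mulrC -ltr_pdivrMr.
move: zA; rewrite ler_norml => zA.
have [h3|h3] := int_norm_gt ni.
  have := ler_wpM2l (ltW e0) h3; rewrite mulrDr mulr1; lra.
have := ler_wpM2l (ltW e0) h3; rewrite mulrN; lra.
Qed.

(** A small L^2 norm says nothing about the values at the sites. Each sample is compared with every
    point e (s + j) of its cell, at the cost e c_j, and the inequality is integrated over s in [0,
    1). The costs sum up to a term of order e^2, which disappears in the limit. *)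
Lemma sampling_bound h V S e N : measurable_fun [set: R] h -> quadratic_modulus h V ->
  (\int[mu]_x (h x ^+ 2)%:E <= S%:E)%E -> 0 < e <= 1 ->
  e * zsum N (fun j => h (e * j%:~R) ^+ 2) <= 2 * S + 2 * e ^+ 2 * V.
Proof.
move=> mh qh hS e01; have /andP[e0 e1] := e01; have [c [c0 cV hc]] := qh e e01.
pose g (y : R) := (2 * h (e * y) ^+ 2)%:E.
have mg : measurable_fun [set: R] g.
  apply/measurable_EFinP; apply: measurable_funM => //; apply: measurable_funX.
  by apply: measurableT_comp => //; exact: measurable_funM.
have g0 y : (0 <= g y)%E by rewrite lee_fin mulr_ge0 ?sqr_ge0.
have mh2 : measurable_fun [set: R] (fun x => (h x ^+ 2)%:E).
  by apply/measurable_EFinP; exact: measurable_funX.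
have hg : (e%:E * \int[mu]_x g x <= (2 * S)%:E)%E.
  rewrite -ge0_integral_scale // EFinM.
  rewrite (_ : (fun x => g (x / e)) = (fun x => 2%:E * (h x ^+ 2)%:E)%E); last first.
    by apply/funext => x; rewrite /g [e * _]mulrC divfK ?gt_eqF // EFinM.
  rewrite ge0_integralZl //; last by move=> x _; rewrite lee_fin sqr_ge0.
  by rewrite lee_wpmul2l // lee_fin.
set z := zsum N _.
(* The constant integrated over [0, 1) below has to be nonnegative; otherwise the claim is
   immediate. *)
case: (leP z (2 * e * V)) => [hz|hz].
  have S0 : 0 <= S.
    rewrite -lee_fin; apply: le_trans hS; apply: integral_ge0 => x _; by rewrite lee_fin sqr_ge0.
  clear -hz S0 e0; apply: (@le_trans _ _ (e * (2 * e * V))); first by rewrite ler_pM2l.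
  by rewrite expr2; lra.
have : ((z - 2 * e * V)%:E <= \int[mu]_x g x)%E.
  apply: (@le_trans _ _ (\int[mu]_(s in `[0%R, 1%R[) (z - 2 * e * V)%:E)%E).
    rewrite integral_cst // (_ : _ `[0%R, 1%R[%classic = 1%E) ?mule1 //.
    by apply: etrans (lebesgue_measure_itv _) _; rewrite /= lte_fin ltr01 oppr0 adde0.
  apply: (@le_trans _ _ (\int[mu]_(x in `[(- N%:R)%R, (N.+1%:R)%R[) g x)%E); last first.
    by apply: ge0_subset_integral => //; exact: measurable_itv.
  rewrite integral_unit_cells //; apply: ge0_le_integral => //.
  - by move=> s _; rewrite lee_fin subr_ge0 ltW.
  - apply: measurable_funTS.
    have mgn (n : int) : measurable_fun [set: R] (fun s => g (s + n%:~R)).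
      by apply: measurableT_comp => //; exact: measurable_funD.
    have mz : measurable_fun [set: R] (fun s => zsum N (fun n : int => g (s + n%:~R)%R)).
      by elim: N {z hz} => [|M IH] /=; [exact: mgn|do 2 (apply: emeasurable_funD => //)].
    exact: mz.
  - move=> s /=; rewrite in_itv /= => s01.
    have -> : zsum N (fun n : int => g (s + n%:~R)) =
        (zsum N (fun n : int => 2 * h (e * (s + n%:~R)) ^+ 2))%:E.
      by elim: N {z hz} => [|M IH] //=; rewrite IH.
    rewrite lee_fin; clear - s01 e0 e1 cV hc c0.
    have le1 : zsum N (fun j => h (e * j%:~R) ^+ 2) <=
        zsum N (fun n : int => 2 * h (e * (s + n%:~R)) ^+ 2 + 2 * e * c n).
      apply: ler_zsum => j _.
      have n1 : e * (s + j%:~R) <= e * (j%:~R + 1) by rewrite ler_pM2l //; lra.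
      have n2 : e * j%:~R <= e * (s + j%:~R) by rewrite ler_pM2l //; lra.
      have n3 : e * j%:~R <= e * (j%:~R + 1) by rewrite ler_pM2l //; lra.
      have h1 := hc j (e * j%:~R) (e * (s + j%:~R)) (ltac:(lra)) (ltac:(lra)).
      rewrite -[2 * e * _]mulrA.
      exact: sqr_split_le h1.
    rewrite zsumD [zsum N (fun n => 2 * e * c n)]zsumZ in le1.
    have : 2 * e * zsum N c <= 2 * e * V by rewrite ler_wpM2l // mulr_ge0 // ltW.
    by rewrite /z; lra.
move=> /(lee_wpmul2l (_ : (0 <= e%:E)%E)) => /(_ (ltW e0)) /le_trans => /(_ _ hg).
by rewrite -EFinM lee_fin expr2; clear; lra.
Qed.

End QuadraticModulus.

(** * Approximation by smooth compactly supported functions *)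

Section Approximation.
Variable R : realType.
Implicit Types (F f : R -> R) (x y e V : R).
Local Notation mu := (@lebesgue_measure R).

Definition hat y : R := smooth_step (y + 1) - smooth_step y.

Lemma hat_split (t : R) (i : int) : 0 <= t < 1 ->
  hat (t - i%:~R) = if i == 0 then 1 - smooth_step t else if i == 1 then smooth_step t else 0.
Proof.
move=> t01; rewrite /hat; case: eqP => [->|i0].
  by rewrite subr0 [smooth_step (t + 1)]smooth_step_right //; lra.
case: eqP => [->|i1].
  by rewrite subrK [smooth_step (t - 1)]smooth_step_left ?subr0 //; lra.
have [h|h] : (i + 1 <= 0) \/ (2 <= i) by clear t t01; lia.
  have {}h : i%:~R + 1 <= 0 :> R by move: h; rewrite -(ler_int R) intrD.
  by rewrite !smooth_step_right ?subrr //; lra.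
have {}h : 2 <= i%:~R :> R by move: h; rewrite -(ler_int R).
by rewrite !smooth_step_left ?subrr //; lra.
Qed.

Definition spline F e (N : nat) x := zsum N (fun i => F (e * i%:~R) * hat (x / e - i%:~R)).

(* The translated hats form a partition of unity, so that a spline takes values between two
   consecutive samples. *)
Lemma splineE F e N x : 0 < e -> let k := Num.floor (x / e) in let t := x / e - k%:~R in
  spline F e N x =
    (if (`|k| <= N)%N then F (e * k%:~R) else 0) * (1 - smooth_step t) +
    (if (`|(k + 1)%R| <= N)%N then F (e * (k%:~R + 1)) else 0) * smooth_step t.
Proof.
move=> e0 k t.
have t01 : 0 <= t < 1.
  by have := floor_itv (x / e); rewrite -/k intrD /t => h; rewrite subr_ge0 ltrBlDl.
rewrite /spline (@eq_zsum _ N _ (fun i =>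
  (if i == k then F (e * k%:~R) * (1 - smooth_step t) else 0) +
  (if i == k + 1 then F (e * (k%:~R + 1)) * smooth_step t else 0))); last first.
  move=> i _.
  have -> : x / e - i%:~R = t - (i - k)%:~R by rewrite /t intrB opprB addrA subrK.
  rewrite hat_split // subr_eq0 subr_eq [1 + k]addrC.
  case: eqP => [->|_]; first by rewrite [k == k + 1]eq_sym -subr_eq0 addrAC subrr addr0.
  by rewrite add0r; case: eqP => [->|_]; rewrite ?mulr0 // intrD.
by rewrite zsumD !zsum_delta; do 2 case: ifP; rewrite ?mul0r.
Qed.

Lemma spline_smooth F e N : smooth_algebra (spline F e N).
Proof.
have sh (c b : R) : smooth_algebra (fun x => c * hat (x / e - b)).
  rewrite (_ : (fun x => _) = (fun x => c * smooth_step (e^-1 * x + (1 - b)) +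
     - c * smooth_step (e^-1 * x + - b))).
    by apply: smooth_add; apply: smooth_affine; exact: smooth_step_smooth.
  apply/funext => x; rewrite /hat mulrBr mulNr [x / e]mulrC.
  by rewrite [e^-1 * x - b + 1]addrAC [e^-1 * x + 1 - b]addrAC -addrA [- b + 1]addrC.
rewrite /spline; elim: N => [|N IH] /=; first exact: sh.
by apply: smooth_add => //; apply: smooth_add.
Qed.

Lemma spline_support F e N x : 0 < e -> e * (N%:R + 1) < `|x| -> spline F e N x = 0.
Proof.
move=> e0 hx; rewrite splineE //.
set k := Num.floor _.
have /andP[k1 k2] := floor_itv (x / e); rewrite -/k in k1 k2.
have E : x = e * (x / e) by rewrite mulrC divfK ?gt_eqF.
have hx' : N%:R + 1 < `|x / e|.
  by rewrite normrM normfV (gtr0_norm e0) ltr_pdivlMr // mulrC.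
have hN : (N < `|k|)%N.
  have : N%:R < `|k%:~R| :> R.
    move: hx' k2; rewrite intrD; move: (x / e) k1 => y k1 hy k2.
    case: (leP 0 y) hy => y0.
      rewrite ger0_norm // => hy; have := ler_norm (k%:~R : R); lra.
    rewrite ltr0_norm // => hy; have := lerNnormlW (lexx `|k%:~R : R|); lra.
  by rewrite -intr_norm -[`|k|%R]abszE -pmulrn ltr_nat.
rewrite leqNgt hN /= mul0r add0r; case: ifP => hk; last by rewrite mul0r.
have kN : k = - N.+1%:Z by clear - hN hk; lia.
exfalso; move: hx' k1 k2; rewrite kN intrD !mulrNz -!pmulrn -addn1 natrD.
move: (x / e) => y hy k1 k2; have y0 : y <= 0 by have := ler0n R N; lra.
by move: hy; rewrite ler0_norm //; lra.
Qed.

(** If all tails exceeded d, the integrals over the intervals [I n] would stay below the total minus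
    d, against monotone convergence. *)
Lemma tail_integral F (S d : R) : measurable_fun [set: R] F ->
  (\int[mu]_x (F x ^+ 2)%:E <= S%:E)%E -> 0 < d ->
  exists2 A : R, 0 < A & (\int[mu]_x ((if A <= `|x| then F x ^+ 2 else 0)%R)%:E <= d%:E)%E.
Proof.
move=> mF hS d0; apply: contrapT => hno.
pose I (n : nat) : set R := `[- n.+1%:R, n.+1%:R]%classic.
pose g x := (F x ^+ 2)%:E.
have mg : measurable_fun [set: R] g by apply/measurable_EFinP; exact: measurable_funX.
have g0 x : (0 <= g x)%E by rewrite lee_fin sqr_ge0.
have mI i : measurable (I i) by exact: measurable_itv.
have UI : \bigcup_N I N = setT.
  apply/seteqP; split => // x _.
  exists (Num.truncn `|x|) => //=; rewrite /I /= in_itv /=.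
  by rewrite -ler_norml ltW // truncnS_gt.
have ndI : nondecreasing_seq I.
  move=> m n mn; apply/subsetPset => x; rewrite /I /= !in_itv /= => /andP[h1 h2].
  have e2 : (m.+1%:R : R) <= n.+1%:R by rewrite ler_nat.
  by apply/andP; split; lra.
have cv : (\int[mu]_(x in I i) g x)%E @[i --> \oo] --> (\int[mu]_x g x)%E.
  rewrite -UI; apply: ge0_nondecreasing_set_cvg_integral => //.
  by move=> i; exact: measurable_funTS.
pose v := fine (\int[mu]_x g x)%E.
have vE : (\int[mu]_x g x)%E = v%:E.
  rewrite fineK // ge0_fin_numE; last exact: integral_ge0.
  by apply: le_lt_trans hS (ltry _).
have : (v%:E <= (v - d)%:E)%E.
  rewrite -vE -(cvg_lim _ cv) //; apply: lime_le; first by apply/cvg_ex; eexists; exact: cv.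
  apply: nearW => n.
  (* The tail starts at n + 2, one unit beyond the interval [I n], so that the two sets are
     disjoint. *)
  pose h x : \bar R := ((if n.+2%:R <= `|x| then F x ^+ 2 else 0)%R)%:E.
  have hd : (d%:E < \int[mu]_x h x)%E.
    by rewrite ltNge; apply/negP => hle; apply: hno; exists n.+2%:R => //; rewrite ltr0n.
  have mh : measurable_fun [set: R] h.
    apply/measurable_EFinP.
    apply: measurable_fun_ifT => //; last exact: measurable_funX.
    by apply: measurable_fun_ler => //; exact: measurableT_comp.
  have h0 x : (0 <= h x)%E by rewrite /h lee_fin; case: ifP => // _; exact: sqr_ge0.
  have mr : measurable_fun [set: R] (g \_ (I n)).
    by apply/(measurable_restrictT _ _).1 => //; exact: measurable_funTS.
  have r0 x : (0 <= (g \_ (I n)) x)%E by rewrite patchE; case: ifP.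
  have hle : (\int[mu]_(x in I n) g x + \int[mu]_x h x <= v%:E)%E.
    rewrite (_ : \int[mu]_(x in I n) g x = \int[mu]_x (g \_ (I n)) x)%E; last exact: integral_mkcond.
    rewrite -ge0_integralD // -vE; apply: ge0_le_integral => //.
    - by move=> x _; apply: adde_ge0.
    - exact: (emeasurable_funD mr mh).
    - move=> x _; rewrite patchE /h /g; case: ifPn => [xI|_]; last first.
        by rewrite add0e lee_fin; case: ifP => // _; exact: sqr_ge0.
      rewrite ifF ?adde0 //; apply/negbTE; rewrite -ltNge.
      move: xI; rewrite inE /I /= in_itv /= -ler_norml => /le_lt_trans; apply.
      by rewrite ltr_nat.
  by have := le_trans (leeD2l _ (ltW hd)) hle; rewrite -leeBrDr.
by rewrite lee_fin; clear -d0; lra.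
Qed.

Lemma convex_square_le (t u a b w z : R) : 0 <= t -> t <= 1 -> 0 <= w + z ->
  (u - a) ^+ 2 <= w + z -> (u - b) ^+ 2 <= w + z ->
  (u - (a * (1 - t) + b * t)) ^+ 2 <= w + z.
Proof.
move=> t0 t1 wz ha hb.
have h1 : (1 - t) * (u - a) ^+ 2 <= (1 - t) * (w + z) by rewrite ler_wpM2l // subr_ge0.
have h2 : t * (u - b) ^+ 2 <= t * (w + z) by rewrite ler_wpM2l.
have h3 : 0 <= t * (1 - t) * (a - b) ^+ 2 by rewrite mulr_ge0 ?sqr_ge0 // mulr_ge0 // subr_ge0.
have -> : (u - (a * (1 - t) + b * t)) ^+ 2 =
  (1 - t) * (u - a) ^+ 2 + t * (u - b) ^+ 2 - t * (1 - t) * (a - b) ^+ 2 by ring.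
lra.
Qed.

(** On the cells it covers, a spline of mesh e stays within e c_k of F, in square, since its values
    are convex combinations of two samples; elsewhere the missing samples are paid for by the tail
    of F. *)
Lemma smooth_approximation F V (S d : R) : continuous F -> quadratic_modulus F V ->
  (\int[mu]_x (F x ^+ 2)%:E <= S%:E)%E -> 0 < d ->
  exists f (A : R), [/\ smooth_algebra f, 0 < A, forall x, A < `|x| -> f x = 0 &
    (\int[mu]_x ((F x - f x) ^+ 2)%:E <= d%:E)%E].
Proof.
move=> cF qF hS d0.
have mF : measurable_fun [set: R] F by exact: continuous_measurable_fun.
have V0 := quadratic_modulus_ge0 qF.
have d4 : 0 < d / 4 by rewrite divr_gt0.
have [A A0 hA] := tail_integral mF hS d4.
(* This makes 4 e^2 V at most d / 2, half of the budget; the other half is twice the tail, bounded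
   by d / 4. *)
pose e := Num.min 1 (d / (8 * (V + 1 + d))).
have V1 : 0 < V + 1 + d by lra.
have e0 : 0 < e by rewrite lt_min ltr01 /= divr_gt0 // mulr_gt0.
have e1 : e <= 1 by rewrite ge_min lexx.
have eV : e ^+ 2 * (4 * V) <= d / 2.
  have h1 : e * (8 * (V + 1 + d)) <= d.
    by rewrite -ler_pdivlMr ?mulr_gt0 // ge_min lexx orbT.
  have h2 : e ^+ 2 * V <= e * V by rewrite ler_wpM2r // expr2 ler_piMr // ltW.
  have h3 : 0 <= e * (1 + d) by rewrite mulr_ge0 ?ltW //; lra.
  by clear - h1 h2 h3; lra.
have [c [c0 cV hc]] := qF e (ltac:(by rewrite e0 e1)).
pose N := (Num.truncn (A / e)).+1.
have NA : A < e * N%:R.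
  by rewrite mulrC -ltr_pdivrMr // /N; apply: truncnS_gt.
pose f := spline F e N.
have sf : smooth_algebra f by exact: spline_smooth.
exists f, (e * (N%:R + 1)); split => //.
- by rewrite mulr_gt0 //; have := ler0n R N; lra.
- by move=> x; exact: spline_support.
have mf : measurable_fun [set: R] f.
  apply: continuous_measurable_fun.
  by have [df _ hdf] := smooth_algebra_derive sf => x; exact: der_continuous (hdf x).
pose T x : R := if A <= `|x| then F x ^+ 2 else 0.
(* Only the excess over the tail term is folded onto the cells: the sums of [T] over translated
   sites are not controlled, its integral is. *)
pose g x : R := Num.max 0 ((F x - f x) ^+ 2 - 2 * T x).
have mT : measurable_fun [set: R] T.
  apply: measurable_fun_ifT => //; last exact: measurable_funX.
  by apply: measurable_fun_ler => //; exact: measurableT_comp.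
have mg : measurable_fun [set: R] g.
  apply: measurable_maxr => //; apply: measurable_funB; last exact: measurable_funM.
  by apply: measurable_funX; exact: measurable_funB.
have g0 x : 0 <= g x by rewrite le_max lexx.
have T0 x : 0 <= T x by rewrite /T; case: ifP => // _; exact: sqr_ge0.
have hg : (\int[mu]_x (g x)%:E <= (d / 2)%:E)%E.
  pose G y : \bar R := (g (e * y))%:E.
  have mG : measurable_fun [set: R] G.
    have me : measurable_fun [set: R] (fun y : R => e * y) by exact: measurable_funM.
    by apply/measurable_EFinP; exact: (measurableT_comp mg me).
  have G0 y : (0 <= G y)%E by rewrite lee_fin.
  have -> : (\int[mu]_x (g x)%:E = e%:E * \int[mu]_x G x)%E.
    rewrite -ge0_integral_scale //; apply: eq_integral => x _.
    by rewrite /G mulrC divfK ?gt_eqF.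
  apply: (@le_trans _ _ (e%:E * (4 * e * V)%:E)%E); last first.
    by rewrite -EFinM lee_fin; clear -eV; lra.
  rewrite lee_wpmul2l ?lee_fin ?(ltW e0) //.
  apply: folding_bound => // M s s01.
  have -> : zsum M (fun n : int => G (s + n%:~R)) = (zsum M (fun n : int => g (e * (s + n%:~R))))%:E.
    by elim: M => [|M IH] //=; rewrite IH.
  rewrite lee_fin; apply: (@le_trans _ _ (zsum M (fun n => 4 * e * c n))); last first.
    by rewrite zsumZ ler_wpM2l // mulr_ge0 // ltW.
  apply: ler_zsum => k _; rewrite /g ge_max; apply/andP; split.
    by rewrite mulr_ge0 // mulr_ge0 // ltW.
  set x := e * (s + k%:~R).
  have xe : x / e = s + k%:~R by rewrite /x mulrAC divff ?mul1r // gt_eqF.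
  have fl : Num.floor (x / e) = k.
    by apply/eqP; rewrite floor_eq xe intrD; apply/andP; split; clear - s01; lra.
  have x1 : e * k%:~R <= x by rewrite ler_pM2l //; clear - s01; lra.
  have x2 : x <= e * (k%:~R + 1) by rewrite ler_pM2l //; clear - s01; lra.
  have h1 := hc k x (e * k%:~R) (ltac:(by rewrite x1 x2)) (ltac:(by rewrite lexx (le_trans x1 x2))).
  have h2 := hc k x (e * (k%:~R + 1)) (ltac:(by rewrite x1 x2)) (ltac:(by rewrite lexx (le_trans x1 x2))).
  rewrite lerBlDl /f splineE // fl.
  have /andP[t0 t1] := smooth_step_bnd (x / e - k%:~R).
  have far : ~~ ((`|k| <= N)%N && (`|(k + 1)%R| <= N)%N) -> A <= `|x|.
    move=> hk; have hx : N%:R <= `|x / e|.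
      rewrite xe; have [h|h] : (N%:Z <= k) \/ (k + 1 <= - N%:Z) by clear - hk; lia.
        have {}h : N%:R <= k%:~R :> R by move: h; rewrite -(ler_int R) -pmulrn.
        by apply: le_trans (ler_norm _); clear - h s01; lra.
      have {}h : k%:~R + 1 <= - N%:R :> R by move: h; rewrite -(ler_int R) intrD mulrNz -pmulrn.
      by have := lerNnormlW (lexx `|s + k%:~R|); clear - h s01; lra.
    apply: ltW; apply: lt_le_trans NA _.
    have := ler_wpM2l (ltW e0) hx; rewrite normrM normfV (gtr0_norm e0) mulrCA divff ?gt_eqF //.
    by rewrite mulr1.
  have ec : 0 <= e * c k by rewrite mulr_ge0 // ltW.
  rewrite -[4 * e * c k]mulrA.
  set a := if (`|k| <= N)%N then _ else _; set b := if (`|(k + 1)%R| <= N)%N then _ else _.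
  have hT := T0 x.
  suff [ha hb] : (F x - a) ^+ 2 <= T x + e * c k /\ (F x - b) ^+ 2 <= T x + e * c k.
    move: ha hb t0 t1 ec hT; move: (smooth_step _) (F x) (T x) (e * c k) => t u w z ha hb t0 t1 z0 hT.
    have w0 : 0 <= w + z by exact: le_trans (sqr_ge0 _) ha.
    by apply: le_trans (convex_square_le t0 t1 w0 ha hb) _; clear - w0 z0 hT; lra.
  have {far}Tx : ~~ ((`|k| <= N)%N && (`|(k + 1)%R| <= N)%N) -> T x = F x ^+ 2.
    by move=> /far Ax; rewrite /T Ax.
  have k1 : (F x - F (e * k%:~R)) ^+ 2 <= T x + e * c k by apply: le_trans h1 _; rewrite lerDr.
  have k2 : (F x - F (e * (k%:~R + 1))) ^+ 2 <= T x + e * c k by apply: le_trans h2 _; rewrite lerDr.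
  by rewrite /a /b; move: Tx; case: (`|k| <= N)%N; case: (`|(k + 1)%R| <= N)%N => /= Tx; split => //; rewrite Tx // subr0 lerDl.
apply: (@le_trans _ _ (\int[mu]_x ((g x)%:E + 2%:E * (T x)%:E))%E).
  apply: ge0_le_integral => //.
  - by move=> x _; rewrite lee_fin sqr_ge0.
  - by apply/measurable_EFinP; apply: measurable_funX; exact: measurable_funB.
  - apply: emeasurable_funD; first exact/measurable_EFinP.
    by apply/measurable_EFinP; exact: measurable_funM.
  - by move=> x _; rewrite -EFinM -EFinD lee_fin -lerBlDr le_max lexx orbT.
rewrite ge0_integralD //; first last.
- by apply/measurable_EFinP; exact: measurable_funM.
- by move=> x _; rewrite -EFinM lee_fin mulr_ge0.
- exact/measurable_EFinP.
- by move=> x _; rewrite lee_fin.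
rewrite ge0_integralZl //; first last.
- by move=> x _; rewrite lee_fin.
- exact/measurable_EFinP.
apply: (@le_trans _ _ ((d / 2)%:E + 2%:E * (d / 4)%:E)%E).
  by rewrite leeD // lee_wpmul2l // lee_fin.
by rewrite -EFinM -EFinD lee_fin; clear; lra.
Qed.

End Approximation.

(** * Travelling waves *)

Section Characteristics.
Variable R : realType.

Lemma is_derive_line (f : R * R -> R) (w v : R * R) (u : R) :
  differentiable f (w + u *: v) ->
  is_derive u (1 : R) (fun s => f (w + s *: v)) ('d f (w + u *: v) v).
Proof.
move=> df; have E : (fun h : R => h^-1 *: (((fun s => f (w + s *: v)) \o shift u) (h *: (1 : R)) -
      f (w + u *: v))) =
    (fun h : R => h^-1 *: ((f \o shift (w + u *: v)) (h *: v) - f (w + u *: v))).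
  apply/funext => h /=; congr (_ *: (f _ - _)).
  by rewrite scalerDl addrCA /GRing.scale /= mulr1.
split.
  by rewrite /derivable E; exact: diff_derivable.
by rewrite /derive E; exact: deriveE.
Qed.

(** A Riemann invariant: Q + al P is constant along the segment from (X + s tau, 0) to (X, tau). The
    sign of s is free, so the pair (-s, -al) yields the second invariant, and together they
    determine the wave by its data. *)
Lemma wave_characteristic (kt mb : R) (Phi Psi : R -> R) (Q P : R -> R -> R) (s al : R) :
  wave_solution kt mb Phi Psi Q P -> kt = s * al -> al * mb^-1 = s ->
  forall X tau, Q X tau + al * P X tau = Phi (X + s * tau) + al * Psi (X + s * tau).
Proof.
move=> [dQP eQ eP init] kE mE X tau.
pose fQ (y : R * R) := Q y.1 y.2; pose fP (y : R * R) := P y.1 y.2.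
have dQ z : differentiable fQ z by case: (dQP z).
have dP z : differentiable fP z by case: (dQP z).
have partial1 (f : R -> R -> R) (Y t : R) : (forall z, differentiable (fun y : R * R => f y.1 y.2) z) ->
    derive1 (f ^~ t) Y = 'd (fun y : R * R => f y.1 y.2) (Y, t) (1, 0).
  move=> df; apply: derE; have := @is_derive_line (fun y => f y.1 y.2) (0, t) (1, 0) Y (df _).
  have E (r : R) : (0, t) + r *: (1, 0) = (r, t) :> R * R.
    by congr pair; rewrite /= /GRing.scale /= ?mulr1 ?mulr0 ?add0r ?addr0.
  by rewrite E; under eq_fun do rewrite E.
have partial2 (f : R -> R -> R) (Y t : R) : (forall z, differentiable (fun y : R * R => f y.1 y.2) z) ->
    derive1 (f Y) t = 'd (fun y : R * R => f y.1 y.2) (Y, t) (0, 1).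
  move=> df; apply: derE; have := @is_derive_line (fun y => f y.1 y.2) (Y, 0) (0, 1) t (df _).
  have E (r : R) : (Y, 0) + r *: (0, 1) = (Y, r) :> R * R.
    by congr pair; rewrite /= /GRing.scale /= ?mulr1 ?mulr0 ?add0r ?addr0.
  by rewrite E; under eq_fun do rewrite E.
pose w : R * R := (X + s * tau, 0); pose v : R * R := (- (s * tau), tau).
have vE : v = - (s * tau) *: (1, 0) + tau *: (0, 1).
  by congr pair; rewrite /= /GRing.scale /= ?mulr1 ?mulr0 ?add0r ?addr0.
have lin (f : R * R -> R) z : 'd f z v = - (s * tau) * 'd f z (1, 0) + tau * 'd f z (0, 1).
  by rewrite vE linearD !linearZ.
pose g u := fQ (w + u *: v) + al * fP (w + u *: v).
have dg u : is_derive u (1 : R) g 0.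
  apply: is_derive_eq (derD (is_derive_line (dQ _)) (derZ al (is_derive_line (dP _)))) _.
  rewrite !lin; move: (w + u *: v) => [Y t].
  have := eQ Y t; have := eP Y t.
  rewrite (partial1 Q) // (partial1 P) // (partial2 Q) // (partial2 P) // -/fQ -/fP => -> ->.
  move: ('d fQ _ _) ('d fP _ _) => q p.
  have {}mE : al * (mb^-1 * q) = s * q by rewrite mulrA mE.
  have {}mE : tau * al * (mb^-1 * q) = tau * s * q by rewrite -mulrA mE mulrA.
  rewrite mulrDr [al * (tau * _)]mulrA [al * tau]mulrC mE kE; ring.
have [c _] := @derMVT R g (fun=> 0) 0 1 ler01 (fun u _ => dg u).
rewrite mul0r => /eqP; rewrite subr_eq0 => /eqP.
rewrite /g scale1r scale0r addr0.
have -> : w + v = (X, tau) by congr pair; rewrite /= ?add0r // addrK.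
by rewrite /fQ /fP /w /= => ->; case: (init (X + s * tau)) => -> ->.
Qed.

End Characteristics.

(** * The two-scale ansatz *)

Section TravellingWave.
Variable R : realType.

(** At most 2 B / e + 1 sites satisfy |e j| <= B. *)
Lemma zsum_count (F : int -> R) (m B e : R) N : 0 < e -> 0 <= B -> 0 <= m ->
  (forall j, 0 <= F j) -> (forall j, F j <= m) -> (forall j, B < `|e * j%:~R| -> F j = 0) ->
  e * zsum N F <= (2 * B + e) * m.
Proof.
move=> e0 B0 m0 F0 Fm out; pose n := Num.truncn (B / e).
have nB : e * n%:R <= B.
  by rewrite mulrC -ler_pdivlMr // truncn_le // divr_ge0 // ltW.
apply: (@le_trans _ _ (e * (n.*2.+1%:R * m))); last first.
  rewrite mulrA ler_wpM2r //.
  by rewrite -addn1 natrD -muln2 natrM mulrDr mulr1 mulrA mulrC lerD2r ler_pM2l.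
rewrite ler_wpM2l ?(ltW e0) // -zsum_cst.
apply: (@le_trans _ _ (zsum (maxn N n) F)); first exact: zsum_mono (leq_maxl _ _).
rewrite (@zsum_widen _ n) ?leq_maxr //; first by apply: ler_zsum.
move=> j nj; apply: out; rewrite normrM (gtr0_norm e0) mulrC -ltr_pdivrMr //.
have : B / e < n.+1%:R by apply: truncnS_gt.
move=> /lt_le_trans; apply.
by rewrite -intr_norm -[`|j|%R]abszE -pmulrn ler_nat.
Qed.

Lemma lipschitz_of_derive (f df : R -> R) (L : R) : (forall x, is_derive x (1 : R) f (df x)) ->
  (forall x, `|df x| <= L) -> forall x y, `|f x - f y| <= L * `|x - y|.
Proof.
move=> hf hL x y; wlog xy : x y / y <= x.
  move=> h; case: (leP y x) => xy; first exact: h.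
  by rewrite distrC [`|x - y|]distrC; apply: h; exact: ltW.
have [c _ ->] := derMVT xy (fun z _ => hf z).
by rewrite normrM ler_wpM2r.
Qed.

(** The slope is taken at an arbitrary point of [a, b], so that the forward difference in one
    equation and the backward difference in the other are both covered. *)
Lemma taylor_bound (f f1 f2 : R -> R) (L a b x : R) :
  (forall x, is_derive x (1 : R) f (f1 x)) -> (forall x, is_derive x (1 : R) f1 (f2 x)) ->
  (forall x, `|f2 x| <= L) -> a <= x <= b ->
  `|f b - f a - (b - a) * f1 x| <= L * (b - a) ^+ 2.
Proof.
move=> hf hf1 hL axb; have ab : a <= b by lra.
have [c hc ->] := derMVT ab (fun z _ => hf z).
rewrite mulrC -mulrBr normrM ger0_norm ?subr_ge0 // expr2 mulrCA ler_wpM2l ?subr_ge0 //.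
apply: le_trans (lipschitz_of_derive hf1 hL c x) _.
rewrite ler_wpM2l //; first exact: le_trans (hL 0).
by rewrite ler_norml; lra.
Qed.

Definition c2_bump (f f1 f2 : R -> R) (A L : R) :=
  [/\ forall x, is_derive x (1 : R) f (f1 x), forall x, is_derive x (1 : R) f1 (f2 x),
      forall x, A < `|x| -> [/\ f x = 0, f1 x = 0 & f2 x = 0] &
      forall x, [/\ `|f x| <= L, `|f1 x| <= L & `|f2 x| <= L]].

Lemma smooth_c2_bump f (A : R) : smooth_algebra f -> 0 < A -> (forall x, A < `|x| -> f x = 0) ->
  exists f1 f2 (L : R), 0 <= L /\ c2_bump f f1 f2 A L.
Proof.
move=> sf A0 f0.
have [f1 sf1 h1] := smooth_algebra_derive sf.
have [f2 sf2 h2] := smooth_algebra_derive sf1.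
have [f3 _ h3] := smooth_algebra_derive sf2.
have o1 := derive_out0 f0 h1; have o2 := derive_out0 o1 h2.
have AA : - A <= A by lra.
have bnd (g dg : R -> R) : (forall x, A < `|x| -> g x = 0) -> (forall x, is_derive x (1 : R) g (dg x)) ->
    exists2 C : R, 0 <= C & forall x, `|g x| <= C.
  move=> g0 hg.
  have [C C0 hC] := @segment_bounded R g _ _ AA (fun x => der_continuous (hg x)).
  exists C => // x; case: (leP `|x| A) => [|/g0->]; last by rewrite normr0.
  by rewrite ler_norml; exact: hC.
have [C0 C00 hC0] := bnd _ _ f0 h1; have [C1 C10 hC1] := bnd _ _ o1 h2.
have [C2 C20 hC2] := bnd _ _ o2 h3.
exists f1, f2, (C0 + C1 + C2); split; first by lra.
split=> // x; first by move=> Ax; rewrite f0 // o1 // o2.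
by split; [have := hC0 x|have := hC1 x|have := hC2 x]; lra.
Qed.

Lemma c2_bump_mono f f1 f2 A L A' L' : A <= A' -> L <= L' -> c2_bump f f1 f2 A L ->
  c2_bump f f1 f2 A' L'.
Proof.
move=> AA LL [h1 h2 out bd]; split => // x.
  by move=> /(le_lt_trans AA); exact: out.
by have [? ? ?] := bd x; split; apply: le_trans LL.
Qed.

Variables (kap mu : int -> R) (lo hi kt mb s A L T0 : R).
Hypothesis lo_gt0 : 0 < lo.
Hypothesis kap_bnd : forall j, lo <= kap j <= hi.
Hypothesis mu_bnd : forall j, lo <= mu j <= hi.
Hypothesis kt_gt0 : 0 < kt.
Hypothesis mb_gt0 : 0 < mb.
Hypothesis s_gt0 : 0 < s.
Hypothesis sE : s * (s / kt) = mb^-1.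
Hypothesis L_ge0 : 0 <= L.
Variables (chi zeta : int -> R).
Hypothesis chiE : forall j, chi (j + 1) - chi j = kt * kap j - 1.
Hypothesis zetaE : forall j, zeta j - zeta (j - 1) = mu j / mb - 1.
Variables (e eta : R).
Hypothesis e_gt0 : 0 < e.
Hypothesis e_le1 : e <= 1.
Hypothesis eta_ge0 : 0 <= eta.
(** Up to macroscopic time T0 the profiles reach A + s T0. One unit more accommodates the sites j +
    1 and j - 1, as e <= 1, and another one the bounds on the correctors at those neighbours. *)
Definition wave_range : R := A + s * T0 + 2.
Hypothesis chi_small : forall j, `|e * j%:~R| <= wave_range -> `|e * chi j| <= eta.
Hypothesis zeta_small : forall j, `|e * j%:~R| <= wave_range -> `|e * zeta j| <= eta.

Definition phase (c : R) (j : int) (t : R) : R := e * j%:~R + c * (e * t).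

(* The two-scale ansatz for a profile travelling at speed c: the correctors chi and zeta remove
   the terms of order e from the forcing, whatever the coefficients. *)
Definition wave_q (f f1 : R -> R) (c : R) (j : int) (t : R) : R :=
  f (phase c j t) + e * zeta j * f1 (phase c j t).
Definition wave_p (f f1 : R -> R) (c : R) (j : int) (t : R) : R :=
  c / kt * (f (phase c j t) + e * chi j * f1 (phase c j t)).
Definition wave_a (f f1 f2 : R -> R) (c : R) (j : int) (t : R) : R :=
  kap j * (c * e * (f1 (phase c j t) + e * zeta j * f2 (phase c j t))) -
  (wave_p f f1 c (j + 1) t - wave_p f f1 c j t).
Definition wave_b (f f1 f2 : R -> R) (c : R) (j : int) (t : R) : R :=
  mu j * (c / kt * (c * e * (f1 (phase c j t) + e * chi j * f2 (phase c j t)))) -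
  (wave_q f f1 c j t - wave_q f f1 c (j - 1) t).

Lemma wave_forced f f1 f2 c : c2_bump f f1 f2 A L ->
  forced_lattice kap mu (wave_q f f1 c) (wave_p f f1 c) (wave_a f f1 f2 c) (wave_b f f1 f2 c).
Proof.
move=> [hf hf1 _ _].
have dphase (g dg : R -> R) j t : (forall x, is_derive x (1 : R) g (dg x)) ->
    is_derive t (1 : R) (fun t => g (phase c j t)) (dg (phase c j t) * (c * e)).
  move=> hg; apply: der_comp (hg _) _; rewrite /phase.
  by apply: is_derive_eq (derD (derC _ _) (derZ c (derZ e (derI t)))) _; rewrite add0r mulr1.
have combo x (g dg dg2 : R -> R) j t : (forall x, is_derive x (1 : R) g (dg x)) ->
    (forall x, is_derive x (1 : R) dg (dg2 x)) ->
    is_derive t (1 : R) (fun t => g (phase c j t) + e * x * dg (phase c j t))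
      (c * e * (dg (phase c j t) + e * x * dg2 (phase c j t))).
  move=> h1 h2; apply: is_derive_eq (derD (dphase _ _ j t h1) (derZ _ (dphase _ _ j t h2))) _.
  by ring.
split=> j t.
  apply: is_derive_eq (combo (zeta j) _ _ _ j t hf hf1) _.
  by rewrite /wave_a subrKC mulKf // gt_eqF // (kap_gt0 lo_gt0 kap_bnd).
apply: is_derive_eq (derZ (c / kt) (combo (chi j) _ _ _ j t hf hf1)) _.
by rewrite /wave_b subrKC mulKf // gt_eqF // (mu_gt0 lo_gt0 mu_bnd).
Qed.

Lemma phase_out c j t : `|c| = s -> `|t| <= T0 / e -> wave_range - 1 < `|e * j%:~R| ->
  A + 1 < `|phase c j t|.
Proof.
move=> cs tT; rewrite /wave_range /phase => h.
have h2 : `|c * (e * t)| <= s * T0.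
  rewrite !normrM cs (gtr0_norm e_gt0) ler_pM2l // mulrC -ler_pdivlMr //.
have := lerB_dist (e * j%:~R) (- (c * (e * t))); rewrite opprK normrN; lra.
Qed.

Definition wave_cst : R := L * (s / kt + 1) * (kt * hi + hi / mb + 1).

Lemma hi_gt0 : 0 < hi.
Proof. by have := kap_bnd 0; have := lo_gt0; lra. Qed.

Lemma wave_a_bound f f1 f2 c j t : c2_bump f f1 f2 A L -> `|c| = s -> `|t| <= T0 / e ->
  `|wave_a f f1 f2 c j t| <= wave_cst * (e * (e + eta)) /\
  (wave_range - 1 < `|e * j%:~R| -> wave_a f f1 f2 c j t = 0).
Proof.
move=> [hf hf1 out bd] cs tT.
have e0 := e_gt0; have e1 := e_le1.
set y := phase c j t.
have yS : phase c (j + 1) t = y + e by rewrite /y /phase intrD; ring.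
have zero : wave_range - 1 < `|e * j%:~R| -> wave_a f f1 f2 c j t = 0.
  move=> /(phase_out cs tT); rewrite -/y => hy.
  have hy2 : A < `|y + e|.
    by have := lerB_dist y (- e); rewrite opprK normrN (gtr0_norm e_gt0); lra.
  have hy1 : A < `|y| by lra.
  rewrite /wave_a /wave_p yS -/y; have [-> -> ->] := out _ hy1; have [-> -> _] := out _ hy2.
  by rewrite !(mulr0, addr0, subrr).
split => //.
have hi0 := hi_gt0; have eta0 := eta_ge0; have kt0 := kt_gt0; have L0 := L_ge0;
have e0' := ltW e0; have kt0' := ltW kt0; have hi0' := ltW hi0; have one := @ler01 R.
have C0 : 0 <= wave_cst * (e * (e + eta)).
  rewrite /wave_cst !mulr_ge0 ?addr_ge0 ?divr_ge0 ?mulr_ge0 //; exact: ltW.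
case: (ltP (wave_range - 1) `|e * j%:~R|) => [/zero->|hj]; first by rewrite normr0.
have c1 : `|e * zeta j| <= eta by apply: zeta_small; lra.
have c2 : `|e * chi (j + 1)| <= eta.
  apply: chi_small; rewrite intrD mulrDr mulr1.
  by apply: le_trans (ler_normD _ _) _; rewrite (gtr0_norm e_gt0); lra.
(* Since kt kap_j = 1 + chi_(j+1) - chi_j, the terms of order e cancel. What is left is a Taylor
   remainder of order e^2 and two products of a factor e with a corrector of size [eta]. *)
pose X := - (f (y + e) - f y - (y + e - y) * f1 y) + e * (kt * kap j) * (e * zeta j) * f2 y
   - e * chi (j + 1) * (f1 (y + e) - f1 y).
have -> : wave_a f f1 f2 c j t = c / kt * X.
  rewrite /wave_a /wave_p yS -/y /X.
  have -> : kap j = (1 + (chi (j + 1) - chi j)) / kt by rewrite chiE subrKC mulrC mulKf ?gt_eqF.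
  by field; rewrite gt_eqF.
have yy : y <= y <= y + e by lra.
have T1 := taylor_bound hf hf1 (fun x => let: And3 _ _ h := bd x in h) yy.
have T2 := lipschitz_of_derive hf1 (fun x => let: And3 _ _ h := bd x in h) (y + e) y.
have [_ _ b2] := bd y.
have X1 : `|X| <= L * e ^+ 2 + e * (kt * hi) * eta * L + eta * (L * e).
  rewrite /X; apply: le_trans (ler_normB _ _) _; apply: lerD; last first.
    rewrite normrM; apply: ler_pM => //; apply: le_trans T2 _.
    by rewrite addrAC subrr add0r (gtr0_norm e0).
  apply: le_trans (ler_normD _ _) _; apply: lerD.
    by rewrite normrN; apply: le_trans T1 _; rewrite addrAC subrr add0r.
  rewrite 2!normrM; apply: ler_pM => //; apply: ler_pM => //.
  have /andP[k1 k2] := kap_bnd j; have k0 := kap_gt0 lo_gt0 kap_bnd j.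
  by rewrite !normrM (gtr0_norm e0) (gtr0_norm kt0) (gtr0_norm k0) ler_pM2l // ler_pM2l.
rewrite normrM normrM cs normfV (gtr0_norm kt0).
have sk : 0 <= s / kt by rewrite divr_ge0 // ltW.
have X2 : `|X| <= e * (e + eta) * (L * (kt * hi + hi / mb + 1)).
  apply: le_trans X1 _; rewrite -subr_ge0.
  have -> : e * (e + eta) * (L * (kt * hi + hi / mb + 1)) - (L * e ^+ 2 + e * (kt * hi) * eta * L + eta * (L * e))
    = e * L * (e * (kt * hi)) + e * L * ((e + eta) * (hi / mb)) by ring.
  have mbi : 0 <= hi / mb by rewrite divr_ge0 ?(ltW hi0) // ltW // mb_gt0.
  by do ?[assumption | apply: addr_ge0 | apply: mulr_ge0].
apply: (@le_trans _ _ ((s / kt + 1) * (e * (e + eta) * (L * (kt * hi + hi / mb + 1))))).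
  apply: ler_pM => //; lra.
by rewrite le_eqVlt; apply/orP; left; apply/eqP; rewrite /wave_cst; ring.
Qed.

Lemma wave_b_bound f f1 f2 c j t : c2_bump f f1 f2 A L -> `|c| = s -> `|t| <= T0 / e ->
  `|wave_b f f1 f2 c j t| <= wave_cst * (e * (e + eta)) /\
  (wave_range - 1 < `|e * j%:~R| -> wave_b f f1 f2 c j t = 0).
Proof.
move=> [hf hf1 out bd] cs tT.
have e0 := e_gt0; have e1 := e_le1.
set y := phase c j t.
have yP : phase c (j - 1) t = y - e by rewrite /y /phase intrB; ring.
have zero : wave_range - 1 < `|e * j%:~R| -> wave_b f f1 f2 c j t = 0.
  move=> /(phase_out cs tT); rewrite -/y => hy.
  have hy2 : A < `|y - e|.
    by have := lerB_dist y e; rewrite (gtr0_norm e_gt0); lra.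
  have hy1 : A < `|y| by lra.
  rewrite /wave_b /wave_q yP -/y; have [-> -> ->] := out _ hy1; have [-> -> _] := out _ hy2.
  by rewrite !(mulr0, addr0, subrr).
split => //.
have hi0 := hi_gt0; have eta0 := eta_ge0; have kt0 := kt_gt0; have L0 := L_ge0;
have e0' := ltW e0; have kt0' := ltW kt0; have hi0' := ltW hi0; have one := @ler01 R; have mb0 := mb_gt0.
have C0 : 0 <= wave_cst * (e * (e + eta)).
  rewrite /wave_cst !mulr_ge0 ?addr_ge0 ?divr_ge0 ?mulr_ge0 //; exact: ltW.
case: (ltP (wave_range - 1) `|e * j%:~R|) => [/zero->|hj]; first by rewrite normr0.
have c1 : `|e * chi j| <= eta by apply: chi_small; lra.
have c2 : `|e * zeta (j - 1)| <= eta.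
  apply: zeta_small; rewrite intrB mulrBr mulr1.
  by apply: le_trans (ler_normB _ _) _; rewrite (gtr0_norm e_gt0); lra.
(* The speed enters only through c^2 / kt, equal to 1 / mb for both directions of propagation; this
   is the coefficient that [zeta] corrects. *)
have cc : c * (c / kt) = mb^-1.
  rewrite -sE -cs !mulrA -!expr2 real_normK //; exact: num_real.
pose X := - (f y - f (y - e) - (y - (y - e)) * f1 y) + e * (mu j / mb) * (e * chi j) * f2 y
   - e * zeta (j - 1) * (f1 y - f1 (y - e)).
have -> : wave_b f f1 f2 c j t = X.
  rewrite /wave_b /wave_q yP -/y /X.
  have -> : mu j * (c / kt * (c * e * (f1 y + e * chi j * f2 y))) =
    (mu j * (c * (c / kt))) * e * (f1 y + e * chi j * f2 y) by ring.
  rewrite cc; have -> : mu j / mb = 1 + (zeta j - zeta (j - 1)) by rewrite zetaE subrKC.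
  by ring.
have yy : y - e <= y <= y by lra.
have T1 := taylor_bound hf hf1 (fun x => let: And3 _ _ h := bd x in h) yy.
have T2 := lipschitz_of_derive hf1 (fun x => let: And3 _ _ h := bd x in h) y (y - e).
have [_ _ b2] := bd y.
have X1 : `|X| <= L * e ^+ 2 + e * (hi / mb) * eta * L + eta * (L * e).
  rewrite /X; apply: le_trans (ler_normB _ _) _; apply: lerD; last first.
    rewrite normrM; apply: ler_pM => //; apply: le_trans T2 _.
    by rewrite opprB addrC subrK (gtr0_norm e0).
  apply: le_trans (ler_normD _ _) _; apply: lerD.
    by rewrite normrN; apply: le_trans T1 _; rewrite opprB addrC subrK.
  rewrite 2!normrM; apply: ler_pM => //; apply: ler_pM => //.
  have /andP[k1 k2] := mu_bnd j; have k0 := mu_gt0 lo_gt0 mu_bnd j.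
  by rewrite !normrM normfV (gtr0_norm e0) (gtr0_norm mb0) (gtr0_norm k0) ler_pM2l // ler_pM2r // invr_gt0.
have X2 : `|X| <= e * (e + eta) * (L * (kt * hi + hi / mb + 1)).
  apply: le_trans X1 _; rewrite -subr_ge0.
  have -> : e * (e + eta) * (L * (kt * hi + hi / mb + 1)) - (L * e ^+ 2 + e * (hi / mb) * eta * L + eta * (L * e))
    = e * L * (e * (hi / mb)) + e * L * ((e + eta) * (kt * hi)) by ring.
  have mbi : 0 <= hi / mb by rewrite divr_ge0 // ltW.
  by do ?[assumption | apply: addr_ge0 | apply: mulr_ge0].
have sk : 0 <= s / kt by rewrite divr_ge0 // ltW.
apply: le_trans X2 _; rewrite /wave_cst -subr_ge0.
have -> : L * (s / kt + 1) * (kt * hi + hi / mb + 1) * (e * (e + eta)) -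
  e * (e + eta) * (L * (kt * hi + hi / mb + 1)) =
  s / kt * (e * (e + eta) * (L * (kt * hi + hi / mb + 1))) by ring.
have mbi : 0 <= hi / mb by rewrite divr_ge0 // ltW.
by do ?[assumption | apply: addr_ge0 | apply: mulr_ge0].
Qed.

End TravellingWave.

(** * Error between the lattice and two travelling waves *)

Section HomogenizationError.
Variable R : realType.

Lemma forced_lattice_lin (kap mu : int -> R) q p a b q' p' a' b' (c : R) :
  forced_lattice kap mu q p a b -> forced_lattice kap mu q' p' a' b' ->
  forced_lattice kap mu (fun j t => q j t + c * q' j t) (fun j t => p j t + c * p' j t)
    (fun j t => a j t + c * a' j t) (fun j t => b j t + c * b' j t).
Proof.
move=> [h1 h2] [h1' h2']; split=> j t.
  by apply: is_derive_eq (derD (h1 j t) (derZ c (h1' j t))) _; ring.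
by apply: is_derive_eq (derD (h2 j t) (derZ c (h2' j t))) _; ring.
Qed.

Lemma energy_gronwall_sym (kap mu : int -> R) (lo hi : R) q p a b (T M lam S E0 : R) :
  0 < lo -> (forall j, lo <= kap j <= hi) -> (forall j, lo <= mu j <= hi) ->
  forced_lattice kap mu q p a b -> 0 < lam -> 0 <= S ->
  (forall N t, `|t| <= T -> zsum N (fun j => q j t ^+ 2 + p j t ^+ 2) <= M) ->
  (forall N t, `|t| <= T ->
     zsum N (fun j => (kap j)^-1 * a j t ^+ 2 + (mu j)^-1 * b j t ^+ 2) <= S) ->
  (forall N, zsum N (energy kap mu q p 0) <= E0) ->
  forall N t, `|t| <= T ->
    zsum N (energy kap mu q p t) <= expR (lam * `|t|) * (E0 + S / lam * `|t|).
Proof.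
move=> lo0 hk hm hf lam0 S0 hM hS hE N t; case: (leP 0 t) => t0 tT.
  rewrite (ger0_norm t0) in tT *.
  have := @energy_gronwall R kap mu lo hi lo0 hk hm q p a b 0 t M lam S E0 hf t0 lam0 S0 _ _ hE N.
  rewrite subr0; apply=> N' u hu; [apply: hM|apply: hS]; rewrite ger0_norm; lra.
rewrite (ltr0_norm t0) in tT *.
have Eb u : energy kap mu (backward q) (fun j t => - p j (- t)) u = energy kap mu q p (- u).
  by apply/funext => j; rewrite /energy /backward sqrrN.
have hb := forced_lattice_backward hf.
have nt : 0 <= - t by lra.
have := @energy_gronwall R kap mu lo hi lo0 hk hm _ _ _ _ 0 (- t) M lam S E0 hb nt lam0 S0.
have Et : energy kap mu q p t = energy kap mu (backward q) (fun j t => - p j (- t)) (- t).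
  by rewrite Eb opprK.
rewrite subr0 Et; apply.
- move=> N' u hu; rewrite (@eq_zsum _ N' _ (fun j => q j (- u) ^+ 2 + p j (- u) ^+ 2)).
    by apply: hM; rewrite normrN ger0_norm; lra.
  by move=> j _; rewrite /backward sqrrN.
- move=> N' u hu; rewrite (@eq_zsum _ N' _
      (fun j => (kap j)^-1 * a j (- u) ^+ 2 + (mu j)^-1 * b j (- u) ^+ 2)).
    by apply: hS; rewrite normrN ger0_norm; lra.
  by move=> j _; rewrite /backward sqrrN.
- by move=> N'; rewrite Eb oppr0.
Qed.

Lemma ler_zsum_twice (F G H : int -> R) (e : R) N : 0 <= e ->
  (forall j, F j <= 2 * G j + 2 * H j) ->
  e * zsum N F <= 2 * (e * zsum N G) + 2 * (e * zsum N H).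
Proof.
move=> e0 h; rewrite mulrCA [2 * (e * zsum N H)]mulrCA -mulrDr ler_wpM2l //.
by rewrite -!zsumZ -zsumD; apply: ler_zsum.
Qed.

Lemma sqr_norm_le (x c : R) : `|x| <= c -> x ^+ 2 <= c ^+ 2.
Proof.
move=> h; rewrite -(real_normK (num_real x)) ler_pXn2r // nnegrE //.
exact: le_trans h.
Qed.

(** Leading order only, without correctors: this expression is compared with the sampled data at
    time 0 and with the limit wave later; the corrected ansatz serves as an intermediate term. *)
Definition two_waves_q (f g : R -> R) (s e : R) (j : int) (t : R) : R :=
  f (phase e s j t) + g (phase e (- s) j t).
Definition two_waves_p (f g : R -> R) (kt s e : R) (j : int) (t : R) : R :=
  s / kt * (f (phase e s j t) - g (phase e (- s) j t)).

(* The factor in front of D does not depend on the profiles f and g: this is what allows to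
   choose them, close to the data, before e tends to 0. *)
Lemma homogenization_error (lo hi kt mb s A L T0 : R) :
  0 < lo -> lo <= hi -> 0 < kt -> 0 < mb -> 0 < s -> s * (s / kt) = mb^-1 -> 0 < A -> 0 <= L -> 0 < T0 ->
  exists C : R, 0 <= C /\ forall (kap mu chi zeta : int -> R) (e eta D : R)
    (f f1 f2 g g1 g2 : R -> R) (q p : int -> R -> R),
  (forall j, lo <= kap j <= hi) -> (forall j, lo <= mu j <= hi) ->
  (forall j, chi (j + 1) - chi j = kt * kap j - 1) ->
  (forall j, zeta j - zeta (j - 1) = mu j / mb - 1) ->
  0 < e -> e <= 1 -> 0 <= eta ->
  (forall j, `|e * j%:~R| <= wave_range s A T0 -> `|e * chi j| <= eta) ->
  (forall j, `|e * j%:~R| <= wave_range s A T0 -> `|e * zeta j| <= eta) ->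
  c2_bump f f1 f2 A L -> c2_bump g g1 g2 A L ->
  free_lattice kap mu q p -> (forall t, exists M, ell2_le q p t M) ->
  (forall N, e * zsum N (fun j => (q j 0 - two_waves_q f g s e j 0) ^+ 2 +
     (p j 0 - two_waves_p f g kt s e j 0) ^+ 2) <= D) ->
  forall N t, `|t| <= T0 / e -> e * zsum N (fun j => (q j t - two_waves_q f g s e j t) ^+ 2 +
     (p j t - two_waves_p f g kt s e j t) ^+ 2) <= 4 * (lo^-1 * (expR T0 * hi)) * D + C * (e + eta) ^+ 2.
Proof.
move=> lo0 lohi kt0 mb0 s0 sE A0 L0 T00.
have hi0 : 0 < hi by exact: lt_le_trans lohi.
pose K := wave_cst hi kt mb s L; pose B := wave_range s A T0.
have B0 : 0 <= B by rewrite /B /wave_range; have := mulr_gt0 s0 T00; lra.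
(* Counting sites, [Zc] bounds e times the sum of squares of the leading waves, and [Zc * eta ^+ 2]
   that of their correctors. In [Sc] the factor 8 stands for two waves, squared, in two
   equations. *)
pose Zc := (2 * B + 1) * (4 * L ^+ 2 * (1 + (s / kt) ^+ 2)).
pose Sc := (2 * B + 1) * (lo^-1 * (8 * K ^+ 2)) * T0.
pose X0 := expR T0.
pose C := 2 * (lo^-1 * (X0 * (2 * hi + 2 * hi * Zc + Sc))) + 2 * Zc.
have L2 := sqr_ge0 L; have sk2 := sqr_ge0 (s / kt); have K2 := sqr_ge0 K.
have Bp : 0 <= 2 * B + 1 by lra.
have loi : 0 <= lo^-1 by rewrite invr_ge0 ltW.
have Zc0 : 0 <= Zc.
  by apply: mulr_ge0 => //; apply: mulr_ge0; lra.
have Sc0 : 0 <= Sc.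
  by apply: mulr_ge0; [apply: mulr_ge0 => //; apply: mulr_ge0; lra|exact: ltW].
have X00 : 0 <= X0 by exact: expR_ge0.
have hZ : 0 <= hi * Zc by apply: mulr_ge0 => //; exact: ltW.
have hC1 : 0 <= X0 * (2 * hi + 2 * hi * Zc + Sc) by apply: mulr_ge0 => //; lra.
have C0 : 0 <= C by rewrite /C; have := mulr_ge0 loi hC1; lra.
exists C; split => // kap mu chi zeta e eta D f f1 f2 g g1 g2 q p hk hm hchi hzeta e0 e1 eta0
  schi szeta bf bg fr el2 hD N t tT.
have T0e : 0 <= T0 / e by rewrite divr_ge0 // ltW.
have ns : `|s| = s by rewrite gtr0_norm.
have nns : `|- s| = s by rewrite normrN.
pose Wq j t := wave_q zeta e f f1 s j t + 1 * wave_q zeta e g g1 (- s) j t.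
pose Wp j t := wave_p kt chi e f f1 s j t + 1 * wave_p kt chi e g g1 (- s) j t.
pose a j t := wave_a kap kt chi zeta e f f1 f2 s j t + 1 * wave_a kap kt chi zeta e g g1 g2 (- s) j t.
pose b j t := wave_b mu kt chi zeta e f f1 f2 s j t + 1 * wave_b mu kt chi zeta e g g1 g2 (- s) j t.
have fW : forced_lattice kap mu Wq Wp a b.
  apply: forced_lattice_lin.
    exact: (@wave_forced R kap mu lo hi kt A L lo0 hk hm chi zeta e f f1 f2 s bf).
  exact: (@wave_forced R kap mu lo hi kt A L lo0 hk hm chi zeta e g g1 g2 (- s) bg).
pose Eq j t := q j t + -1 * Wq j t; pose Ep j t := p j t + -1 * Wp j t.
have fE : forced_lattice kap mu Eq Ep (fun j t => 0 + -1 * a j t) (fun j t => 0 + -1 * b j t).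
  exact: forced_lattice_lin.
have [rf1 rf2 rf3 rf4] := bf; have [rg1 rg2 rg3 rg4] := bg.
have far (u : R) j : `|u| <= T0 / e -> B < `|e * j%:~R| ->
    A < `|phase e s j u| /\ A < `|phase e (- s) j u|.
  move=> hu hj; have hj' : wave_range s A T0 - 1 < `|e * j%:~R| by move: hj; rewrite /B; lra.
  have h1 := @phase_out R s A T0 s0 e e0 _ j u ns hu hj'.
  have h2 := @phase_out R s A T0 s0 e e0 _ j u nns hu hj'.
  by move: h1 h2; clear; split; lra.
have e1B : 2 * B + e <= 2 * B + 1 by lra.
have wcount (F : int -> R) (m : R) M : 0 <= m -> (forall j, 0 <= F j) ->
    (forall j, `|e * j%:~R| <= B -> F j <= m) ->
    (forall j, B < `|e * j%:~R| -> F j = 0) -> e * zsum M F <= (2 * B + 1) * m.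
  move=> m0 F0 Fm out; apply: (@le_trans _ _ ((2 * B + e) * m)); last by rewrite ler_wpM2r.
  apply: zsum_count => // j; case: (leP `|e * j%:~R| B) => [|/out->//]; exact: Fm.
have corr (u : R) : `|u| <= T0 / e -> forall M, e * zsum M (fun j =>
    (Wq j u - two_waves_q f g s e j u) ^+ 2 + (Wp j u - two_waves_p f g kt s e j u) ^+ 2) <= Zc * eta ^+ 2.
  move=> hu M; rewrite /Zc -[_ * eta ^+ 2]mulrA; apply: wcount => //.
  - by rewrite mulr_ge0 ?sqr_ge0 // mulr_ge0 //; lra.
  - by move=> j; rewrite addr_ge0 // sqr_ge0.
  - move=> j hj; have c1 := schi j hj; have c2 := szeta j hj.
    have [_ b1 _] := rf4 (phase e s j u); have [_ b2 _] := rg4 (phase e (- s) j u).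
    rewrite /Wq /Wp /wave_q /wave_p /two_waves_q /two_waves_p.
    move: (f _) (g _) b1 b2 => x1 x2; move: (f1 _) (g1 _) => y1 y2 b1 b2.
    have -> : x1 + e * zeta j * y1 + 1 * (x2 + e * zeta j * y2) - (x1 + x2) =
      e * zeta j * (y1 + y2) by ring.
    have -> : s / kt * (x1 + e * chi j * y1) + 1 * (- s / kt * (x2 + e * chi j * y2)) -
      s / kt * (x1 - x2) = s / kt * (e * chi j * (y1 - y2)) by ring.
    have h1 : (e * zeta j * (y1 + y2)) ^+ 2 <= (eta * (2 * L)) ^+ 2.
      apply: sqr_norm_le; rewrite normrM ler_pM //.
      by apply: le_trans (ler_normD _ _) _; lra.
    have h2 : (e * chi j * (y1 - y2)) ^+ 2 <= (eta * (2 * L)) ^+ 2.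
      apply: sqr_norm_le; rewrite normrM ler_pM //.
      by apply: le_trans (ler_normB _ _) _; lra.
    have h3 := ler_wpM2l sk2 h2.
    rewrite [(s / kt * _) ^+ 2]exprMn; apply: le_trans (lerD h1 h3) _.
    by rewrite le_eqVlt; apply/orP; left; apply/eqP; ring.
  - move=> j /(far u j hu) [/rf3[z1 z2 _] /rg3[z3 z4 _]].
    rewrite /Wq /Wp /wave_q /wave_p /two_waves_q /two_waves_p z1 z2 z3 z4; ring.
have bounded (u : R) : `|u| <= T0 / e -> forall M, e * zsum M (fun j =>
    two_waves_q f g s e j u ^+ 2 + two_waves_p f g kt s e j u ^+ 2) <= Zc.
  move=> hu M; apply: wcount => //.
  - by rewrite mulr_ge0 //; lra.
  - by move=> j; rewrite addr_ge0 // sqr_ge0.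
  - move=> j hj.
    have [b1 _ _] := rf4 (phase e s j u); have [b2 _ _] := rg4 (phase e (- s) j u).
    rewrite /two_waves_q /two_waves_p.
    move: (f _) (g _) b1 b2 => x1 x2 b1 b2.
    have h1 : (x1 + x2) ^+ 2 <= (2 * L) ^+ 2.
      by apply: sqr_norm_le; apply: le_trans (ler_normD _ _) _; lra.
    have h2 : (x1 - x2) ^+ 2 <= (2 * L) ^+ 2.
      by apply: sqr_norm_le; apply: le_trans (ler_normB _ _) _; lra.
    have h3 := ler_wpM2l sk2 h2.
    rewrite [(s / kt * _) ^+ 2]exprMn; apply: le_trans (lerD h1 h3) _.
    by rewrite le_eqVlt; apply/orP; left; apply/eqP; ring.
  - move=> j /(far u j hu) [/rf3[z1 _ _] /rg3[z3 _ _]].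
    by rewrite /two_waves_q /two_waves_p z1 z3; ring.
have resid (u : R) : `|u| <= T0 / e -> forall M, zsum M (fun j =>
    (kap j)^-1 * (0 + -1 * a j u) ^+ 2 + (mu j)^-1 * (0 + -1 * b j u) ^+ 2) <= Sc / T0 * (e * (e + eta) ^+ 2).
  move=> hu M.
  have ab (c : R) (F G : R) : `|F| <= K * (e * (e + eta)) -> `|G| <= K * (e * (e + eta)) ->
      lo <= c -> c^-1 * (0 + -1 * (F + 1 * G)) ^+ 2 <= lo^-1 * (2 * (K * (e * (e + eta)))) ^+ 2.
    move=> hF hG hc; apply: ler_pM => //.
    - by rewrite invr_ge0; apply: le_trans hc; exact: ltW.
    - exact: sqr_ge0.
    - by rewrite lef_pV2 // posrE //; apply: lt_le_trans hc.
    apply: sqr_norm_le; rewrite add0r mulN1r normrN mul1r.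
    by apply: le_trans (ler_normD _ _) _; lra.
  have wa := @wave_a_bound R kap lo hi kt mb s A L T0 lo0 hk kt0 mb0 s0 L0 chi zeta hchi
    e eta e0 e1 eta0 schi szeta.
  have wb := @wave_b_bound R kap mu lo hi kt mb s A L T0 lo0 hk hm kt0 mb0 s0 sE L0 chi zeta hzeta
    e eta e0 e1 eta0 schi szeta.
  rewrite -(ler_pM2l e0).
  have -> : e * (Sc / T0 * (e * (e + eta) ^+ 2)) =
      (2 * B + 1) * (2 * (lo^-1 * (2 * (K * (e * (e + eta)))) ^+ 2)).
    by rewrite /Sc; field; rewrite !gt_eqF.
  apply: wcount => //.
  - by rewrite mulr_ge0 // mulr_ge0 // sqr_ge0.
  - move=> j; have /andP[k1 _] := hk j; have /andP[m1 _] := hm j.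
    by rewrite addr_ge0 // mulr_ge0 ?sqr_ge0 // invr_ge0; [apply: le_trans k1|apply: le_trans m1]; exact: ltW.
  - move=> j _; have /andP[k1 _] := hk j; have /andP[m1 _] := hm j.
    rewrite mulr_natl mulr2n lerD //; rewrite /a /b; apply: ab => //.
    + by case: (wa f f1 f2 s j u bf ns hu).
    + by case: (wa g g1 g2 (- s) j u bg nns hu).
    + by case: (wb f f1 f2 s j u bf ns hu).
    + by case: (wb g g1 g2 (- s) j u bg nns hu).
  - move=> j hj; have hj' : wave_range s A T0 - 1 < `|e * j%:~R| by move: hj; rewrite /B; lra.
    have [_ z1] := wa f f1 f2 s j u bf ns hu; have [_ z2] := wa g g1 g2 (- s) j u bg nns hu.
    have [_ z3] := wb f f1 f2 s j u bf ns hu; have [_ z4] := wb g g1 g2 (- s) j u bg nns hu.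
    by rewrite /a /b z1 // z2 // z3 // z4 //; ring.
have [M hM] := free_lattice_bounded lo0 hk hm (T0 / e) fr el2.
have sq2 (x y : R) : (x - y) ^+ 2 <= 2 * x ^+ 2 + 2 * y ^+ 2 by have := sqr_ge0 (x + y); nra.
have sq2D (x y : R) : (x + y) ^+ 2 <= 2 * x ^+ 2 + 2 * y ^+ 2 by have := sqr_ge0 (x - y); nra.
have e0' := ltW e0.
have d3 (x y z : R) : x - z - (y - z) = x + -1 * y by ring.
have d4 (x y z : R) : x - y + (y - z) = x - z by ring.
have EX (u : R) M' : e * zsum M' (fun j => (Eq j u) ^+ 2 + (Ep j u) ^+ 2) <=
   2 * (e * zsum M' (fun j => (q j u - two_waves_q f g s e j u) ^+ 2 +
     (p j u - two_waves_p f g kt s e j u) ^+ 2)) +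
   2 * (e * zsum M' (fun j => (Wq j u - two_waves_q f g s e j u) ^+ 2 + (Wp j u - two_waves_p f g kt s e j u) ^+ 2)).
  apply: ler_zsum_twice => // j; rewrite /Eq /Ep.
  have h1 := sq2 (q j u - two_waves_q f g s e j u) (Wq j u - two_waves_q f g s e j u).
  have h2 := sq2 (p j u - two_waves_p f g kt s e j u) (Wp j u - two_waves_p f g kt s e j u).
  by move: h1 h2; rewrite !d3; clear; lra.
have XE (u : R) M' : e * zsum M' (fun j => (q j u - two_waves_q f g s e j u) ^+ 2 +
     (p j u - two_waves_p f g kt s e j u) ^+ 2) <=
   2 * (e * zsum M' (fun j => (Eq j u) ^+ 2 + (Ep j u) ^+ 2)) +
   2 * (e * zsum M' (fun j => (Wq j u - two_waves_q f g s e j u) ^+ 2 + (Wp j u - two_waves_p f g kt s e j u) ^+ 2)).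
  apply: ler_zsum_twice => // j; rewrite /Eq /Ep.
  have h1 := sq2D (q j u - Wq j u) (Wq j u - two_waves_q f g s e j u).
  have h2 := sq2D (p j u - Wp j u) (Wp j u - two_waves_p f g kt s e j u).
  by move: h1 h2; rewrite !d4 !mulN1r; clear; lra.
have zero_in : `|0 : R| <= T0 / e by rewrite normr0.
have D0 : 0 <= D by apply: le_trans (hD 0%N); rewrite mulr_ge0 // addr_ge0 // sqr_ge0.
have et2 : eta ^+ 2 <= (e + eta) ^+ 2 by rewrite ler_pXn2r ?nnegrE //; lra.
have s2 := sqr_ge0 (e + eta).
have S0 : 0 <= Sc / T0 * (e * (e + eta) ^+ 2).
  by apply: mulr_ge0; [apply: divr_ge0 => //; exact: ltW|exact: mulr_ge0].
(* This bound may blow up as e tends to 0. It provides the finiteness required by the energy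
   estimate and leaves no trace in its conclusion. *)
have bM N' (u : R) : `|u| <= T0 / e -> zsum N' (fun j => Eq j u ^+ 2 + Ep j u ^+ 2) <=
    2 * M + 2 * ((2 * (Zc * eta ^+ 2) + 2 * Zc) / e).
  move=> hu; rewrite -(ler_pM2l e0).
  have h1 : e * zsum N' (fun j => Eq j u ^+ 2 + Ep j u ^+ 2) <=
      2 * (e * zsum N' (fun j => q j u ^+ 2 + p j u ^+ 2)) +
      2 * (e * zsum N' (fun j => Wq j u ^+ 2 + Wp j u ^+ 2)).
    apply: ler_zsum_twice => // j; rewrite /Eq /Ep !mulN1r.
    by move: (sq2 (q j u) (Wq j u)) (sq2 (p j u) (Wp j u)); clear; lra.
  have h2 : e * zsum N' (fun j => Wq j u ^+ 2 + Wp j u ^+ 2) <=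
      2 * (Zc * eta ^+ 2) + 2 * Zc.
    apply: (@le_trans _ _ (2 * (e * zsum N' (fun j => (Wq j u - two_waves_q f g s e j u) ^+ 2 +
       (Wp j u - two_waves_p f g kt s e j u) ^+ 2)) +
       2 * (e * zsum N' (fun j => two_waves_q f g s e j u ^+ 2 + two_waves_p f g kt s e j u ^+ 2)))).
      apply: ler_zsum_twice => // j.
      have g1' := sq2D (Wq j u - two_waves_q f g s e j u) (two_waves_q f g s e j u).
      have g2' := sq2D (Wp j u - two_waves_p f g kt s e j u) (two_waves_p f g kt s e j u).
      by move: g1' g2'; rewrite !subrK; clear; lra.
    have c1 := corr u hu N'; have c2 := bounded u hu N'.
    by apply: lerD; rewrite ler_pM2l.
  have h3 : e * zsum N' (fun j => q j u ^+ 2 + p j u ^+ 2) <= e * M.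
    by rewrite ler_wpM2l //; exact: hM.
  rewrite mulrDr [e * (2 * M)]mulrCA [e * (2 * (_ / e))]mulrCA [e * (_ / e)]mulrC divfK ?gt_eqF //.
  by apply: le_trans h1 _; apply: lerD; rewrite ler_pM2l.
have E0b N' : zsum N' (energy kap mu Eq Ep 0) <= hi * ((2 * D + 2 * (Zc * eta ^+ 2)) / e).
  apply: (@le_trans _ _ (zsum N' (fun j => hi * (Eq j 0 ^+ 2 + Ep j 0 ^+ 2)))).
    by apply: ler_zsum => j _; apply: energy_le.
  rewrite zsumZ ler_wpM2l ?(ltW hi0) // ler_pdivlMr // mulrC.
  by apply: le_trans (EX 0 N') _; apply: lerD; rewrite ler_pM2l //; exact: corr.
(* The rate is taken to be e: over times |t| <= T0 / e the exponential stays below exp(T0), and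
   residuals of total square e (e + eta)^2 contribute, after multiplication by e, a term of order (e
   + eta)^2. *)
have G := energy_gronwall_sym lo0 hk hm fE e0 S0 (fun N' u hu => bM N' u hu)
   (fun N' u hu => resid u hu N') E0b N tT.
have et : e * `|t| <= T0 by rewrite mulrC -ler_pdivlMr.
have lE : e * zsum N (fun j => Eq j t ^+ 2 + Ep j t ^+ 2) <=
    lo^-1 * (X0 * (hi * (2 * D + 2 * (Zc * eta ^+ 2)) + Sc * (e + eta) ^+ 2)).
  rewrite ler_pdivlMl //.
  apply: (@le_trans _ _ (e * zsum N (energy kap mu Eq Ep t))).
    rewrite mulrCA ler_wpM2l // -zsumZ; apply: ler_zsum => j _; exact: energy_ge.
  apply: le_trans (ler_wpM2l e0' G) _.
  rewrite mulrCA; apply: ler_pM.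
  - exact: expR_ge0.
  - apply: mulr_ge0 => //; apply: addr_ge0.
      by apply: mulr_ge0; [exact: ltW|apply: divr_ge0 => //; have := mulr_ge0 Zc0 (sqr_ge0 eta); lra].
    by apply: mulr_ge0 => //; exact: divr_ge0.
  - by rewrite ler_expR.
  have -> : e * (hi * ((2 * D + 2 * (Zc * eta ^+ 2)) / e) +
      Sc / T0 * (e * (e + eta) ^+ 2) / e * `|t|) =
      hi * (2 * D + 2 * (Zc * eta ^+ 2)) + (e * `|t|) * (Sc / T0 * (e + eta) ^+ 2).
    by field; rewrite !gt_eqF.
  rewrite lerD2l; apply: (@le_trans _ _ (T0 * (Sc / T0 * (e + eta) ^+ 2))).
    rewrite ler_wpM2r //; apply: mulr_ge0 => //; apply: divr_ge0 => //; exact: ltW.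
  by rewrite mulrA [T0 * _]mulrC divfK ?gt_eqF.
apply: le_trans (XE t N) _.
have cr := corr t tT N.
set Y := e * _ in lE *; set Z := e * _ in cr *.
have z1 : Zc * eta ^+ 2 <= Zc * (e + eta) ^+ 2 by exact: ler_wpM2l.
have y1 : lo^-1 * (X0 * (hi * (2 * D + 2 * (Zc * eta ^+ 2)) + Sc * (e + eta) ^+ 2)) <=
   2 * (lo^-1 * (X0 * hi)) * D + lo^-1 * (X0 * (2 * hi + 2 * hi * Zc + Sc)) * (e + eta) ^+ 2.
  have z2 : lo^-1 * (X0 * (hi * (Zc * eta ^+ 2))) <= lo^-1 * (X0 * (hi * (Zc * (e + eta) ^+ 2))).
    by rewrite ler_wpM2l // ler_wpM2l // ler_wpM2l // ltW.
  have z3 : 0 <= lo^-1 * (X0 * (hi * (e + eta) ^+ 2)).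
    by do 2 (apply: mulr_ge0 => //); apply: mulr_ge0 => //; exact: ltW.
  by move: z2 z3; clear; move: (lo^-1) X0 Zc Sc ((e + eta) ^+ 2) (eta ^+ 2) => l X' Z' S' x y; lra.
rewrite /C -/X0; move: y1 z1 cr lE; clear.
move: (lo^-1 * (X0 * (2 * hi + 2 * hi * Zc + Sc))) (lo^-1 * (X0 * hi)) => U W.
by move: Zc Z Y ((e + eta) ^+ 2) (eta ^+ 2) (lo^-1 * _) => Z' Z2 Y x y v; lra.
Qed.

End HomogenizationError.

(** * Correctors and passage to the limit *)

Section Correctors.
Variable R : realType.
Implicit Types (x c : int -> R).

(** The discrete primitive that vanishes at 0: on each half-line it is, up to sign, a partial sum to
    which the law of large numbers applies. *)
Definition corrector x (j : int) : R :=
  match j with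
  | Posz n => \sum_(i < n) x i%:Z
  | Negz n => - \sum_(i < n.+1) x (Negz i)
  end.

Lemma correctorE x j : corrector x (j + 1) - corrector x j = x j.
Proof.
case: j => [n|[|n]].
- by rewrite -PoszD addn1 /= big_ord_recr /= addrAC subrr add0r.
- by rewrite /= big_ord0 big_ord1 opprK add0r.
- have -> : Negz n.+1 + 1 = Negz n by rewrite !NegzE; lia.
  by rewrite /corrector [X in _ - - X]big_ord_recr /=; ring.
Qed.

Definition sublinear c := forall d : R, 0 < d -> exists C : R, forall j, `|c j| <= d * `|j%:~R| + C.

Lemma corrector_sublinear x :
  (forall d : R, 0 < d -> exists C : R, forall n, `|\sum_(i < n) x i%:Z| <= d * n%:R + C) ->
  (forall d : R, 0 < d -> exists C : R, forall n, `|\sum_(i < n) x (Negz i)| <= d * n%:R + C) ->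
  sublinear (corrector x).
Proof.
move=> hp hn d d0; have [C1 h1] := hp d d0; have [C2 h2] := hn d d0.
exists (Num.max C1 C2) => -[n|n].
  by rewrite -pmulrn normr_nat; apply: le_trans (h1 n) _; rewrite lerD2l le_max lexx.
rewrite /corrector normrN NegzE mulrNz normrN -pmulrn normr_nat.
by apply: le_trans (h2 n.+1) _; rewrite lerD2l le_max lexx orbT.
Qed.

Lemma sublinear_shift c : sublinear c -> sublinear (fun j => c (j + 1)).
Proof.
move=> hc d d0; have [C hC] := hc d d0; exists (d + C) => j.
apply: le_trans (hC (j + 1)) _; rewrite addrA lerD2r.
have h : `|(j + 1)%:~R| <= `|j%:~R| + 1 :> R.
  by rewrite intrD; apply: le_trans (ler_normD _ _) _; rewrite normr1.
by apply: le_trans (ler_wpM2l (ltW d0) h) _; rewrite mulrDr mulr1.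
Qed.

(** For |e j| <= B, sublinearity gives |e c_j| <= d B + e C. The slope d is chosen to take half of
    [eta], uniformly in e; the constant C, which depends on d, is then absorbed by taking e
    small. *)
Lemma sublinear_small c (B eta : R) : sublinear c -> 0 <= B -> 0 < eta ->
  exists2 e0 : R, 0 < e0 & forall e, 0 < e -> e <= e0 -> forall j, `|e * j%:~R| <= B -> `|e * c j| <= eta.
Proof.
move=> hc B0 eta0.
have d0 : 0 < eta / (2 * (B + 1)) by rewrite divr_gt0 // mulr_gt0 //; lra.
have [C hC] := hc _ d0.
exists (eta / (2 * (`|C| + 1))) => [|e e0 ee j hj].
  by rewrite divr_gt0 // mulr_gt0 //; have := normr_ge0 C; lra.
rewrite normrM (gtr0_norm e0); apply: le_trans (ler_wpM2l (ltW e0) (hC j)) _.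
have h1 : eta / (2 * (B + 1)) * (e * `|j%:~R|) <= eta / 2.
  apply: (@le_trans _ _ (eta / (2 * (B + 1)) * (B + 1))).
    rewrite ler_pM2l //; move: hj; rewrite normrM (gtr0_norm e0); lra.
  by rewrite le_eqVlt; apply/orP; left; apply/eqP; field; rewrite gt_eqF //; lra.
have h2 : e * C <= eta / 2.
  apply: (@le_trans _ _ (e * (`|C| + 1))).
    by rewrite ler_wpM2l ?(ltW e0) //; have := ler_norm C; lra.
  apply: le_trans (_ : eta / (2 * (`|C| + 1)) * (`|C| + 1) <= _).
    by rewrite ler_wpM2r //; have := normr_ge0 C; lra.
  rewrite le_eqVlt; apply/orP; left; apply/eqP; field.
  by rewrite gt_eqF //; have := normr_ge0 C; lra.
by rewrite mulrDr mulrCA; lra.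
Qed.

End Correctors.

(** * Interpolated lattice functions against continuous profiles *)

Section Comparison.
Variable R : realType.
Local Notation mu := (@lebesgue_measure R).

Lemma sqmod_sub (z : R[i]) (x y : R) :
  sqmod (z - x%:C) <= 2 * sqmod (z - y%:C) + 2 * (y - x) ^+ 2.
Proof.
case: z => a b; rewrite /sqmod /=.
by rewrite subr0; have := sqr_ge0 (a - y - (y - x)); have := sqr_ge0 b; nra.
Qed.

(** Three comparisons: the interpolation with the step function of the samples of h, that step
    function with h, and h with H0. The weights 2, 4 and 4 of their squares, together with supports
    of length at most 2 A + 3 and 2 A + 2, produce 8, 16 A + 20 and 4. *)
Lemma interpolation_compare (u : int -> R) (h H0 : R -> R) (M A L e eta theta : R) :
  0 < e <= 1 -> ell2_bnd u M -> 0 <= A -> (forall x, A < `|x| -> h x = 0) ->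
  (forall x y, `|h x - h y| <= L * `|x - y|) -> continuous h -> continuous H0 ->
  (forall N, e * zsum N (fun j => (u j - h (e * j%:~R)) ^+ 2) <= eta) ->
  (\int[mu]_x ((h x - H0 x) ^+ 2)%:E <= theta%:E)%E ->
  (\int[mu]_x (sqmod (interpolation u (x / e) - (H0 x)%:C))%:E <=
    (8 * eta + (16 * A + 20) * L ^+ 2 * e ^+ 2 + 4 * theta)%:E)%E.
Proof.
move=> /andP[e0 e1] hu A0 hA hL ch cH heta htheta.
have L0 : 0 <= L by have := hL 1 0; rewrite subr0 normr1 mulr1; exact: le_trans.
pose hj (j : int) := h (e * j%:~R).
pose Nh := (Num.truncn (A / e)).+1.
have hout j : (Nh < `|j|)%N -> hj j = 0.
  move=> nj; apply: hA; rewrite normrM (gtr0_norm e0) mulrC -ltr_pdivrMr //.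
  have h1 : A / e < Nh%:R by apply: truncnS_gt.
  apply: lt_le_trans h1 _.
  by rewrite -intr_norm -[`|j|%R]abszE -pmulrn ler_nat ltnW.
have S1 : ell2_bnd (fun j => u j - hj j) (eta / e).
  by move=> N; rewrite ler_pdivlMr // mulrC.
have S2 : ell2_bnd (deltap hj) ((2 * (A + 1) + e) * (L * e) ^+ 2 / e).
  move=> N; rewrite ler_pdivlMr // mulrC; apply: zsum_count => //.
  - by lra.
  - exact: sqr_ge0.
  - by move=> j; exact: sqr_ge0.
  - move=> j; rewrite /deltap /hj; apply: sqr_norm_le; apply: le_trans (hL _ _) _.
    by rewrite intrD mulrDr mulr1 addrAC subrr add0r (gtr0_norm e0).
  - move=> j hj'; rewrite /deltap /hj intrD mulrDr mulr1 !hA ?subrr ?expr0n //; first by lra.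
    have := lerB_dist (e * j%:~R) (- e); rewrite opprK normrN (gtr0_norm e0); lra.
have E1 := interpolation_estimate e0 hu hout S1 S2.
have [mRe mIm] := measurable_interpolation hu.
have me : measurable_fun [set: R] (fun x : R => x / e) by exact: measurable_funM.
have mfl : measurable_fun [set: R] (fun x : R => hj (Num.floor (x / e))).
  exact: (measurableT_comp (measurable_step hout) me).
have mh : measurable_fun [set: R] h by exact: continuous_measurable_fun.
have mH : measurable_fun [set: R] H0 by exact: continuous_measurable_fun.
have msq (k : R -> R) : measurable_fun [set: R] k ->
    measurable_fun [set: R] (fun x => (sqmod (interpolation u (x / e) - (k x)%:C))%:E).
  move=> mk; apply/measurable_EFinP; rewrite /sqmod.
  rewrite (_ : (fun x => _) = (fun x => (complex.Re (interpolation u (x / e)) - k x) ^+ 2 +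
     (complex.Im (interpolation u (x / e))) ^+ 2)); last first.
    apply/funext => x; case: (interpolation u (x / e)) => a b.
    by rewrite /= subr0.
  apply: measurable_funD; apply: measurable_funX.
    by apply: measurable_funB => //; exact: (measurableT_comp mRe me).
  exact: (measurableT_comp mIm me).
have sq0 z : (0 <= (sqmod z)%:E :> \bar R)%E by rewrite lee_fin sqmod_ge0.
have mstep : measurable_fun [set: R] (fun x => ((hj (Num.floor (x / e)) - h x) ^+ 2)%:E).
  by apply/measurable_EFinP; apply: measurable_funX; exact: measurable_funB.
have mlast : measurable_fun [set: R] (fun x => ((h x - H0 x) ^+ 2)%:E).
  by apply/measurable_EFinP; apply: measurable_funX; exact: measurable_funB.
have E2 : (\int[mu]_x ((hj (Num.floor (x / e)) - h x) ^+ 2)%:E <=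
    ((L * e) ^+ 2 * (2 * (A + 1)))%:E)%E.
  apply: (@le_trans _ _ (\int[mu]_(x in `[(- (A + 1))%R, (A + 1)%R]) ((L * e) ^+ 2)%:E)%E); last first.
    rewrite integral_cst_segment; last by lra.
    by rewrite lee_fin le_eqVlt; apply/orP; left; apply/eqP; ring.
  have fl x : e * (Num.floor (x / e))%:~R <= x /\ x < e * (Num.floor (x / e))%:~R + e.
    have /andP[f1 f2] := floor_itv (x / e); move: f2; rewrite intrD => f2.
    split; first by rewrite mulrC -ler_pdivlMr.
    by rewrite -[X in _ + X]mulr1 -mulrDr mulrC -ltr_pdivrMr.
  rewrite (@integral_support R `[- (A + 1), A + 1]%classic); last first.
    move=> x nx; have hx : A + 1 < `|x|.
      by rewrite ltNge; apply/negP => h1; apply: nx; rewrite /= in_itv /= -ler_norml.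
    have [f1 f2] := fl x.
    have fx : A < `|e * (Num.floor (x / e))%:~R|.
      have : `|e * (Num.floor (x / e))%:~R - x| <= e by rewrite ler_norml; lra.
      have := lerB_dist x (e * (Num.floor (x / e))%:~R); rewrite distrC; lra.
    by rewrite /hj !hA ?subrr ?expr0n //; lra.
  apply: ge0_le_integral => //.
  - by move=> x _; rewrite lee_fin sqr_ge0.
  - exact: measurable_funTS.
  - move=> x _; rewrite lee_fin; apply: sqr_norm_le; apply: le_trans (hL _ _) _.
    rewrite ler_wpM2l // ler_norml; have [f1 f2] := fl x; lra.
apply: (@le_trans _ _ (\int[mu]_x (2%:E * (sqmod (interpolation u (x / e) - (hj (Num.floor (x / e)))%:C))%:E
   + (4%:E * ((hj (Num.floor (x / e)) - h x) ^+ 2)%:E + 4%:E * ((h x - H0 x) ^+ 2)%:E)))%E).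
  apply: ge0_le_integral => //.
  - exact: msq.
  - apply: emeasurable_funD; first by apply: measurable_funeM; exact: msq.
    by apply: emeasurable_funD; exact: measurable_funeM.
  - move=> x _; rewrite -!EFinM -!EFinD lee_fin.
    apply: le_trans (sqmod_sub _ _ (hj (Num.floor (x / e)))) _.
    rewrite lerD2l; move: (hj _) (h x) (H0 x) => a b c.
    by have := sqr_ge0 (a - b - (b - c)); nra.
rewrite ge0_integralD //; first last.
- by apply: emeasurable_funD; exact: measurable_funeM.
- by move=> x _; rewrite -!EFinM -EFinD lee_fin addr_ge0 // mulr_ge0 ?sqr_ge0.
- by apply: measurable_funeM; exact: msq.
- by move=> x _; rewrite mule_ge0 // lee_fin.
rewrite ge0_integralD //; first last.
- exact: measurable_funeM.
- by move=> x _; rewrite -EFinM lee_fin mulr_ge0 ?sqr_ge0.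
- exact: measurable_funeM.
- by move=> x _; rewrite -EFinM lee_fin mulr_ge0 ?sqr_ge0.
have p0 (k : R -> R) x : [set: R] x -> (0 <= ((k x) ^+ 2)%:E :> \bar R)%E by rewrite lee_fin sqr_ge0.
rewrite ge0_integralZl //; last exact: msq.
rewrite ge0_integralZl //; last by move=> x _; rewrite lee_fin sqr_ge0.
rewrite ge0_integralZl //; last by move=> x _; rewrite lee_fin sqr_ge0.
apply: (@le_trans _ _ (2%:E * (e * (4 * (eta / e) + 2 * ((2 * (A + 1) + e) * (L * e) ^+ 2 / e)))%:E +
  (4%:E * ((L * e) ^+ 2 * (2 * (A + 1)))%:E + 4%:E * theta%:E))%E).
  apply: leeD; first by rewrite lee_wpmul2l // lee_fin.
  by apply: leeD; rewrite lee_wpmul2l // lee_fin.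
rewrite -!EFinM -!EFinD lee_fin.
have -> : e * (4 * (eta / e) + 2 * ((2 * (A + 1) + e) * (L * e) ^+ 2 / e)) =
  4 * eta + 2 * ((2 * (A + 1) + e) * (L * e) ^+ 2) by field; rewrite gt_eqF.
have h1 : (2 * (A + 1) + e) * (L * e) ^+ 2 <= (2 * (A + 1) + 1) * (L * e) ^+ 2.
  by rewrite ler_wpM2r ?sqr_ge0 // lerD2l.
by move: h1; rewrite exprMn; clear; lra.
Qed.

End Comparison.

(** * Passage to the limit for fixed coefficients *)

Section Limit.
Variable R : realType.
Local Notation mu := (@lebesgue_measure R).

Lemma L2_shift_lin (F G : R -> R) (c1 c2 a b S1 S2 : R) :
  measurable_fun [set: R] F -> measurable_fun [set: R] G ->
  (\int[mu]_x (F x ^+ 2)%:E <= S1%:E)%E -> (\int[mu]_x (G x ^+ 2)%:E <= S2%:E)%E ->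
  (\int[mu]_x ((c1 * F (x + a) + c2 * G (x + b)) ^+ 2)%:E <=
    (2 * c1 ^+ 2 * S1 + 2 * c2 ^+ 2 * S2)%:E)%E.
Proof.
move=> mF mG hF hG.
have msh c : measurable_fun [set: R] (fun x : R => x + c) by exact: measurable_funD.
have mFa : measurable_fun [set: R] (fun x => F (x + a)) by exact: (measurableT_comp mF (msh a)).
have mGb : measurable_fun [set: R] (fun x => G (x + b)) by exact: (measurableT_comp mG (msh b)).
have m2 (k : R -> R) : measurable_fun [set: R] k -> measurable_fun [set: R] (fun x => (k x ^+ 2)%:E).
  by move=> mk; apply/measurable_EFinP; exact: measurable_funX.
have p2 (k : R -> R) x : (0 <= (k x ^+ 2)%:E :> \bar R)%E by rewrite lee_fin sqr_ge0.
have cc (c : R) : (0 <= (2 * c ^+ 2)%:E :> \bar R)%E by rewrite lee_fin mulr_ge0 // sqr_ge0.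
apply: (@le_trans _ _ (\int[mu]_x ((2 * c1 ^+ 2)%:E * (F (x + a) ^+ 2)%:E +
    (2 * c2 ^+ 2)%:E * (G (x + b) ^+ 2)%:E))%E).
  apply: ge0_le_integral => //.
  - by apply: (m2 (fun x => c1 * F (x + a) + c2 * G (x + b))); apply: measurable_funD; exact: measurable_funM.
  - by apply: emeasurable_funD; apply: measurable_funeM; [exact: (m2 (fun x => F (x + a)))|exact: (m2 (fun x => G (x + b)))].
  - move=> x _; rewrite -!EFinM -EFinD lee_fin; move: (F _) (G _) => u v.
    by have := sqr_ge0 (c1 * u - c2 * v); nra.
have mFe := m2 _ mFa; have mGe := m2 _ mGb.
rewrite ge0_integralD //; first last.
- exact: measurable_funeM.
- by move=> x _; apply: mule_ge0 => //; exact: (p2 (fun x => G (x + b))).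
- exact: measurable_funeM.
- by move=> x _; apply: mule_ge0 => //; exact: (p2 (fun x => F (x + a))).
rewrite ge0_integralZl //.
rewrite ge0_integralZl //.
rewrite -(ge0_integral_shift a (m2 _ mF) (p2 F)) -(ge0_integral_shift b (m2 _ mG) (p2 G)).
by rewrite EFinD !(EFinM (2 * _)) leeD // lee_wpmul2l.
Qed.

Lemma parallelogram_le (z k u v : R) : z ^+ 2 <= k - 1 ->
  (u + v) ^+ 2 + (z * (u - v)) ^+ 2 <= 2 * k * (u ^+ 2 + v ^+ 2).
Proof.
move=> hz; have k1 : 0 <= k - 1 by exact: le_trans (sqr_ge0 _) hz.
have h1 := ler_wpM2r (sqr_ge0 (u - v)) hz; have h2 := mulr_ge0 k1 (sqr_ge0 (u + v)).
by rewrite exprMn; apply: le_trans (lerD (lexx _) h1) _; move: h2 (sqr_ge0 (u - v)); clear; lra.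
Qed.

Lemma c2_bump_lipschitz (f f1 f2 : R -> R) (A L : R) : c2_bump f f1 f2 A L ->
  forall x y, `|f x - f y| <= L * `|x - y|.
Proof. by move=> [h1 _ _ bd]; apply: lipschitz_of_derive h1 _ => x; case: (bd x). Qed.

(** One [e0] serves all solutions and all tau, as the supremum over tau requires. Three quarters of
    the accuracy d are spent: on the approximation of the profiles ([delK]), on the correctors
    ([etaC]) and on the terms of order e^2 ([eK]). *)
Lemma homogenization_limit (lo hi kt mb T0 : R) (kap mu' chi zeta : int -> R) (Phi Psi : R -> R)
    (Q0 P0 : R -> R -> R) (V W S1 S2 : R) :
  0 < lo -> (forall j, lo <= kap j <= hi) -> (forall j, lo <= mu' j <= hi) ->
  0 < kt -> 0 < mb -> 0 < T0 ->
  (forall j, chi (j + 1) - chi j = kt * kap j - 1) ->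
  (forall j, zeta j - zeta (j - 1) = mu' j / mb - 1) -> sublinear chi -> sublinear zeta ->
  continuous Phi -> continuous Psi -> quadratic_modulus Phi V -> quadratic_modulus Psi W ->
  (\int[mu]_x (Phi x ^+ 2)%:E <= S1%:E)%E -> (\int[mu]_x (Psi x ^+ 2)%:E <= S2%:E)%E ->
  wave_solution kt mb Phi Psi Q0 P0 ->
  forall d : R, 0 < d -> exists2 e0 : R, 0 < e0 & forall e, 0 < e -> e <= e0 ->
    forall q p, free_lattice kap mu' q p -> (forall t, exists M, ell2_le q p t M) ->
    (forall j, q j 0 = Phi (e * j%:~R) /\ p j 0 = Psi (e * j%:~R)) ->
    forall tau, `|tau| <= T0 ->
    (\int[mu]_x (sqmod (interpolation (q ^~ (tau / e)) (x / e) - (Q0 x tau)%:C))%:E <= d%:E)%E /\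
    (\int[mu]_x (sqmod (interpolation (p ^~ (tau / e)) (x / e) - (P0 x tau)%:C))%:E <= d%:E)%E.
Proof.
move=> lo0 hk hm kt0 mb0 T00 hchi hzeta schi szeta cPhi cPsi qPhi qPsi iPhi iPsi wav d d0.
have lohi : lo <= hi by have /andP[h1 h2] := hk 0; exact: le_trans h2.
pose s := Num.sqrt (kt / mb).
have s0 : 0 < s by rewrite sqrtr_gt0 divr_gt0.
have ss : s * s = kt / mb by rewrite -expr2 sqr_sqrtr // divr_ge0 // ltW.
have sn0 : s != 0 by rewrite gt_eqF.
have kn0 : kt != 0 by rewrite gt_eqF.
pose al := kt / s.
have kE : kt = s * al by rewrite /al mulrC divfK.
have alE : al * mb^-1 = s by rewrite /al mulrAC -ss mulfK.
have sE : s * (s / kt) = mb^-1 by rewrite mulrA ss mulrAC mulfV // mul1r.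
have al_inv : s / kt * al = 1 by rewrite /al; field; rewrite sn0 kn0.
(* With al = kt / s, these are half the Riemann invariants of the data: [A] is carried along x + s
   tau and [B] along x - s tau. *)
pose A x := 2^-1 * Phi x + al / 2 * Psi x; pose B x := 2^-1 * Phi x + - (al / 2) * Psi x.
have cA : continuous A.
  by move=> x; apply: cvgD; apply: cvgM; [exact: cvg_cst|exact: cPhi|exact: cvg_cst|exact: cPsi].
have cB : continuous B.
  by move=> x; apply: cvgD; apply: cvgM; [exact: cvg_cst|exact: cPhi|exact: cvg_cst|exact: cPsi].
have QE x tau : Q0 x tau = A (x + s * tau) + B (x + - s * tau) /\
    P0 x tau = s / kt * (A (x + s * tau) - B (x + - s * tau)).
  have h1 := wave_characteristic wav kE alE x tau.
  have kE' : kt = - s * - al by rewrite mulrNN.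
  have alE' : - al * mb^-1 = - s by rewrite mulNr alE.
  have h2 := wave_characteristic wav kE' alE' x tau.
  split; first by rewrite /A /B; lra.
  have h3 : al * P0 x tau = A (x + s * tau) - B (x + - s * tau) by rewrite /A /B; lra.
  by rewrite -h3 mulrA al_inv mul1r.
have mPhi : measurable_fun [set: R] Phi by exact: continuous_measurable_fun.
have mPsi : measurable_fun [set: R] Psi by exact: continuous_measurable_fun.
have mA : measurable_fun [set: R] A by exact: continuous_measurable_fun.
have mB : measurable_fun [set: R] B by exact: continuous_measurable_fun.
have iL c1 c2 : (\int[mu]_x ((c1 * Phi x + c2 * Psi x) ^+ 2)%:E <=
    (2 * c1 ^+ 2 * S1 + 2 * c2 ^+ 2 * S2)%:E)%E.
  have := @L2_shift_lin Phi Psi c1 c2 0 0 S1 S2 mPhi mPsi iPhi iPsi.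
  by under eq_integral do rewrite !addr0.
have qA := quadratic_modulus_lin 2^-1 (al / 2) qPhi qPsi; rewrite -/A in qA.
have qB := quadratic_modulus_lin 2^-1 (- (al / 2)) qPhi qPsi; rewrite -/B in qB.
pose kk := 1 + s / kt.
have skp : 0 < s / kt by rewrite divr_gt0.
have kk0 : 0 < kk by rewrite /kk; lra.
pose C1 := 4 * (lo^-1 * (expR T0 * hi)).
have C10 : 0 <= C1.
  rewrite /C1; apply: mulr_ge0 => //; apply: mulr_ge0; first by rewrite invr_ge0 ltW.
  apply: mulr_ge0; [exact: expR_ge0|apply: le_trans lohi; exact: ltW].
(* The coefficient of [del] in the final bound: 64 = 8 * 2 * 4 comes from sampling the error of the
   profiles, amplified by [C1], and 16 from the distance in L^2 between the profiles and the limit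
   wave. *)
pose Kd := 64 * C1 * kk ^+ 2 + 16 * kk ^+ 2.
have Kd0 : 0 <= Kd by have := mulr_ge0 C10 (sqr_ge0 kk); have := sqr_ge0 kk; rewrite /Kd; lra.
pose del := d / (4 * (Kd + 1)).
have del0 : 0 < del by rewrite divr_gt0 // mulr_gt0 //; lra.
have delK : Kd * del <= d / 4.
  have -> : d / 4 = (Kd + 1) * del by rewrite /del; field; rewrite gt_eqF //; lra.
  by rewrite ler_wpM2r ?(ltW del0) //; lra.
have [f [A1 [sf A10 fA dA]]] := smooth_approximation cA qA (iL _ _) del0.
have [g [A2 [sg A20 gA dB]]] := smooth_approximation cB qB (iL _ _) del0.
have [f1 [f2 [L1 [L10 bf]]]] := smooth_c2_bump sf A10 fA.
have [g1 [g2 [L2 [L20 bg]]]] := smooth_c2_bump sg A20 gA.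
pose AA := A1 + A2; pose L := L1 + L2.
have AA0 : 0 < AA by rewrite /AA; lra.
have L0 : 0 <= L by rewrite /L; lra.
have {}bf : c2_bump f f1 f2 AA L by apply: c2_bump_mono bf; rewrite ?lerDl // ltW.
have {}bg : c2_bump g g1 g2 AA L by apply: c2_bump_mono bg; rewrite ?lerDr // ltW.
have lf := c2_bump_lipschitz bf; have lg := c2_bump_lipschitz bg.
have f0 x : AA < `|x| -> f x = 0 by case: bf => _ _ out _ /out[].
have g0 x : AA < `|x| -> g x = 0 by case: bg => _ _ out _ /out[].
have cf : continuous f by case: bf => hf _ _ _ x; exact: der_continuous (hf x).
have cg : continuous g by case: bg => hg _ _ _ x; exact: der_continuous (hg x).
have qAf := quadratic_modulus_lin 1 (-1) qA (quadratic_modulus_lipschitz (ltW AA0) f0 lf).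
have qBg := quadratic_modulus_lin 1 (-1) qB (quadratic_modulus_lipschitz (ltW AA0) g0 lg).
have VA0 := quadratic_modulus_ge0 qAf; have VB0 := quadratic_modulus_ge0 qBg.
move: qAf qBg VA0 VB0; set VA := _ + _; set VB := 2 * _ * _ + _ => qAf qBg VA0 VB0.
have [C [C0 HE]] := homogenization_error lo0 lohi kt0 mb0 s0 sE AA0 L0 T00.
pose AH := AA + s * T0; pose LH := 2 * L * kk.
have AH0 : 0 <= AH by have := mulr_gt0 s0 T00; rewrite /AH; lra.
pose K2 := 32 * C1 * kk ^+ 2 * (VA + VB) + (16 * AH + 20) * LH ^+ 2.
have K20 : 0 <= K2.
  apply: addr_ge0.
    apply: mulr_ge0; last exact: addr_ge0.
    by apply: mulr_ge0; [exact: mulr_ge0|exact: sqr_ge0].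
  by apply: mulr_ge0; [clear -AH0; lra|exact: sqr_ge0].
(* Once e <= eta <= 1, C (e + eta)^2 <= 4 C eta, and the factor 8 of the comparison makes 32. *)
pose eta := Num.min 1 (d / (4 * (32 * C + 1))).
have eta0 : 0 < eta by rewrite lt_min ltr01 /= divr_gt0 // mulr_gt0 // ltr_wpDl // mulr_ge0.
have eta1 : eta <= 1 by rewrite ge_min lexx.
have etaC : 32 * C * eta <= d / 4.
  apply: (@le_trans _ _ ((32 * C + 1) * (d / (4 * (32 * C + 1))))); last first.
    rewrite le_eqVlt; apply/orP; left; apply/eqP; field.
    by rewrite gt_eqF //; clear -C0; lra.
  apply: ler_pM; [by rewrite mulr_ge0|exact: ltW|by rewrite lerDl|by rewrite ge_min lexx orbT].
clearbody eta.
have wr0 : 0 <= wave_range s AA T0 by rewrite /wave_range; move: (mulr_gt0 s0 T00) AA0; clear; lra.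
have [e1 e10 small1] := sublinear_small schi wr0 eta0.
have [e2 e20 small2] := sublinear_small szeta wr0 eta0.
exists (Num.min (Num.min e1 e2) (Num.min eta (d / (4 * (K2 + 1))))).
  by rewrite !lt_min e10 e20 eta0 /= divr_gt0 // mulr_gt0 // ltr_wpDl.
move=> e ep; rewrite !le_min => /andP[/andP[ee1 ee2] /andP[ee3 ee4]] q p fr el init tau htau.
have e1' : e <= 1 by exact: le_trans eta1.
have eK : K2 * e ^+ 2 <= d / 4.
  apply: (@le_trans _ _ ((K2 + 1) * (d / (4 * (K2 + 1))))); last first.
    rewrite le_eqVlt; apply/orP; left; apply/eqP; field.
    by rewrite gt_eqF // ltr_wpDl.
  apply: ler_pM; [exact: K20|exact: sqr_ge0|by rewrite lerDl|].
  by apply: le_trans ee4; rewrite expr2 ler_piMr // ltW.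
have e01 : 0 < e <= 1 by rewrite ep e1'.
have en0 : e != 0 by rewrite gt_eqF.
pose D := 2 * kk ^+ 2 * (4 * del + 2 * e ^+ 2 * (VA + VB)).
have dAf : (\int[mu]_x ((1 * A x + -1 * f x) ^+ 2)%:E <= del%:E)%E.
  by under eq_integral do rewrite mul1r mulN1r.
have dBg : (\int[mu]_x ((1 * B x + -1 * g x) ^+ 2)%:E <= del%:E)%E.
  by under eq_integral do rewrite mul1r mulN1r.
have mf : measurable_fun [set: R] f by exact: continuous_measurable_fun.
have mg : measurable_fun [set: R] g by exact: continuous_measurable_fun.
have mAf : measurable_fun [set: R] (fun x => 1 * A x + -1 * f x).
  by apply: measurable_funD; exact: measurable_funM.
have mBg : measurable_fun [set: R] (fun x => 1 * B x + -1 * g x).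
  by apply: measurable_funD; exact: measurable_funM.
have sk_kk : (s / kt) ^+ 2 <= kk ^+ 2 - 1 by rewrite /kk sqrrD expr1n mul1r mulr2n; move: (s / kt) skp; clear; move=> z z0; lra.
have phase0 c j : phase e c j 0 = e * j%:~R by rewrite /phase !mulr0 addr0.
have hD N : e * zsum N (fun j => (q j 0 - two_waves_q f g s e j 0) ^+ 2 +
     (p j 0 - two_waves_p f g kt s e j 0) ^+ 2) <= D.
  have s1 := sampling_bound N mAf qAf dAf e01; have s2 := sampling_bound N mBg qBg dBg e01.
  apply: (@le_trans _ _ (e * zsum N (fun j => 2 * kk ^+ 2 *
     ((1 * A (e * j%:~R) + -1 * f (e * j%:~R)) ^+ 2 + (1 * B (e * j%:~R) + -1 * g (e * j%:~R)) ^+ 2)))).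
    rewrite ler_wpM2l ?(ltW ep) //; apply: ler_zsum => j _; have [-> ->] := init j.
    rewrite /two_waves_q /two_waves_p !phase0; move: (e * j%:~R) => x.
    have -> : Phi x = A x + B x by rewrite /A /B; clear; lra.
    have -> : Psi x = s / kt * (A x - B x).
      rewrite /A /B; have -> : 2^-1 * Phi x + al / 2 * Psi x - (2^-1 * Phi x + - (al / 2) * Psi x) =
        al * Psi x by field.
      by rewrite mulrA al_inv mul1r.
    rewrite !mul1r !mulN1r.
    have -> : A x + B x - (f x + g x) = (A x - f x) + (B x - g x) by ring.
    have -> : s / kt * (A x - B x) - s / kt * (f x - g x) = s / kt * ((A x - f x) - (B x - g x)) by ring.
    exact: parallelogram_le.
  rewrite zsumZ zsumD mulrCA mulrDr /D; apply: ler_wpM2l.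
    by apply: mulr_ge0 => //; exact: sqr_ge0.
  by apply: le_trans (lerD s1 s2) _; clear; lra.
have t_in : `|tau / e| <= T0 / e by rewrite normrM normfV (gtr0_norm ep) ler_pM2r // invr_gt0.
have err N := HE kap mu' chi zeta e eta D f f1 f2 g g1 g2 q p hk hm hchi hzeta ep e1' (ltW eta0)
  (small1 e ep ee1) (small2 e ep ee2) bf bg fr el hD N (tau / e) t_in.
pose E := C1 * D + C * (e + eta) ^+ 2.
have final : 8 * E + (16 * AH + 20) * LH ^+ 2 * e ^+ 2 + 4 * (4 * kk ^+ 2 * del) <= d.
  have h1 : C * (e + eta) ^+ 2 <= C * (4 * eta).
    rewrite ler_wpM2l //; apply: (@le_trans _ _ ((2 * eta) ^+ 2)).
      by apply: sqr_norm_le; rewrite ger0_norm; clear -ep ee3 eta0; lra.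
    have h : eta * eta <= eta by rewrite ler_piMl // ltW.
    by rewrite exprMn !expr2; clear -h; lra.
  have -> : 8 * E + (16 * AH + 20) * LH ^+ 2 * e ^+ 2 + 4 * (4 * kk ^+ 2 * del) =
    Kd * del + K2 * e ^+ 2 + 8 * (C * (e + eta) ^+ 2) by rewrite /E /D /Kd /K2; ring.
  by move: h1 delK eK etaC d0; clear; lra.
have [M hM] := el (tau / e).
have bq : ell2_bnd (q ^~ (tau / e)) M.
  by move=> N; apply: le_trans (hM N); apply: ler_zsum => j _; rewrite lerDl sqr_ge0.
have bp : ell2_bnd (p ^~ (tau / e)) M.
  by move=> N; apply: le_trans (hM N); apply: ler_zsum => j _; rewrite lerDr sqr_ge0.
have phaseE c j : phase e c j (tau / e) = e * j%:~R + c * tau.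
  by rewrite /phase [e * (tau / e)]mulrC divfK.
have shiftc (k : R -> R) c : continuous k -> continuous (fun x : R => k (x + c)).
  move=> ck x; apply: (@continuous_comp _ _ _ (fun x : R => x + c) k); last exact: ck.
  by apply: cvgD; [exact: cvg_id|exact: cvg_cst].
have out (x : R) : AH < `|x| -> f (x + s * tau) = 0 /\ g (x + - s * tau) = 0.
  have hst : `|s * tau| <= s * T0 by rewrite normrM (gtr0_norm s0) ler_pM2l.
  move=> hx; split; [apply: f0|apply: g0].
    by have := lerB_dist x (- (s * tau)); rewrite opprK normrN; move: hx hst; rewrite /AH; clear; lra.
  by have := lerB_dist x (s * tau); rewrite mulNr; move: hx hst; rewrite /AH; clear; lra.
have lip2 (x y : R) : `|f (x + s * tau) - f (y + s * tau)| <= L * `|x - y| /\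
    `|g (x + - s * tau) - g (y + - s * tau)| <= L * `|x - y|.
  have cc (c : R) : x + c - (y + c) = x - y by ring.
  by split; [have := lf (x + s * tau) (y + s * tau)|have := lg (x + - s * tau) (y + - s * tau)];
    rewrite cc.
have Lxy (x y : R) : 0 <= L * `|x - y| by rewrite mulr_ge0.
(* Both components combine the same two profiles, with coefficients (1, 1) for q and (s / kt, - s /
   kt) for p, all bounded by [kk]. *)
have key (u : int -> R) (c1 c2 : R) (H0 : R -> R) : ell2_bnd u M -> `|c1| <= kk -> `|c2| <= kk ->
    (forall x, H0 x = c1 * A (x + s * tau) + c2 * B (x + - s * tau)) ->
    (forall N, e * zsum N (fun j => (u j - (c1 * f (e * j%:~R + s * tau) + c2 * g (e * j%:~R + - s * tau))) ^+ 2) <= E) ->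
    (\int[mu]_x (sqmod (interpolation u (x / e) - (H0 x)%:C))%:E <= d%:E)%E.
  move=> hu hc1 hc2 HE0 hE.
  have le_kk c : `|c| <= kk -> c ^+ 2 <= kk ^+ 2 by exact: sqr_norm_le.
  pose h x := c1 * f (x + s * tau) + c2 * g (x + - s * tau).
  have ch : continuous h.
    move=> x; apply: cvgD; apply: cvgM; try exact: cvg_cst.
      exact: (shiftc f (s * tau) cf).
    exact: (shiftc g (- s * tau) cg).
  have cH : continuous H0.
    rewrite (_ : H0 = (fun x => c1 * A (x + s * tau) + c2 * B (x + - s * tau))); last exact/funext.
    move=> x; apply: cvgD; apply: cvgM; try exact: cvg_cst.
      exact: (shiftc A (s * tau) cA).
    exact: (shiftc B (- s * tau) cB).
  have lh (x y : R) : `|h x - h y| <= LH * `|x - y|.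
    have [l1 l2] := lip2 x y; rewrite /h.
    have -> : c1 * f (x + s * tau) + c2 * g (x + - s * tau) - (c1 * f (y + s * tau) + c2 * g (y + - s * tau)) =
      c1 * (f (x + s * tau) - f (y + s * tau)) + c2 * (g (x + - s * tau) - g (y + - s * tau)) by ring.
    have m1 := ler_pM (normr_ge0 _) (normr_ge0 _) hc1 l1.
    have m2 := ler_pM (normr_ge0 _) (normr_ge0 _) hc2 l2.
    apply: le_trans (ler_normD _ _) _; rewrite !normrM.
    by apply: le_trans (lerD m1 m2) _; rewrite /LH le_eqVlt; apply/orP; left; apply/eqP; ring.
  have h0 (x : R) : AH < `|x| -> h x = 0 by move=> /out[h1 h2]; rewrite /h h1 h2 !mulr0 addr0.
  have hth : (\int[mu]_x ((h x - H0 x) ^+ 2)%:E <= (4 * kk ^+ 2 * del)%:E)%E.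
    have T := @L2_shift_lin _ _ (- c1) (- c2) (s * tau) (- s * tau) _ _ mAf mBg dAf dBg.
    have Eh x : h x - H0 x = - c1 * (1 * A (x + s * tau) + -1 * f (x + s * tau)) +
        - c2 * (1 * B (x + - s * tau) + -1 * g (x + - s * tau)) by rewrite /h HE0; ring.
    under eq_integral do rewrite Eh.
    apply: le_trans T _; rewrite lee_fin !sqrrN.
    have m1 := ler_wpM2r (ltW del0) (le_kk _ hc1); have m2 := ler_wpM2r (ltW del0) (le_kk _ hc2).
    by move: m1 m2; clear; lra.
  apply: le_trans (interpolation_compare e01 hu AH0 h0 lh ch cH hE hth) _.
  by rewrite lee_fin.
have k1 : `|1 : R| <= kk by rewrite normr1 /kk; lra.
have k2 : `|s / kt| <= kk by rewrite gtr0_norm // /kk; lra.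
split.
  apply: (key _ 1 1) => //; first by move=> x; rewrite !mul1r; case: (QE x tau).
  move=> N; apply: le_trans (err N); rewrite ler_wpM2l ?(ltW ep) //; apply: ler_zsum => j _.
  by rewrite /two_waves_q !phaseE !mul1r lerDl sqr_ge0.
apply: (key _ (s / kt) (- (s / kt))) => //.
- by rewrite normrN.
- by move=> x; rewrite mulNr -mulrBr; case: (QE x tau).
move=> N; apply: le_trans (err N); rewrite ler_wpM2l ?(ltW ep) //; apply: ler_zsum => j _.
by rewrite /two_waves_p !phaseE mulNr -mulrBr lerDr sqr_ge0.
Qed.

End Limit.

(** * From the random lattice to the deterministic estimate *)

Section Assembly.
Variable R : realType.
Local Notation mu := (@lebesgue_measure R).

Lemma Lnorm2_lty_integral (g : R -> R) : ('N[mu]_2%:E[(fun x => (g x)%:E)] < +oo)%E ->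
  exists S : R, (\int[mu]_x (g x ^+ 2)%:E <= S%:E)%E.
Proof.
move=> h; have := poweR_Lnorm mu (fun x => (g x)%:E) (_ : 2 != 0 :> R).
have -> : (\int[mu]_x (`|(g x)%:E| `^ 2))%E = (\int[mu]_x (g x ^+ 2)%:E)%E.
  apply: eq_integral => x _; rewrite abse_EFin poweR_EFin powR_mulrn // real_normK //; exact: num_real.
move=> /(_ _)/wrap[]; first by rewrite pnatr_eq0.
have := Lnorm_ge0 mu 2%:E (fun x => (g x)%:E); move: h.
case: ('N[mu]_2%:E[_])%E => [r||] // _ _ <-.
by rewrite poweR_EFin; exists (r `^ 2).
Qed.

Lemma ln_expR1_ge1 (x : R) : 0 <= x -> 1 <= ln (x + expR 1).
Proof. by move=> x0; rewrite -[X in X <= _](expRK 1) ler_ln ?posrE ?ltr_wpDl ?expR_gt0 // lerDr. Qed.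

Lemma lil_weight_sqr_ge1 (x : R) : 1 <= lil_weight x ^+ 2.
Proof.
have h : 0 <= `|x| * ln (ln (`|x| + expR 1)).
  by rewrite mulr_ge0 // ln_ge0 // ln_expR1_ge1.
by rewrite /lil_weight sqr_sqrtr ?lerDl // addr_ge0.
Qed.

Lemma measurable_lil_weight : measurable_fun [set: R] (@lil_weight R).
Proof.
have mn : measurable_fun [set: R] (fun x : R => `|x|) by exact: measurableT_comp.
apply: (measurableT_comp (continuous_measurable_fun (@sqrt_continuous R))).
apply: measurable_funD => //; apply: measurable_funM => //.
have mnE : measurable_fun [set: R] (fun x : R => `|x| + expR 1) by exact: measurable_funD.
exact: (measurableT_comp (@measurable_ln R) (measurableT_comp (@measurable_ln R) mnE)).
Qed.

(** The weight is at least one, so the weighted norms dominate the plain L^2 norms of F and of its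
    first weak derivative; the latter provides the modulus. *)
Lemma HLIL_sqr_integrable (F : R -> R) (s : nat) : (0 < s)%N -> HLIL s F -> continuous F ->
  exists S V : R, (\int[mu]_x (F x ^+ 2)%:E <= S%:E)%E /\ quadratic_modulus F V.
Proof.
move=> s0 [_ [DF [DF0 wDF nDF]]] cF.
have term i : (i <= s)%N -> ('N[mu]_2%:E[(fun x => (lil_weight x * DF i x)%:E)] < +oo)%E.
  move=> si; apply: le_lt_trans nDF; rewrite /HLIL_norm (bigD1 (Ordinal (si : (i < s.+1)%N))) //=.
  by rewrite leeDl // sume_ge0 // => j _; exact: Lnorm_ge0.
have bound i : (i <= s)%N -> measurable_fun [set: R] (DF i) ->
    exists S : R, (\int[mu]_x (DF i x ^+ 2)%:E <= S%:E)%E.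
  move=> si mD; have [S hS] := Lnorm2_lty_integral (term i si).
  exists S; apply: le_trans hS; apply: ge0_le_integral => //.
  - by move=> x _; rewrite lee_fin sqr_ge0.
  - by apply/measurable_EFinP; exact: measurable_funX.
  - apply/measurable_EFinP; apply: measurable_funX; apply: measurable_funM => //.
    exact: measurable_lil_weight.
  - by move=> x _; rewrite lee_fin exprMn ler_peMl ?sqr_ge0 // lil_weight_sqr_ge1.
have w1 := wDF 1%N s0; have [[mD1 _ _] _] := w1.
have [V hV] := bound 1%N s0 mD1.
have [S hS] := bound 0%N (leq0n _) (ltac:(rewrite DF0; exact: continuous_measurable_fun)).
rewrite DF0 in hS; exists S, V; split => //.
exact: quadratic_modulus_weak cF w1 hV.
Qed.

Lemma ell2_bounded (f : int -> R) : ell2 f -> exists M, ell2_bnd f M.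
Proof.
move=> hf; pose E := (\esum_(j in [set: int]) ((f j) ^+ 2)%:E)%E.
have E0 : (0 <= E)%E by apply: esum_ge0 => j _; rewrite lee_fin sqr_ge0.
exists (fine E) => N; rewrite -lee_fin fineK ?ge0_fin_numE //.
pose r := [seq i%:Z - N%:Z | i <- iota 0 N.*2.+1].
have ur : uniq r.
  by rewrite map_inj_uniq ?iota_uniq // => i j /addIr[].
apply: esum_ge; exists [set` r]; first by split => //; exact: finite_seq.
rewrite -fsbig_seq // /r big_map sumEFin lee_fin.
by rewrite -[iota 0 _]/(index_iota 0 N.*2.+1) big_mkord zsumE.
Qed.

(** Averages of numbers at least a stay at least a, so the bound on the mean is read off a single
    realisation, without going back to the expectation. *)
Lemma slln_mean_ge (X : int -> R) (a mu0 : R) : (forall n : nat, a <= X n%:Z) ->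
  (forall d : R, 0 < d -> exists C : R, forall n, `|\sum_(i < n) (X i%:Z - mu0)| <= d * n%:R + C) ->
  a <= mu0.
Proof.
move=> aX hX; suff key (d : R) : 0 < d -> a <= mu0 + d by apply/ler_addgt0Pr => d /key.
move=> d0; have [C hC] := hX d d0.
case: (leP a (mu0 + d)) => // h; exfalso.
pose x := a - mu0 - d; have x0 : 0 < x by rewrite /x; lra.
pose n := (Num.truncn (C / x)).+1.
have nC : C < n%:R * x by rewrite -ltr_pdivrMr // /n; apply: truncnS_gt.
have s1 : n%:R * (a - mu0) <= \sum_(i < n) (X i%:Z - mu0).
  rewrite mulr_natl -[X in _ *+ X](card_ord n) -sumr_const; apply: ler_sum => i _.
  by rewrite lerD2r.
have := le_trans s1 (le_trans (ler_norm _) (hC n)).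
by move: nC; rewrite /x; lra.
Qed.

Lemma sublinear_slln (X : int -> R) (mu0 : R) : 0 < mu0 ->
  (forall d : R, 0 < d -> exists C : R, forall n, `|\sum_(i < n) (X i%:Z - mu0)| <= d * n%:R + C) ->
  (forall d : R, 0 < d -> exists C : R, forall n, `|\sum_(i < n) (X (Negz i) - mu0)| <= d * n%:R + C) ->
  sublinear (corrector (fun j => X j / mu0 - 1)).
Proof.
move=> m0 hp hn; have m0' : mu0 != 0 by rewrite gt_eqF.
have scale (idx : nat -> int) :
  (forall d : R, 0 < d -> exists C : R, forall n, `|\sum_(i < n) (X (idx i) - mu0)| <= d * n%:R + C) ->
  forall d : R, 0 < d -> exists C : R, forall n, `|\sum_(i < n) (X (idx i) / mu0 - 1)| <= d * n%:R + C.
  move=> h d d0; have [C hC] := h (d * mu0) (mulr_gt0 d0 m0).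
  exists (C / mu0) => n.
  have -> : \sum_(i < n) (X (idx i) / mu0 - 1) = (\sum_(i < n) (X (idx i) - mu0)) / mu0.
    by rewrite mulr_suml; apply: eq_bigr => i _; rewrite mulrBl divff.
  rewrite normrM normfV (gtr0_norm m0) ler_pdivrMr // mulrDl divfK //.
  by rewrite mulrAC; exact: hC.
by apply: corrector_sublinear; [exact: (scale Posz)|exact: (scale Negz)].
Qed.

Lemma lattice_solution_free (m k r0 p0 : int -> R) (r p : int -> R -> R) (K : R) :
  (forall j, k j != 0) -> (forall j, `|k j| <= K) -> lattice_solution m k r0 p0 r p ->
  let q j t := k j * r j t in
  [/\ free_lattice (fun j => (k j)^-1) m q p, forall t, exists M, ell2_le q p t M &
      forall j, q j 0 = k j * r0 j /\ p j 0 = p0 j].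
Proof.
move=> k0 kK [l2 hr hp init] q; split.
- split=> j t; rewrite addr0; last exact: hp.
  by rewrite invrK; exact: derZ (hr j t).
- move=> t; have [/ell2_bounded[M1 h1] /ell2_bounded[M2 h2]] := l2 t.
  exists (K ^+ 2 * M1 + M2) => N; rewrite zsumD lerD //.
  apply: (@le_trans _ _ (zsum N (fun j => K ^+ 2 * r j t ^+ 2))).
    apply: ler_zsum => j _; rewrite /q exprMn ler_wpM2r ?sqr_ge0 //; exact: sqr_norm_le.
  by rewrite zsumZ ler_wpM2l ?sqr_ge0.
- by move=> j; have [e1 e2] := init j; rewrite /q e1 e2.
Qed.

End Assembly.

Theorem theorem5p3 (d : measure_display) (T : measurableType d) (R : realType)
  (Pr : probability T R)
  (m k : int -> T -> R) (a_m b_m a_k b_k mbar ktilde : R)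
  (m_iid : iid Pr m)
  (kinv_iid : iid Pr (fun j w => (k j w)^-1))
  (a_m_gt0 : 0 < a_m) (a_k_gt0 : 0 < a_k)
  (m_bnd : forall j, {ae Pr, forall w, a_m <= m j w <= b_m})
  (kinv_bnd : forall j, {ae Pr, forall w, a_k <= (k j w)^-1 <= b_k})
  (mbarE : mbar%:E = ('E_Pr[m 0%R])%E)
  (ktildeE : (ktilde^-1)%:E = ('E_Pr[(fun w => (k 0 w)^-1)%R])%E)
  (Phi Psi : R -> R)
  (Phi_HLIL : HLIL 3 Phi) (Psi_HLIL : HLIL 3 Psi)
  (Phi_cont : continuous Phi) (Psi_cont : continuous Psi)
  (T0 : R) (T0_gt0 : 0 < T0)
  (Q0 P0 : R -> R -> R)
  (Q0P0_sol : wave_solution ktilde mbar Phi Psi Q0 P0) :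
  {ae Pr, forall w,
    forall r p : R -> int -> R -> R,
    (forall eps, 0 < eps ->
       lattice_solution (m ^~ w) (k ^~ w)
         (fun j => Phi (eps * j%:~R) / k j w) (fun j => Psi (eps * j%:~R))
         (r eps) (p eps)) ->
    let Q eps X tau :=
      interpolation (fun j => k j w * r eps j (tau / eps)) (X / eps) in
    let P eps X tau :=
      interpolation (fun j => p eps j (tau / eps)) (X / eps) in
    ereal_sup
      [set (L2norm (fun X => (Q eps X tau - (Q0 X tau)%:C)%R)
            + L2norm (fun X => (P eps X tau - (P0 X tau)%:C)%R))%E
        | tau in [set tau : R | (`|tau| <= T0)%R]]
      @[eps --> 0^'+] --> 0%E}.
Proof.
have posz_inj : injective Posz by move=> i j [].
have negz_inj : injective Negz by move=> i j [].
have [S1 [V [iPhi qPhi]]] := HLIL_sqr_integrable (isT : (0 < 3)%N) Phi_HLIL Phi_cont.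
have [S2 [W [iPsi qPsi]]] := HLIL_sqr_integrable (isT : (0 < 3)%N) Psi_HLIL Psi_cont.
have ae_int (X : int -> T -> R) (a b : R) : (forall j, {ae Pr, forall w, a <= X j w <= b}) ->
    {ae Pr, forall w, forall j, a <= X j w <= b}.
  move=> hX; have /ae_foralln hp := fun n => hX (Posz n); have /ae_foralln hn := fun n => hX (Negz n).
  by move: hp hn; apply: filterS2 => w hp hn [n|n].
pose averages (X : int -> T -> R) (mu0 : R) (idx : nat -> int) (w : T) := forall delta : R, 0 < delta ->
  exists C, forall n, `|\sum_(i < n) (X (idx i) w - mu0)| <= delta * n%:R + C.
have ae_slln (X : int -> T -> R) (a b mu0 : R) : iid Pr X ->
    (forall j, {ae Pr, forall w, a <= X j w <= b}) -> mu0%:E = ('E_Pr[X 0%R])%E ->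
    {ae Pr, forall w, averages X mu0 Posz w /\ averages X mu0 Negz w}.
  move=> h1 h2 h3; have hp := slln_iid h1 h2 h3 posz_inj; have hn := slln_iid h1 h2 h3 negz_inj.
  by move: hp hn; apply: filterS2.
have bnds : {ae Pr, forall w, (forall j, a_m <= m j w <= b_m) /\ (forall j, a_k <= (k j w)^-1 <= b_k)}.
  by move: (ae_int _ _ _ m_bnd) (ae_int _ _ _ kinv_bnd); apply: filterS2.
move: bnds (ae_slln _ _ _ _ m_iid m_bnd mbarE) (ae_slln _ _ _ _ kinv_iid kinv_bnd ktildeE).
(* The almost sure event: bounds at all sites and averages on both half-lines, for m and for 1/k. It
   involves neither eps nor the solution, so one event serves all of them. *)
apply: filterS3 => w [mw kw] [h1 h2] [h3 h4] r p sol Q P.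
have mbar0 : 0 < mbar.
  apply: lt_le_trans a_m_gt0 _; apply: (@slln_mean_ge _ (m ^~ w)) h1 => n.
  by have /andP[] := mw n.
have kt0 : 0 < ktilde.
  rewrite -invr_gt0; apply: lt_le_trans a_k_gt0 _.
  apply: (@slln_mean_ge _ (fun j => (k j w)^-1)) h3 => n.
  by have /andP[] := kw n.
have k0 j : 0 < k j w by rewrite -invr_gt0; have /andP[h _] := kw j; exact: lt_le_trans h.
pose lo := Num.min a_m a_k; pose hi := Num.max b_m b_k.
have lo0 : 0 < lo by rewrite lt_min a_m_gt0.
have hk j : lo <= (k j w)^-1 <= hi.
  by have /andP[l h] := kw j; rewrite ge_min l orbT le_max h orbT.
have hm j : lo <= m j w <= hi by have /andP[l h] := mw j; rewrite ge_min l le_max h.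
pose chi := corrector (fun j => (k j w)^-1 / ktilde^-1 - 1).
(* Here a backward difference is to be inverted, hence the shift by one site. *)
pose zeta j := corrector (fun j => m j w / mbar - 1) (j + 1).
have hchi j : chi (j + 1) - chi j = ktilde * (k j w)^-1 - 1.
  by rewrite correctorE invrK mulrC.
have hzeta j : zeta j - zeta (j - 1) = m j w / mbar - 1.
  by rewrite /zeta subrK correctorE.
have sch : sublinear chi.
  by apply: (@sublinear_slln _ (fun j => (k j w)^-1)); rewrite ?invr_gt0.
have sze : sublinear zeta.
  by apply: sublinear_shift; apply: (@sublinear_slln _ (m ^~ w)).
have lim := homogenization_limit lo0 hk hm kt0 mbar0 T0_gt0 hchi hzeta sch sze Phi_cont Psi_cont
  qPhi qPsi iPhi iPsi Q0P0_sol.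
apply: cvge0_le.
  (* The supremum over an empty set would be -oo; the time 0 belongs to the set, so the supremum is
     nonnegative. *)
  move=> e; have zero_in : [set tau : R | (`|tau| <= T0)%R] 0 by rewrite /= normr0 ltW.
  apply: le_trans (ereal_sup_ubound (ex_intro2 _ _ 0 zero_in erefl)).
  by apply: adde_ge0; exact: Lnorm_ge0.
move=> e e0; have e2 : 0 < e / 2 by rewrite divr_gt0.
(* [L2norm_le] compares squares: the accuracy (e / 2)^2 gives e / 2 for each of the two norms. *)
have [e1 e10 he] := lim ((e / 2) ^+ 2) (exprn_gt0 2 e2).
near=> eps.
have eps0 : 0 < eps by near: eps; exact: nbhs_right_gt.
have eps1 : eps <= e1 by near: eps; exact: nbhs_right_le.
have kn0 j : k j w != 0 by rewrite gt_eqF.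
have kK j : `|k j w| <= a_k^-1.
  by rewrite gtr0_norm // -[k j w]invrK lef_pV2 ?posrE ?invr_gt0 //; have /andP[] := kw j.
have [fr el init] := lattice_solution_free kn0 kK (sol eps eps0).
have init' j : k j w * r eps j 0 = Phi (eps * j%:~R) /\ p eps j 0 = Psi (eps * j%:~R).
  by have [-> ->] := init j; rewrite mulrC divfK.
apply: ge_ereal_sup => _ [tau htau <-].
have [hQ hP] := he eps eps0 eps1 _ _ fr el init' tau htau.
rewrite (_ : e%:E = (e / 2)%:E + (e / 2)%:E)%E; last by rewrite -EFinD -splitr.
rewrite -(L2norm_le _ (ltW e2)) in hQ; rewrite -(L2norm_le _ (ltW e2)) in hP.
exact: (leeD hQ hP).
Unshelve. all: by end_near. Qed.
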